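(* Let $\mathsf{G}_0,\mathsf{G}_1\in\mathcal{M}(\Omega,\mathbb{S}^n_+)$, fix $\Lambda_2\in\mathbb{S}^n_{++}$, and for $\Lambda=(\Lambda_1,\Lambda_2)$ with $\Lambda_1\in\mathbb{S}^k_+$ let $\mu_{*,\Lambda}$ denote a minimizer of $\mathrm{WB}_\Lambda^2(\mathsf{G}_0,\mathsf{G}_1)=\inf\{\mathcal{J}_{\Lambda,Q}(\mu):\mu\in\mathcal{CE}([0,1];\mathsf{G}_0,\mathsf{G}_1)\}$. Then $$\mathrm{WB}^2_{(\Lambda_1,\Lambda_2)}(\mathsf{G}_0,\mathsf{G}_1)\to\mathrm{WB}^2_{(0,\Lambda_2)}(\mathsf{G}_0,\mathsf{G}_1)\quad\text{as }\|\Lambda_1\|_{\mathrm F}\to0,$$ and for any sequence $\{\Lambda_{1,j}\}_{j\in\mathbb{N}}\subset\mathbb{S}^k_+$ with $\|\Lambda_{1,j}\|_{\mathrm F}\to0$, the associated minimizers $\mu_{*,(\Lambda_{1,j},\Lambda_2)}$, up to a subsequence, weak* converge in $\mathcal{M}(Q,\mathbb{X})$ to a minimizer $\mu_*$ of $\mathrm{WB}^2_{(0,\Lambda_2)}(\mathsf{G}_0,\mathsf{G}_1)$.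
   Context: Matrices: $\mathbb{S}^n,\mathbb{S}^n_+,\mathbb{S}^n_{++}$ are the real symmetric, positive semidefinite, positive definite $n\times n$ matrices; $\mathbb{M}^n=\mathbb{R}^{n\times n}$; $A\cdot B=\mathrm{Tr}(A^{\mathrm T}B)$, $\|A\|_{\mathrm F}=\sqrt{A\cdot A}$; $A^\dagger$ is the pseudoinverse; $\mathrm{Ran}$ is the range. $\mathcal{M}(\mathcal{X},V)$ denotes finite $V$-valued Radon measures on a compact metric space $\mathcal{X}$; weak* convergence is tested against continuous functions. Action: $n,k,d$ are positive integers and $\mathbb{X}=\mathbb{S}^n\times\mathbb{R}^{n\times k}\times\mathbb{M}^n$. For $\Lambda=(\Lambda_1,\Lambda_2)$ with $\Lambda_1\in\mathbb{S}^k_+$, $\Lambda_2\in\mathbb{S}^n_{++}$, define $J_\Lambda(X,Y,Z)=\frac12(Y\Lambda_1^\dagger)\cdot(X^\dagger Y\Lambda_1^\dagger)+\frac12(Z\Lambda_2^{-1})\cdot(X^\dagger Z\Lambda_2^{-1})$ if $X\in\mathbb{S}^n_+$, $\mathrm{Ran}(Y^{\mathrm T})\subset\mathrm{Ran}(\Lambda_1)$ and $\mathrm{Ran}([Y,Z])\subset\mathrm{Ran}(X)$, and $+\infty$ otherwise (so for $\Lambda_1=0$ finiteness forces $Y=0$). For $\mu=(\mathsf{G},\mathsf{q},\mathsf{R})\in\mathcal{M}(\mathcal{X},\mathbb{X})$, $\mathcal{J}_{\Lambda,\mathcal{X}}(\mu)=\int_{\mathcal{X}}J_\Lambda(\frac{\mathrm{d}\mu}{\mathrm{d}\lambda})\,\mathrm{d}\lambda$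 for any nonnegative finite Radon $\lambda$ with $|\mu|\ll\lambda$ (independent of $\lambda$). Continuity equation: $\Omega\subset\mathbb{R}^d$ is compact with nonempty interior and smooth boundary; $Q=[0,1]\times\Omega$. $\mathsf{D}^*$ is a first-order constant-coefficient linear differential operator from $\mathbb{S}^n$-valued to $\mathbb{R}^{n\times k}$-valued functions on $\mathbb{R}^d$ with $\mathsf{D}^*(I)=0$; i.e. $\mathsf{D}^*\Phi=L_0(\Phi)+\sum_{j=1}^dL_j(\partial_{x_j}\Phi)$ with linear $L_j:\mathbb{S}^n\to\mathbb{R}^{n\times k}$ and $L_0(I)=0$; on functions of $(t,x)$ it acts in $x$. $C^1(Q,\mathbb{S}^n)$: derivatives exist in the interior and extend continuously to the boundary. $\Phi_t=\Phi(t,\cdot)$. $\mathcal{CE}([0,1];\mathsf{G}_0,\mathsf{G}_1)$ is the set of $\mu=(\mathsf{G},\mathsf{q},\mathsf{R})\in\mathcal{M}(Q,\mathbb{X})$ with $$\int_Q\partial_t\Phi\cdot\mathrm{d}\mathsf{G}+\mathsf{D}^*\Phi\cdot\mathrm{d}\mathsf{q}+\Phi\cdot\mathrm{d}\mathsf{R}=\int_\Omega\Phi_1\cdot\mathrm{d}\mathsf{G}_1-\int_\Omega\Phi_0\cdot\mathrm{d}\mathsf{G}_0\quad\forall\Phi\in C^1(Q,\mathbb{S}^n).$$ Minimizers of $\mathrm{WB}^2_\Lambda(\mathsf{G}_0,\mathsf{G}_1)$ always exist. *)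

(* Defs.v *)
From HB Require Import structures.
From mathcomp Require Import all_boot all_order all_algebra.
From mathcomp Require Import all_classical all_reals all_analysis.

Set Implicit Arguments.
Unset Strict Implicit.
Unset Printing Implicit Defensive.

Import Order.TTheory GRing.Theory Num.Theory.
Import numFieldNormedType.Exports.

Local Open Scope classical_set_scope.
Local Open Scope ring_scope.
Local Open Scope charge_scope.

Section matrices.
Context {R : realType}.

Definition psd_mx n (X : 'M[R]_n) : Prop :=
  X^T = X /\ forall u : 'cV[R]_n, 0 <= (u^T *m X *m u) 0 0.

Definition pd_mx n (X : 'M[R]_n) : Prop :=
  X^T = X /\ forall u : 'cV[R]_n, u != 0 -> 0 < (u^T *m X *m u) 0 0.

Definition mxdot m n (A B : 'M[R]_(m, n)) : R := \tr (A^T *m B).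

Definition frobenius m n (A : 'M[R]_(m, n)) : R := Num.sqrt (mxdot A A).

Definition penrose m n (A : 'M[R]_(m, n)) (B : 'M[R]_(n, m)) : Prop :=
  [/\ A *m B *m A = A, B *m A *m B = B,
      (A *m B)^T = A *m B & (B *m A)^T = B *m A].

(* Moore-Penrose pseudoinverse; MathComp's pinvmx is only a partial inverse. *)
Definition mp_pinv m n (A : 'M[R]_(m, n)) : 'M[R]_(n, m) :=
  xget 0 [set B | penrose A B].

Lemma row_free_gram m n (A : 'M[R]_(m, n)) :
  row_free A -> A *m A^T \in unitmx.
Proof.
move=> fA; rewrite -row_free_unit; apply/row_freeP.
suff : row_free (A *m A^T) by move/row_freeP.
rewrite -kermx_eq0; apply/eqP/row_matrixP => i; rewrite row0.
set v := row i _; have vA : v *m (A *m A^T) = 0.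
  by apply/sub_kermxP; rewrite row_sub.
suff vA0 : v *m A = 0.
  by apply: (row_free_inj fA); rewrite vA0 mul0mx.
have : \tr ((v *m A) *m (v *m A)^T) = 0.
  by rewrite trmx_mul mulmxA -(mulmxA v) vA mul0mx mxtrace0.
rewrite /mxtrace big_ord1 mxE => /eqP.
rewrite psumr_eq0; last by move=> j _; rewrite [_^T _ _]mxE -expr2 sqr_ge0.
move=> /allP H; apply/rowP => j; rewrite [RHS]mxE.
by have := H j (mem_index_enum _); rewrite [_^T _ _]mxE -expr2 sqrf_eq0 => /eqP.
Qed.

Lemma penrose_unique m n (A : 'M[R]_(m, n)) B C :
  penrose A B -> penrose A C -> B = C.
Proof.
move=> [ABA BAB sAB sBA] [ACA CAC sAC sCA].
have e1 : A *m B = A *m C.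
  rewrite -{1}ACA -(mulmxA (A *m C)) -sAC -sAB -trmx_mul.
  by rewrite mulmxA ABA sAC.
have e2 : B *m A = C *m A.
  rewrite -{1}ACA -(mulmxA A) mulmxA -sBA -sCA -trmx_mul.
  by rewrite -mulmxA (mulmxA A) ABA.
by rewrite -BAB -mulmxA e1 mulmxA e2 CAC.
Qed.

Lemma penrose_factor m n r (C : 'M[R]_(m, r)) (D : 'M[R]_(r, n)) :
  row_full C -> row_free D ->
  penrose (C *m D)
    (D^T *m invmx (D *m D^T) *m invmx (C^T *m C) *m C^T).
Proof.
move=> fC fD.
have uD : D *m D^T \in unitmx by exact: row_free_gram.
have uC : C^T *m C \in unitmx.
  rewrite -{2}[C]trmxK; apply: row_free_gram.
  by rewrite /row_free mxrank_tr.
set P := invmx (D *m D^T); set Q := invmx (C^T *m C).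
have sP : P^T = P by rewrite /P trmx_inv trmx_mul trmxK.
have sQ : Q^T = Q by rewrite /Q trmx_inv trmx_mul trmxK.
have AB : C *m D *m (D^T *m P *m Q *m C^T) = C *m Q *m C^T.
  by rewrite !mulmxA -(mulmxA C D) -(mulmxA C (D *m D^T)) mulmxV // mulmx1.
have BA : (D^T *m P *m Q *m C^T) *m (C *m D) = D^T *m P *m D.
  rewrite !mulmxA -(mulmxA _ C^T C) -(mulmxA _ Q).
  by rewrite mulVmx // mulmx1.
split.
- rewrite AB !mulmxA -(mulmxA _ C^T C) -(mulmxA C Q).
  by rewrite mulVmx // mulmx1.
- rewrite BA !mulmxA -(mulmxA _ D D^T) -(mulmxA D^T P (D *m D^T)).
  by rewrite mulVmx // mulmx1.
- by rewrite AB !trmx_mul trmxK sQ mulmxA.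
- by rewrite BA !trmx_mul trmxK sP mulmxA.
Qed.

Lemma mp_pinvP m n (A : 'M[R]_(m, n)) : penrose A (mp_pinv A).
Proof.
rewrite /mp_pinv; case: xgetP => [B _ //|noB].
exfalso; move: noB; rewrite -{1}[A]mulmx_base => noB; apply: (noB _).
by apply: penrose_factor; [exact: col_base_full|exact: row_base_free].
Qed.

(* Ran A is the column space, hence the transposes. *)
Definition ran_sub m n p (A : 'M[R]_(m, n)) (B : 'M[R]_(m, p)) : bool :=
  (A^T <= B^T)%MS.


Definition J_density n k (L1 : 'M[R]_k) (L2 : 'M[R]_n)
    (X : 'M[R]_n) (Y : 'M[R]_(n, k)) (Z : 'M[R]_n) : \bar R :=
  if `[< [/\ psd_mx X, ran_sub Y^T L1 & ran_sub (row_mx Y Z) X] >] then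
    (2^-1 * mxdot (Y *m mp_pinv L1) (mp_pinv X *m (Y *m mp_pinv L1)) +
     2^-1 * mxdot (Z *m invmx L2) (mp_pinv X *m (Z *m invmx L2)))%:E
  else +oo%E.

(* [L1 --> 0] inside the cone of positive semidefinite matrices. *)
Definition psd_to0 k : set_system 'M[R]_k :=
  filter_from [set e : R | 0 < e]
    (fun e => [set L1 | psd_mx L1 /\ frobenius L1 < e]).

End matrices.

Arguments psd_to0 {R} k.

HB.instance Definition _ (X Y : ptopologicalType) := Pointed.on (X * Y)%type.

Definition borel (X : ptopologicalType) := g_sigma_algebraType (@open X).

(* On a compact subset of a Euclidean space every finite signed Borel measure
   is Radon, so Radon measures are the library's charges on the Borel sets.
   Measures on a compact [D] are represented by charges on the ambient space
   that vanish outside [D]. *)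
Section charges.
Context d (T : measurableType d) {R : realType}.
Implicit Types nu : {charge set T -> \bar R}.

Lemma hahn_ex nu : exists PN : set T * set T, hahn_decomposition nu PN.1 PN.2.
Proof. by have [P [N PN]] := Hahn_decomposition nu; exists (P, N). Qed.

Definition hahn nu := svalP (cid (hahn_ex nu)).

Definition cintegral nu (D : set T) (f : T -> R) : R :=
  \int[jordan_pos (hahn nu)]_(x in D) f x -
  \int[jordan_neg (hahn nu)]_(x in D) f x.

Definition concentrated nu (D : set T) : Prop :=
  forall A, measurable A -> nu A = nu (A `&` D).

Definition mxcharge m n := 'I_m -> 'I_n -> {charge set T -> \bar R}.

Definition mxvalue m n (nu : mxcharge m n) (A : set T) : 'M[R]_(m, n) :=
  \matrix_(i, j) fine (nu i j A).

Definition mxintegral m n (nu : mxcharge m n) (D : set T)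
    (F : T -> 'M[R]_(m, n)) : R :=
  \sum_i \sum_j cintegral (nu i j) D (fun x => F x i j).

Definition mxRN m n (nu : mxcharge m n)
    (la : {sigma_finite_measure set T -> \bar R}) (x : T) : 'M[R]_(m, n) :=
  \matrix_(i, j) fine (('d (nu i j) '/d la) x).

Record Xcharge n k := XCharge {
  XG : mxcharge n n ;
  Xq : mxcharge n k ;
  XR : mxcharge n n }.

Definition in_MX n k (mu : Xcharge n k) (D : set T) : Prop :=
  [/\ forall i j, concentrated (XG mu i j) D,
      forall i j, concentrated (Xq mu i j) D,
      forall i j, concentrated (XR mu i j) D &
      forall A, measurable A -> (mxvalue (XG mu) A)^T = mxvalue (XG mu) A].

Definition in_MSplus n (G : mxcharge n n) (D : set T) : Prop :=
  (forall i j, concentrated (G i j) D) /\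
  forall A, measurable A -> psd_mx (mxvalue G A).

(* Sum of the total variations of all the coordinates of [mu]; it is equivalent
   (in the sense of mutual absolute continuity) to the total variation |mu|. *)
Section variation.
Context n k (mu : Xcharge n k).
Local Open Scope ereal_scope.

Definition coords : seq ({charge set T -> \bar R}) :=
  [seq XG mu p.1 p.2 | p <- index_enum ('I_n * 'I_n)%type] ++
  [seq Xq mu p.1 p.2 | p <- index_enum ('I_n * 'I_k)%type] ++
  [seq XR mu p.1 p.2 | p <- index_enum ('I_n * 'I_n)%type].

Definition variation (A : set T) : \bar R :=
  \sum_(nu <- coords) charge_variation (hahn nu) A.

Let variation0 : variation set0 = 0.
Proof. by rewrite /variation big1. Qed.

Let variation_ge0 A : 0 <= variation A.
Proof. by rewrite /variation; apply: sume_ge0. Qed.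

Let sum_sigma_additive (I : Type) (s : seq I)
    (m : I -> {measure set T -> \bar R}) :
  semi_sigma_additive (fun A => \sum_(i <- s) m i A).
Proof.
elim: s => [|i s IHs] F mF tF mUF.
  rewrite big_nil [X in X @ _ --> _](_ : _ = cst 0); first exact: cvg_cst.
  by apply/funext => x; rewrite big1// => j _; rewrite big_nil.
rewrite big_cons.
rewrite [X in X @ _ --> _](_ : _ = (fun x => \sum_(0 <= j < x) m i (F j)) \+
    (fun x => \sum_(0 <= j < x) \sum_(i0 <- s) m i0 (F j))); last first.
  by apply/funext => x; rewrite /= -big_split; apply: eq_bigr => j _;
    rewrite big_cons.
apply: cvgeD => /=; [|exact: measure_semi_sigma_additive|exact: IHs].
by rewrite ge0_adde_def// inE//; exact: sume_ge0.
Qed.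

Let variation_sigma_additive : semi_sigma_additive variation.
Proof.
exact: (@sum_sigma_additive _ coords (fun nu => charge_variation (hahn nu))).
Qed.

HB.instance Definition _ := isMeasure.Build _ _ _ variation
  variation0 variation_ge0 variation_sigma_additive.

Let variation_fin : fin_num_fun variation.
Proof.
move=> A mA; rewrite /variation.
apply: (big_ind (fun x : \bar R => x \is a fin_num)) => // [x y|nu _].
  by rewrite fin_numD => -> ->.
exact: fin_num_measure.
Qed.

HB.instance Definition _ := @Measure_isFinite.Build _ _ _
  variation variation_fin.

Lemma variation_dominates :
  [/\ forall i j, XG mu i j `<< variation, forall i j, Xq mu i j `<< variation &
      forall i j, XR mu i j `<< variation].
Proof.
suff H (I : finType) (f : I -> {charge set T -> \bar R}) i :
    (forall A, \sum_(i : I) charge_variation (hahn (f i)) A <= variation A) ->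
    f i `<< variation.
  have ge0 (I : finType) (f : I -> {charge set T -> \bar R}) A :
      0 <= \sum_(i : I) charge_variation (hahn (f i)) A by exact: sume_ge0.
  split=> i j; [pose f (p : 'I_n * 'I_n) := XG mu p.1 p.2|
    pose f (p : 'I_n * 'I_k) := Xq mu p.1 p.2|
    pose f (p : 'I_n * 'I_n) := XR mu p.1 p.2]; apply: (H _ f (i, j)) => A;
    rewrite /variation !big_cat !big_map /=.
  - by rewrite leeDl// adde_ge0//; exact: ge0.
  - rewrite addeCA leeDl// adde_ge0//.
      exact: (ge0 _ (fun p => XG mu p.1 p.2)).
    exact: (ge0 _ (fun p => XR mu p.1 p.2)).
  - rewrite addeA leeDr// adde_ge0//.
      exact: (ge0 _ (fun p => XG mu p.1 p.2)).
    exact: (ge0 _ (fun p => Xq mu p.1 p.2)).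
move=> fle; apply/null_content_dominatesP => A mA vA0.
apply/eqP; rewrite -abse_eq0 eq_le abse_ge0 andbT -vA0.
rewrite (le_trans (abse_charge_variation (hahn (f i)) mA))//.
rewrite (le_trans _ (fle A))// (bigD1 i)//= leeDl//.
exact: sume_ge0.
Qed.

End variation.

Section action.
Context n k (L1 : 'M[R]_k) (L2 : 'M[R]_n).

Definition action_wrt (la : {finite_measure set T -> \bar R})
    (mu : Xcharge n k) (D : set T) : \bar R :=
  (\int[la]_(x in D)
     J_density L1 L2 (mxRN (XG mu) la x) (mxRN (Xq mu) la x)
       (mxRN (XR mu) la x))%E.

(* [J_density] is positively 1-homogeneous, so every dominating measure gives
   the same value; [variation mu] is the canonical one. *)
Definition action (mu : Xcharge n k) (D : set T) : \bar R :=
  action_wrt (variation mu) mu D.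

End action.

End charges.

Definition weak_star_cvg (X : ptopologicalType) (R : realType) n k (D : set X)
    (mu_ : nat -> Xcharge (borel X) (R := R) n k)
    (mu : Xcharge (borel X) (R := R) n k) : Prop :=
  forall (F : X -> 'M[R]_n) (H : X -> 'M[R]_(n, k)) (K : X -> 'M[R]_n),
    {within D, continuous F} -> {within D, continuous H} ->
    {within D, continuous K} -> (forall x, D x -> (F x)^T = F x) ->
    mxintegral (XG (mu_ j)) D F + mxintegral (Xq (mu_ j)) D H +
      mxintegral (XR (mu_ j)) D K @[j --> \oo] -->
    mxintegral (XG mu) D F + mxintegral (Xq mu) D H + mxintegral (XR mu) D K.

Section euclidean.
Context {R : realType} (d : nat).

Fixpoint Cr (r : nat) (f : 'rV[R]_d -> R) : Prop :=
  if r is r'.+1 then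
    forall j, (forall x, derivable f x (delta_mx 0 j)) /\
              Cr r' ('D_(delta_mx 0 j) f)
  else continuous f.

Definition Cinfty (f : 'rV[R]_d -> R) : Prop := forall r, Cr r f.

(* Locally at each boundary point, [Omega] is a sublevel set of a smooth
   function with nonvanishing gradient. *)
Definition smooth_boundary (Omega : set 'rV[R]_d) : Prop :=
  forall x, (closure Omega `\` Omega^°) x ->
    exists (U : set 'rV[R]_d) (psi : 'rV[R]_d -> R),
      [/\ nbhs x U, Cinfty psi, exists j, 'D_(delta_mx 0 j) psi x != 0 &
          Omega `&` U = [set y | psi y <= 0] `&` U].

Definition cylinder (Omega : set 'rV[R]_d) : set (R * 'rV[R]_d) :=
  `[0, 1]%classic `*` Omega.

End euclidean.

Section continuity_equation.
Context {R : realType} (n k d : nat).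
Local Notation Xcharges := (Xcharge (borel (R * 'rV[R]_d)%type) (R := R) n k).
Implicit Types (Omega : set 'rV[R]_d) (Phi : R * 'rV[R]_d -> 'M[R]_n).

(* [dtPhi] and [dxPhi j] are the continuous extensions to [Q] of the partial
   derivatives of [Phi], which exist in the interior of [Q]. *)
Definition C1_sym (Q : set (R * 'rV[R]_d)) Phi
    (dtPhi : R * 'rV[R]_d -> 'M[R]_n)
    (dxPhi : 'I_d -> R * 'rV[R]_d -> 'M[R]_n) : Prop :=
  [/\ forall z, Q z -> (Phi z)^T = Phi z,
      {within Q, continuous Phi},
      {within Q, continuous dtPhi},
      forall j, {within Q, continuous (dxPhi j)} &
      forall z, Q^° z ->
        is_derive z ((1, 0) : R * 'rV[R]_d) Phi (dtPhi z) /\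
        forall j, is_derive z ((0, delta_mx 0 j) : R * 'rV[R]_d) Phi
                    (dxPhi j z)].

Section problem.
Context (L0 : {linear 'M[R]_n -> 'M[R]_(n, k)})
  (L : 'I_d -> {linear 'M[R]_n -> 'M[R]_(n, k)}).

(* A linear map on symmetric matrices is given as the restriction of a linear
   map on all matrices; only symmetric arguments are ever used. *)
Definition Dstar Phi (dxPhi : 'I_d -> R * 'rV[R]_d -> 'M[R]_n) (z : R * 'rV[R]_d) :
    'M[R]_(n, k) :=
  L0 (Phi z) + \sum_j L j (dxPhi j z).

Context Omega (G0 G1 : mxcharge (borel 'rV[R]_d) (R := R) n n).

Definition CE : set Xcharges :=
  [set mu : Xcharges | in_MX mu (cylinder Omega) /\
    forall Phi dtPhi dxPhi, C1_sym (cylinder Omega) Phi dtPhi dxPhi ->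
      mxintegral (XG mu) (cylinder Omega) dtPhi +
      mxintegral (Xq mu) (cylinder Omega) (Dstar Phi dxPhi) +
      mxintegral (XR mu) (cylinder Omega) Phi =
      mxintegral G1 Omega (fun x => Phi (1, x)) -
      mxintegral G0 Omega (fun x => Phi (0, x))].

Definition WB2 (L1 : 'M[R]_k) (L2 : 'M[R]_n) : \bar R :=
  ereal_inf [set action L1 L2 mu (cylinder Omega) | mu in CE].

Definition WB2_minimizer (L1 : 'M[R]_k) (L2 : 'M[R]_n) (mu : Xcharges) : Prop :=
  CE mu /\ action L1 L2 mu (cylinder Omega) = WB2 L1 L2.

End problem.

End continuity_equation.

(* Main.v *)
Require Import Defs.
From HB Require Import structures.
From mathcomp Require Import all_boot all_order all_algebra.
From mathcomp Require Import all_classical all_reals all_analysis.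
From mathcomp Require Import measurable_realfun.
From mathcomp Require Import ring lra.

(* Pointwise [J_(Lambda_1, Lambda_2) <= J_(0, Lambda_2)], so the value for
   [Lambda_1] is at most the one for [0].  For the converse, let
   [mu_j] have bounded action for [Lambda_{1,j} -> 0].  Testing the continuity
   equation with [(t - 1) I], which [D^*] annihilates, bounds the mass of
   [G_j] by a fraction of itself plus a constant; then [R_j] is bounded
   and the mass of [q_j] is of order [|Lambda_{1,j}|].  So a subsequence weak*
   converges to some [(G, 0, R)] in CE, and its [J_0]-action is bounded by
   the same constant: with [M] the inverse of [Lambda_2], on psd [X],
     [J_0(X, 0, Z) = sup_B (B M^T . Z - 1/2 B B^T . X)],
   and the tests against continuous subpartitions of unity that this dual form
   yields pass to the limit.  The value for [0] is finite because
   [G = (1 - t)^2 G_0 + t^2 G_1], [q = 0], [R = d_t G] has finite action. *)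

Set Implicit Arguments.
Unset Strict Implicit.
Unset Printing Implicit Defensive.

Import Order.TTheory GRing.Theory Num.Theory.
Import numFieldNormedType.Exports.

Local Open Scope classical_set_scope.
Local Open Scope ring_scope.

(** * Matrices and the action density *)

(** The density is not known to be measurable, so the action is handled as a lower integral. This
    dictates how it is estimated: an integrable minorant of the density integrates to at most the
    action, while an upper bound comes from countably many dual tests and monotone convergence along
    finite maxima. Hence the rational matrices and vectors. These tests need disjoint Borel sets,
    whereas weak* limits see continuous functions only; an L1 approximation with respect to the
    variation of the limit links the two.

    Limits of measures are constructed: the masses of countably many cells converge along a
    subsequence, and a measure with the right integrals is an image of Lebesgue measure.

    The squares in the competitor keep its action finite where a weight vanishes: for [G = s^2 g]
    and [R = 2 s g] every dual test is at most [2 M M^T . g], whatever [s]. Its time discretisations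
    satisfy the continuity equation only in the limit. Test fields have derivatives in the interior
    alone, so this limit relies on the density of the interior, which is where the smooth boundary
    enters. *)

Section mxdot.
Context {R : realType}.

Lemma mxdotE m n (A B : 'M[R]_(m, n)) :
  mxdot A B = \sum_i \sum_j A i j * B i j.
Proof.
rewrite /mxdot /mxtrace exchange_big/=; apply: eq_bigr => j _.
by rewrite mxE; apply: eq_bigr => i _; rewrite mxE.
Qed.

Lemma mxdotC m n (A B : 'M[R]_(m, n)) : mxdot A B = mxdot B A.
Proof. by rewrite !mxdotE; do 2!apply: eq_bigr => ? _; rewrite mulrC. Qed.

Lemma mxdotDl m n (A B C : 'M[R]_(m, n)) :
  mxdot (A + B) C = mxdot A C + mxdot B C.
Proof. by rewrite /mxdot linearD mulmxDl linearD. Qed.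

Lemma mxdotZl m n c (A B : 'M[R]_(m, n)) : mxdot (c *: A) B = c * mxdot A B.
Proof. by rewrite /mxdot linearZ/= -scalemxAl linearZ. Qed.

Lemma mxdotNl m n (A B : 'M[R]_(m, n)) : mxdot (- A) B = - mxdot A B.
Proof. by rewrite -scaleN1r mxdotZl mulN1r. Qed.

Lemma mxdotDr m n (A B C : 'M[R]_(m, n)) :
  mxdot A (B + C) = mxdot A B + mxdot A C.
Proof. by rewrite /mxdot mulmxDr linearD. Qed.

Lemma mxdotZr m n c (A B : 'M[R]_(m, n)) : mxdot A (c *: B) = c * mxdot A B.
Proof. by rewrite mxdotC mxdotZl mxdotC. Qed.

Lemma mxdotNr m n (A B : 'M[R]_(m, n)) : mxdot A (- B) = - mxdot A B.
Proof. by rewrite -scaleN1r mxdotZr mulN1r. Qed.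

Lemma mxdot0r m n (A : 'M[R]_(m, n)) : mxdot A 0 = 0.
Proof. by rewrite /mxdot mulmx0 linear0. Qed.

Lemma mxdot0l m n (A : 'M[R]_(m, n)) : mxdot 0 A = 0.
Proof. by rewrite mxdotC mxdot0r. Qed.

Lemma mxdot_ge0 m n (A : 'M[R]_(m, n)) : 0 <= mxdot A A.
Proof.
by rewrite mxdotE; do 2!apply: sumr_ge0 => ? _; rewrite -expr2 sqr_ge0.
Qed.

Lemma mxdot_eq0 m n (A : 'M[R]_(m, n)) : mxdot A A = 0 -> A = 0.
Proof.
rewrite mxdotE => /eqP; rewrite psumr_eq0 => [/allP A0|i _]; last first.
  by apply: sumr_ge0 => j _; rewrite -expr2 sqr_ge0.
apply/matrixP => i j; have := A0 i (mem_index_enum _).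
rewrite psumr_eq0 => [/allP /(_ j (mem_index_enum _))|? _]; last first.
  by rewrite -expr2 sqr_ge0.
by rewrite -expr2 sqrf_eq0 mxE => /eqP.
Qed.

Lemma mxdot_mulmxr n p q (A : 'M[R]_(n, q)) (B : 'M[R]_(n, p)) (C : 'M[R]_(p, q)) :
  mxdot A (B *m C) = mxdot (A *m C^T) B.
Proof. by rewrite /mxdot trmx_mul trmxK mulmxA mxtrace_mulC mulmxA. Qed.

Lemma mxdot_mulmxl n p q (A : 'M[R]_(n, q)) (B : 'M[R]_(n, p)) (C : 'M[R]_(p, q)) :
  mxdot A (B *m C) = mxdot (B^T *m A) C.
Proof. by rewrite /mxdot trmx_mul trmxK mulmxA. Qed.

Lemma mxdot_delta m n (A : 'M[R]_(m, n)) i j : mxdot (delta_mx i j) A = A i j.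
Proof.
rewrite mxdotE (bigD1 i)//= (bigD1 j)//= mxE !eqxx mul1r.
rewrite !big1 ?addr0// => [k /negPf ki|k /negPf ki].
  by apply: big1 => l _; rewrite mxE ki mul0r.
by rewrite mxE ki andbF mul0r.
Qed.

Lemma entry_le_frobenius m n (A : 'M[R]_(m, n)) i j : `|A i j| <= frobenius A.
Proof.
rewrite -sqrtr_sqr ler_sqrt ?mxdot_ge0// mxdotE (bigD1 i)//= (bigD1 j)//=.
rewrite expr2 -addrA lerDl addr_ge0//; last first.
  by do 2!apply: sumr_ge0 => ? _; rewrite -expr2 sqr_ge0.
by apply: sumr_ge0 => ? _; rewrite -expr2 sqr_ge0.
Qed.

End mxdot.

(** * Positive semidefinite matrices and Young's inequality *)

Section psd.
Context {R : realType}.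

Lemma quad_mxdot n (X : 'M[R]_n) (u : 'cV[R]_n) :
  (u^T *m X *m u) 0 0 = mxdot u (X *m u).
Proof. by rewrite /mxdot mulmxA /mxtrace big_ord1. Qed.

(** The trace is a sum of quadratic forms, one for each column of [T]. *)
Lemma psd_mxdot_ge0 n p (X : 'M[R]_n) (T : 'M[R]_(n, p)) :
  psd_mx X -> 0 <= mxdot T (X *m T).
Proof.
move=> [_ X0]; rewrite /mxdot mulmxA /mxtrace; apply: sumr_ge0 => j _.
suff -> : (T^T *m X *m T) j j = ((col j T)^T *m X *m (col j T)) 0 0 by exact: X0.
rewrite [LHS]mxE [RHS]mxE; apply: eq_bigr => k _; congr (_ * _); last by rewrite mxE.
by rewrite [LHS]mxE [RHS]mxE; apply: eq_bigr => l _; rewrite !mxE.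
Qed.

(** The quadratic form of [X] at [a e_i + b e_j]. Choosing [a] and [b] among 0, 1 and -1 gives all
    the entry bounds below. *)
Lemma psd_quad2 n (X : 'M[R]_n) i j (a b : R) : psd_mx X ->
  0 <= a ^+ 2 * X i i + 2 * a * b * X i j + b ^+ 2 * X j j.
Proof.
move=> Xpsd; have [XT _] := Xpsd.
have Xji : X j i = X i j by rewrite -{1}XT mxE.
pose u : 'cV[R]_n := a *: delta_mx i 0 + b *: delta_mx j 0.
have := psd_mxdot_ge0 u Xpsd.
rewrite mulmxDr -!scalemxAr -!colE !mxdotDl !mxdotDr !mxdotZl !mxdotZr.
by rewrite !mxdot_delta !mxE Xji; lra.
Qed.

Lemma psd_diag_ge0 n (X : 'M[R]_n) i : psd_mx X -> 0 <= X i i.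
Proof. by move=> /(psd_quad2 i i 1 0); lra. Qed.

Lemma psd_diag_le_tr n (X : 'M[R]_n) i : psd_mx X -> X i i <= \tr X.
Proof.
move=> Xpsd; rewrite /mxtrace (bigD1 i)//= lerDl.
by apply: sumr_ge0 => k _; exact: psd_diag_ge0.
Qed.

Lemma psd_tr_ge0 n (X : 'M[R]_n) : psd_mx X -> 0 <= \tr X.
Proof. by move=> Xpsd; apply: sumr_ge0 => i _; exact: psd_diag_ge0. Qed.

Lemma psd_entry_le_tr n (X : 'M[R]_n) i j : psd_mx X -> `|X i j| <= \tr X.
Proof.
move=> Xpsd.
have := psd_quad2 i j 1 1 Xpsd; have := psd_quad2 i j 1 (-1) Xpsd.
have := psd_diag_le_tr i Xpsd; have := psd_diag_le_tr j Xpsd.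
by rewrite ler_norml; lra.
Qed.

(** [X *m mp_pinv X] is the orthogonal projector onto the range of [X], so a range condition becomes
    an equation. *)
Lemma ran_subP n p (X : 'M[R]_n) (W : 'M[R]_(n, p)) :
  reflect (X *m (mp_pinv X *m W) = W) (ran_sub W X).
Proof.
apply: (iffP submxP) => [[D /(congr1 trmx)]|XW].
  rewrite trmxK trmx_mul trmxK => ->.
  by have [XXX _ _ _] := mp_pinvP X; rewrite !mulmxA XXX.
by exists (mp_pinv X *m W)^T; rewrite -trmx_mul XW.
Qed.

(* Completing the square in [B - X^+ W]. *)
Lemma psd_young n p (X : 'M[R]_n) (B W : 'M[R]_(n, p)) :
  psd_mx X -> ran_sub W X ->
  mxdot B W - 2^-1 * mxdot B (X *m B) <= 2^-1 * mxdot W (mp_pinv X *m W).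
Proof.
move=> Xpsd /ran_subP XT; have [sX _] := Xpsd.
have := psd_mxdot_ge0 (B - mp_pinv X *m W) Xpsd.
set T := mp_pinv X *m W in XT *.
rewrite mulmxDr mulmxN XT !(mxdotDl, mxdotDr, mxdotNl, mxdotNr).
rewrite [mxdot T (X *m B)]mxdot_mulmxl sX XT.
by rewrite [mxdot W B]mxdotC [mxdot W T]mxdotC; lra.
Qed.

(** Young's inequality at [B = s delta_ij] with [s = e] and [s = - e], divided by [e]. The weight
    [e] stays free: a small one makes the share of the trace small. *)
Lemma psd_young_entry n p (X : 'M[R]_n) (W : 'M[R]_(n, p)) i j (e : R) :
  psd_mx X -> ran_sub W X -> 0 < e ->
  `|W i j| <= 2^-1 * e * \tr X + (2^-1 * mxdot W (mp_pinv X *m W)) / e.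
Proof.
move=> Xpsd XW e0; set q := 2^-1 * mxdot W _.
have H s : s * W i j - 2^-1 * s ^+ 2 * X i i <= q.
  have := psd_young (s *: delta_mx i j) Xpsd XW.
  rewrite -scalemxAr !mxdotZl !mxdotZr !mxdot_delta.
  have -> : (X *m delta_mx i j) i j = X i i.
    rewrite mxE (bigD1 i)//= big1 ?mxE ?eqxx ?mulr1 ?addr0// => l /negPf li.
    by rewrite mxE li mulr0.
  by rewrite -/q; lra.
have := H e; have := H (- e); have := psd_diag_le_tr i Xpsd.
have -> : q / e = e^-1 * q by rewrite mulrC.
have e'0 : 0 < e^-1 by rewrite invr_gt0.
have ee' : e * e^-1 = 1 by rewrite divff// gt_eqF.
move=> Xtr H1 H2.
have K (x : R) : e * x - 2^-1 * e ^+ 2 * X i i <= q -> x <= 2^-1 * e * \tr X + e^-1 * q.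
  move=> h; rewrite -(ler_pM2l e0) mulrDr [e * (e^-1 * q)]mulrA ee' mul1r.
  by have := ler_wpM2l (sqr_ge0 e) Xtr; lra.
by rewrite ler_norml -lerN2 opprK andbC; apply/andP; split; apply: K => //; lra.
Qed.

(** The transposed pseudoinverse satisfies the Penrose equations of [X^T = X], which have only one
    solution. *)
Lemma mp_pinv_sym n (X : 'M[R]_n) : X^T = X -> (mp_pinv X)^T = mp_pinv X.
Proof.
move=> sX; apply: (@penrose_unique R _ _ X); last exact: mp_pinvP.
have [p1 p2 p3 p4] := mp_pinvP X; split.
- by rewrite -{1 3}sX -!trmx_mul mulmxA p1 sX.
- by rewrite -{2}sX -!trmx_mul mulmxA p2.
- by rewrite -{1 3}sX -!trmx_mul p4.
- by rewrite -{2 4}sX -!trmx_mul p3.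
Qed.

Lemma pd_unitmx n (X : 'M[R]_n) : pd_mx X -> X \in unitmx.
Proof.
move=> [sX X0]; rewrite -row_free_unit -kermx_eq0; apply/eqP/row_matrixP => i.
rewrite row0; set v := row i _.
have vX : v *m X = 0 by apply/sub_kermxP; rewrite row_sub.
apply/eqP/negPn/negP => v0; have := X0 v^T.
by rewrite trmx_eq0 v0 trmxK vX mul0mx mxE ltxx => /(_ isT).
Qed.

Lemma cvg_sumR (I : finType) (T : Type) (F : set_system T) {FF : Filter F}
    (f : I -> T -> R) (a : I -> R) :
  (forall i, f i x @[x --> F] --> a i) ->
  \sum_i f i x @[x --> F] --> \sum_i a i.
Proof.
by move=> fa; apply: cvg_big => //; exact: add_continuous.
Qed.

(** Tests over all real matrices can thus be restricted to countably many, as statements almost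
    everywhere require. *)
Lemma rat_mx_approx m n (B : 'M[R]_(m, n)) :
  exists B_ : nat -> 'M[rat]_(m, n),
    forall i j, ratr (B_ t i j) @[t --> \oo] --> B i j.
Proof.
have H t i j : exists q : rat, `|B i j - ratr q| < t.+1%:R^-1.
  have : (0 : R) < t.+1%:R^-1 by rewrite invr_gt0.
  move: (t.+1%:R^-1) => e e0.
  have [|q] := @rat_in_itvoo R (B i j - e) (B i j + e); first lra.
  by rewrite in_itv/= => /andP[q1 q2]; exists q; rewrite ltr_norml; lra.
exists (fun t => \matrix_(i, j) sval (cid (H t i j))) => i j.
apply/cvgrPdist_lt => e e0.
near=> t; rewrite mxE; case: cid => q /= /lt_trans; apply.
near: t; exact: near_infty_natSinv_lt (PosNum e0).
Unshelve. all: by end_near. Qed.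

End psd.

(** * Dual and coercive bounds on the action density *)

Section density.
Context {R : realType} (n k : nat).
Implicit Types (M B X Z : 'M[R]_n) (Y : 'M[R]_(n, k)).

(* With [M] the inverse of [L2], [J_density 0 L2 X 0 Z] is the supremum over [B]
   of [Jdual M B X Z] when [X] is positive semidefinite. *)
Definition Jdual M B X Z : R :=
  mxdot (B *m M^T) Z - 2^-1 * mxdot (B *m B^T) X.

Lemma JdualE M B X Z : X^T = X ->
  Jdual M B X Z = mxdot B (Z *m M) - 2^-1 * mxdot B (X *m B).
Proof. by move=> sX; rewrite /Jdual !mxdot_mulmxr. Qed.

Lemma ran_sub_row_mx n1 n2 n3 (X : 'M[R]_n1) (Y : 'M[R]_(n1, n2)) (Z : 'M[R]_(n1, n3)) :
  ran_sub (row_mx Y Z) X = ran_sub Y X && ran_sub Z X.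
Proof.
apply/ran_subP/andP => [|[/ran_subP XY /ran_subP XZ]].
  by rewrite !mul_mx_row => /eq_row_mx [XY XZ]; split; apply/ran_subP.
by rewrite !mul_mx_row XY XZ.
Qed.

Lemma ran_sub_mulmx p q (X : 'M[R]_n) (W : 'M[R]_(n, p)) (C : 'M[R]_(p, q)) :
  ran_sub W X -> ran_sub (W *m C) X.
Proof. by move=> /ran_subP XW; apply/ran_subP; rewrite !mulmxA -(mulmxA X) XW. Qed.

Variant J_density_spec (L1 : 'M[R]_k) (L2 : 'M[R]_n) X Y Z : \bar R -> Type :=
| JDensityFin of psd_mx X & ran_sub Y^T L1 & ran_sub Y X & ran_sub Z X :
    J_density_spec L1 L2 X Y Z
      (2^-1 * mxdot (Y *m mp_pinv L1) (mp_pinv X *m (Y *m mp_pinv L1)) +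
       2^-1 * mxdot (Z *m invmx L2) (mp_pinv X *m (Z *m invmx L2)))%:E
| JDensityInf : J_density_spec L1 L2 X Y Z +oo%E.

Lemma J_densityP (L1 : 'M[R]_k) (L2 : 'M[R]_n) X Y Z :
  J_density_spec L1 L2 X Y Z (J_density L1 L2 X Y Z).
Proof.
rewrite /J_density; case: asboolP => [[psdX YL]|_]; last by constructor.
by rewrite ran_sub_row_mx => /andP[YX ZX]; constructor.
Qed.

Lemma psd_pinv_ge0 p X (W : 'M[R]_(n, p)) :
  psd_mx X -> ran_sub W X -> 0 <= 2^-1 * mxdot W (mp_pinv X *m W).
Proof.
move=> psdX WX; have := psd_young 0 psdX WX.
by rewrite mulmx0 !mxdot0l mulr0 subr0.
Qed.

(** Young's inequality with [W = Z L2^-1]; the term in [Y] is nonnegative and dropped. *)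
Lemma J_density_ge_dual (L1 : 'M[R]_k) (L2 : 'M[R]_n) B X Y Z :
  ((Jdual (invmx L2) B X Z)%:E <= J_density L1 L2 X Y Z)%E.
Proof.
case: J_densityP => [psdX _ YX ZX|]; last by rewrite leey.
have [sX _] := psdX; rewrite lee_fin JdualE//.
have := psd_young B psdX (ran_sub_mulmx (invmx L2) ZX).
by have := psd_pinv_ge0 psdX (ran_sub_mulmx (mp_pinv L1) YX); lra.
Qed.

Lemma J_density_ge0 (L1 : 'M[R]_k) (L2 : 'M[R]_n) X Y Z : (0 <= J_density L1 L2 X Y Z)%E.
Proof.
apply: le_trans (J_density_ge_dual L1 L2 0 X Y Z).
by rewrite /Jdual !mul0mx !mxdot0l mulr0 subr0.
Qed.

(** For [L1 = 0] the range condition on [Y^T] forces [Y = 0], and then the density no longer depends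
    on [L1]. *)
Lemma J_density_le_J0 (L1 : 'M[R]_k) (L2 : 'M[R]_n) X Y Z :
  (J_density L1 L2 X Y Z <= J_density 0 L2 X Y Z)%E.
Proof.
rewrite [leRHS]/J_density; case: asboolP => [[psdX YL YZX]|_]; last exact: leey.
have Y0 : Y = 0.
  move/ran_subP : YL; rewrite mul0mx => /(congr1 trmx).
  by rewrite trmx0 trmxK => <-.
rewrite /J_density asboolT Y0 ?mul0mx//; split=> //; last by rewrite -Y0.
by rewrite trmx0; apply/ran_subP; rewrite !mulmx0.
Qed.

(** Write [Z = (Z L2^-1) L2] and control the first factor by Young's inequality with weight [e K],
    where [K = 1 + n |L2|]; the constant provided is its square, uniform in [L1]. In [e] the gain is
    linear and the loss quadratic, which later allows the mass to be absorbed. *)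
Lemma J_density_ge_Z (L2 : 'M[R]_n) : pd_mx L2 -> exists2 K : R, 0 < K &
  forall (L1 : 'M[R]_k) X Y Z i j (e : R), 0 < e ->
    ((e * `|Z i j| - K * e ^+ 2 * \tr X)%:E <= J_density L1 L2 X Y Z)%E.
Proof.
move=> /pd_unitmx uL2; pose K := 1 + n%:R * frobenius L2.
have f0 : 0 <= frobenius L2 by rewrite sqrtr_ge0.
have K0 : 0 < K by rewrite ltr_pwDl// mulr_ge0.
exists (K ^+ 2); first exact: exprn_gt0.
move=> L1 X Y Z i j e e0.
case: J_densityP => [psdX _ YX ZX|]; last by rewrite leey.
rewrite lee_fin.
have := psd_pinv_ge0 psdX (ran_sub_mulmx (mp_pinv L1) YX).
set q1 := 2^-1 * mxdot _ _ => q10.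
have ZMX := ran_sub_mulmx (invmx L2) ZX.
have := psd_pinv_ge0 psdX ZMX.
set q := 2^-1 * mxdot (Z *m _) _ => q0.
have eK0 : 0 < e * K by rewrite mulr_gt0.
have ZW l : `|(Z *m invmx L2) i l| <= 2^-1 * (e * K) * \tr X + q / (e * K).
  exact: psd_young_entry.
have tX := psd_tr_ge0 psdX.
have ZK : `|Z i j| <= (2^-1 * (e * K) * \tr X + q / (e * K)) * K.
  rewrite -{1}[Z](mulmxKV uL2) mxE (le_trans (ler_norm_sum _ _ _))//.
  apply: (@le_trans _ _ (\sum_(l < n) (2^-1 * (e * K) * \tr X + q / (e * K)) * frobenius L2)).
    by apply: ler_sum => l _; rewrite normrM ler_pM// entry_le_frobenius.
  rewrite sumr_const card_ord -mulrnAr ler_wpM2l//.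
    by rewrite addr_ge0// ?divr_ge0// ?mulr_ge0// ltW.
  by rewrite -[frobenius L2 *+ n]mulr_natl /K; lra.
have -> : q1 + q = q1 + e * K * (q / (e * K)) by field; rewrite !gt_eqF.
have := ler_wpM2l (ltW e0) ZK.
have : 0 <= (e * K) ^+ 2 * \tr X by rewrite mulr_ge0// sqr_ge0.
by lra.
Qed.

(** The range condition gives [Y = Y L1^+ L1], so an entry of [Y] is at most [k |L1|] times a bound
    on the entries of [Y L1^+]. The multiplier [s] may be of order [1 / |L1|]: this is what makes
    the mass of [q] vanish with [L1]. *)
Lemma J_density_ge_Y (L1 : 'M[R]_k) (L2 : 'M[R]_n) X Y Z i j (s : R) : psd_mx L1 -> 0 <= s ->
  s * (k%:R * frobenius L1) <= 1 ->
  ((s * `|Y i j| - \tr X)%:E <= J_density L1 L2 X Y Z)%E.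
Proof.
move=> [sL1 _] s0 sL.
case: J_densityP => [psdX YL YX ZX|]; last by rewrite leey.
rewrite lee_fin.
have := psd_pinv_ge0 psdX (ran_sub_mulmx (invmx L2) ZX).
set q2 := 2^-1 * mxdot _ _ => q20.
have WX := ran_sub_mulmx (mp_pinv L1) YX.
have := psd_pinv_ge0 psdX WX.
set q := 2^-1 * mxdot (Y *m _) _ => q0.
have YE : Y = Y *m mp_pinv L1 *m L1.
  move/ran_subP : YL => /(congr1 trmx); rewrite mulmxA trmx_mul trmxK => YE.
  by rewrite -{1}YE trmx_mul sL1 mp_pinv_sym// mulmxA.
have tX := psd_tr_ge0 psdX.
have YW l : `|(Y *m mp_pinv L1) i l| <= \tr X + q.
  have := psd_young_entry i l psdX WX ltr01; rewrite -/q divr1 mulr1 => h.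
  by apply: (le_trans h); lra.
have YK : `|Y i j| <= (\tr X + q) * (k%:R * frobenius L1).
  rewrite {1}YE mxE (le_trans (ler_norm_sum _ _ _))//.
  apply: (@le_trans _ _ (\sum_(l < k) (\tr X + q) * frobenius L1)).
    by apply: ler_sum => l _; rewrite normrM ler_pM// entry_le_frobenius.
  by rewrite sumr_const card_ord -mulrnAr -[frobenius L1 *+ k]mulr_natl.
have := ler_wpM2l s0 YK.
have : 0 <= \tr X + q by rewrite addr_ge0.
move=> /ler_wpM2l/(_ _ _ sL); rewrite mulr1.
rewrite [s * ((\tr X + q) * _)]mulrCA.
by lra.
Qed.

Lemma J_density_lty_psd (L1 : 'M[R]_k) (L2 : 'M[R]_n) X Y Z :
  (J_density L1 L2 X Y Z < +oo)%E -> psd_mx X.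
Proof. by case: J_densityP. Qed.

Lemma Jdual_le_of_rat M X Z (c : R) : X^T = X ->
  (forall B : 'M[rat]_n, Jdual M (map_mx ratr B) X Z <= c) ->
  forall B, Jdual M B X Z <= c.
Proof.
move=> sX H B; have [B_ BB] := rat_mx_approx B.
have : (Jdual M (map_mx ratr (B_ t)) X Z) @[t --> \oo] --> Jdual M B X Z.
  rewrite JdualE//.
  under eq_fun do rewrite JdualE//.
  apply: cvgB.
    rewrite mxdotE; under eq_fun do rewrite mxdotE.
    apply: cvg_sumR => i; apply: cvg_sumR => j; apply: cvgM; last exact: cvg_cst.
    by under eq_fun do rewrite mxE; exact: BB.
  apply: cvgM; first exact: cvg_cst.
  rewrite mxdotE; under eq_fun do rewrite mxdotE.
  apply: cvg_sumR => i; apply: cvg_sumR => j; apply: cvgM.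
    by under eq_fun do rewrite mxE; exact: BB.
  rewrite mxE; under eq_fun do rewrite mxE.
  apply: cvg_sumR => l; apply: cvgM; first exact: cvg_cst.
  by under eq_fun do rewrite mxE; exact: BB.
move=> cv; rewrite -(cvg_lim _ cv)//; apply: limr_le.
  by apply/cvg_ex; eexists; exact: cv.
by apply: nearW => t; exact: H.
Qed.

(* The dual formulation of [J]: if the range condition fails, testing with
   multiples of the component of [W] in the kernel of [X] gives [+oo]. *)
Lemma J0_le_of_dual (L2 : 'M[R]_n) X Z (c : R) : psd_mx X -> pd_mx L2 ->
  (forall B : 'M[rat]_n, Jdual (invmx L2) (map_mx ratr B) X Z <= c) ->
  (J_density 0 L2 X (0 : 'M[R]_(n, k)) Z <= c%:E)%E.
Proof.
move=> psdX /pd_unitmx uL2; have [sX _] := psdX.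
move=> /(Jdual_le_of_rat sX) H; set W := Z *m invmx L2.
have [p1 p2 p3 p4] := mp_pinvP X.
have WX : ran_sub W X.
  apply/ran_subP/eqP; rewrite mulmxA -subr_eq0 -opprB oppr_eq0; apply/eqP.
  set N := _ - _; apply: mxdot_eq0; apply/eqP/negPn/negP => N0.
  have PN : N = (1%:M - X *m mp_pinv X) *m W by rewrite mulmxBl mul1mx.
  have sP : (1%:M - X *m mp_pinv X)^T = 1%:M - X *m mp_pinv X.
    by rewrite linearB/= trmx1 p3.
  have XN : X *m N = 0.
    rewrite PN mulmxA -{1}sX -sP -trmx_mul mulmxBl mul1mx p1 subrr trmx0.
    by rewrite mul0mx.
  have NW : mxdot N W = mxdot N N.
    rewrite [X in _ = mxdot _ X]PN (mxdot_mulmxl N (1%:M - X *m mp_pinv X)) sP; congr (mxdot _ _).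
    suff E : X *m mp_pinv X *m N = 0 by rewrite mulmxBl mul1mx E subr0.
    by rewrite PN mulmxA mulmxBr mulmx1 (mulmxA (X *m mp_pinv X) X) p1 subrr mul0mx.
  have N1 : 0 < mxdot N N by rewrite lt_neqAle mxdot_ge0 eq_sym N0.
  (* The factor makes the dual value at this [B] equal to [c + 1]. *)
  have := H (((c + 1) / mxdot N N) *: N).
  rewrite JdualE// -scalemxAr XN scaler0 mxdot0r mulr0 subr0 mxdotZl NW.
  by rewrite divfK ?gt_eqF//; lra.
have ZX : ran_sub Z X.
  by rewrite -[Z](mulmxKV uL2); exact: ran_sub_mulmx.
rewrite /J_density asboolT.
  rewrite lee_fin !mul0mx mxdot0l mulr0 add0r -/W.
  (* The supremum is attained at [B = X^+ W]. *)
  have := H (mp_pinv X *m W); rewrite JdualE// -/W.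
  by move/ran_subP : WX => ->; rewrite [mxdot _ W]mxdotC; lra.
split => //; first by rewrite trmx0; apply/ran_subP; rewrite !mulmx0.
by rewrite ran_sub_row_mx ZX andbT; apply/ran_subP; rewrite !mulmx0.
Qed.

End density.

(** * Integration against charges *)

Section bounded_measurable.
Context d (T : measurableType d) {R : realType}.
Implicit Types (D : set T) (f g : T -> R).

(** Over a measurable [D], such functions are integrable against every finite measure, hence against
    both Jordan parts of any charge. *)
Definition bounded_measurable D f : Prop :=
  measurable_fun D f /\ exists K, forall x, D x -> `|f x| <= K.

Lemma bounded_measurable_integrable (m : {finite_measure set T -> \bar R}) D f :
  measurable D -> bounded_measurable D f -> m.-integrable D (EFin \o f).
Proof.
move=> mD [mf [K fK]]; apply: measurable_bounded_integrable => //.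
  by rewrite -ge0_fin_numE// fin_num_measure.
exists K; split; first exact: num_real.
by move=> y Ky x Dx; apply: le_trans (fK x Dx) (ltW Ky).
Qed.

Lemma bounded_measurable_fin_num (m : {finite_measure set T -> \bar R}) D f :
  measurable D -> bounded_measurable D f ->
  (\int[m]_(x in D) (f x)%:E)%E \is a fin_num.
Proof.
by move=> mD bf; apply: (integrable_fin_num mD); exact: bounded_measurable_integrable.
Qed.

Lemma bounded_measurable_cst D (c : R) : bounded_measurable D (fun=> c).
Proof. by split; [exact: measurable_cst|exists `|c|]. Qed.

Lemma bounded_measurableD D f g : bounded_measurable D f ->
  bounded_measurable D g -> bounded_measurable D (fun x => f x + g x).
Proof.
move=> [mf [K fK]] [mg [L gL]]; split; first exact: measurable_funD.
exists (K + L) => x Dx; rewrite (le_trans (ler_normD _ _))//.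
by rewrite lerD// ?fK ?gL.
Qed.

Lemma bounded_measurableM D f g : bounded_measurable D f ->
  bounded_measurable D g -> bounded_measurable D (fun x => f x * g x).
Proof.
move=> [mf [K fK]] [mg [L gL]]; split; first exact: measurable_funM.
exists (K * L) => x Dx; rewrite normrM.
by rewrite ler_pM// ?fK ?gL.
Qed.

Lemma bounded_measurableZ D c f : bounded_measurable D f ->
  bounded_measurable D (fun x => c * f x).
Proof. exact: bounded_measurableM (bounded_measurable_cst _ _). Qed.

Lemma bounded_measurableN D f : bounded_measurable D f ->
  bounded_measurable D (fun x => - f x).
Proof.
move=> /(bounded_measurableZ (-1)).
by under eq_fun do rewrite mulN1r.
Qed.

Lemma bounded_measurableB D f g : bounded_measurable D f ->
  bounded_measurable D g -> bounded_measurable D (fun x => f x - g x).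
Proof.
by move=> bf bg; apply: bounded_measurableD => //; exact: bounded_measurableN.
Qed.

Lemma bounded_measurable_norm D f : bounded_measurable D f ->
  bounded_measurable D (fun x => `|f x|).
Proof.
move=> [mf [K fK]]; split; first exact: measurableT_comp.
by exists K => x Dx; rewrite normr_id fK.
Qed.

Lemma bounded_measurable_sum (I : Type) (s : seq I) (F : I -> T -> R) D :
  (forall i, bounded_measurable D (F i)) ->
  bounded_measurable D (fun x => \sum_(i <- s) F i x).
Proof.
move=> bF; elim: s => [|i s IHs].
  by under eq_fun do rewrite big_nil; exact: bounded_measurable_cst.
by under eq_fun do rewrite big_cons; exact: bounded_measurableD.
Qed.

Lemma bounded_measurable_indic D A : measurable A ->
  bounded_measurable D (\1_A : T -> R).
Proof.
move=> mA; split; first exact: measurable_indic.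
exists 1 => x _; rewrite indicE.
by case: (x \in A); rewrite ?normr0 ?normr1.
Qed.

Lemma bounded_measurableS D E f : measurable D -> E `<=` D ->
  bounded_measurable D f -> bounded_measurable E f.
Proof.
move=> mD ED [mf [K fK]]; split; first exact: measurable_funS mf.
by exists K => x Ex; exact/fK/ED.
Qed.

End bounded_measurable.

Section madd.
Context d (T : measurableType d) {R : realType}.
Variables p q : {finite_measure set T -> \bar R}.

Definition madd : set T -> \bar R := measure_add p q.

Lemma maddE A : madd A = (p A + q A)%E.
Proof. exact: measure_addE. Qed.

HB.instance Definition _ := Measure.on madd.

Let madd_fin : fin_num_fun madd.
Proof. by move=> A mA; rewrite maddE fin_numD !fin_num_measure. Qed.

HB.instance Definition _ := @Measure_isFinite.Build _ _ _ madd madd_fin.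

End madd.

Section cintegral.
Context d (T : measurableType d) {R : realType}.
Implicit Types (nu : {charge set T -> \bar R}) (D : set T) (f g : T -> R).

Lemma jordanE nu A : measurable A ->
  nu A = (jordan_pos (hahn nu) A - jordan_neg (hahn nu) A)%E.
Proof. by move=> mA; rewrite (jordan_decomp (hahn nu) mA)/= /cadd/= cscaleN1. Qed.

(** All ways of writing [nu] as a difference of finite measures give the same integral, because
    [p + nu^- = q + nu^+]. Linearity in the charge and images of charges go through this, without
    computing any Hahn decomposition. *)
Lemma cintegral_diff nu (p q : {finite_measure set T -> \bar R}) D f :
  measurable D -> bounded_measurable D f ->
  (forall A, measurable A -> A `<=` D -> nu A = (p A - q A)%E) ->
  cintegral nu D f = \int[p]_(x in D) f x - \int[q]_(x in D) f x.
Proof.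
move=> mD bf nuE.
have I (m : {finite_measure set T -> \bar R}) := bounded_measurable_integrable m mD bf.
have E : \int[jordan_pos (hahn nu)]_(x in D) f x + \int[q]_(x in D) f x =
    \int[p]_(x in D) f x + \int[jordan_neg (hahn nu)]_(x in D) f x.
  rewrite /Rintegral -!fineD; try exact: bounded_measurable_fin_num.
  congr fine; rewrite -!integral_measure_add//; try exact: I.
  apply: eq_measure_integral => A mA AD; apply: (etrans (measure_addE _ _ _)).
  apply: (etrans _ (esym (measure_addE _ _ _))).
  have H (a b x y : \bar R) : a \is a fin_num -> b \is a fin_num ->
      x \is a fin_num -> y \is a fin_num ->
      (a - b = x - y -> a + y = x + b)%E.
    move: a b x y => [a||] [b||] [x||] [y||]// _ _ _ _.
    by rewrite -!EFinB -!EFinD => -[] ?; congr EFin; lra.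
  apply: H; try exact: fin_num_measure.
  by rewrite -jordanE// nuE.
have L (a b x y : R) : a + y = x + b -> a - b = x - y by lra.
exact: L E.
Qed.

Lemma eq_cintegral_charge nu nu' D f : measurable D -> bounded_measurable D f ->
  (forall A, measurable A -> A `<=` D -> nu A = nu' A) ->
  cintegral nu D f = cintegral nu' D f.
Proof.
move=> mD bf E; rewrite [RHS]/cintegral; apply: cintegral_diff => // A mA AD.
by rewrite E// (jordanE nu' mA).
Qed.

Lemma eq_cintegral nu D f g : {in D, f =1 g} ->
  cintegral nu D f = cintegral nu D g.
Proof. by move=> fg; rewrite /cintegral; congr (_ - _); exact: eq_Rintegral. Qed.

Lemma cintegralD nu D f g : measurable D -> bounded_measurable D f ->
  bounded_measurable D g ->
  cintegral nu D (fun x => f x + g x) = cintegral nu D f + cintegral nu D g.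
Proof.
move=> mD bf bg; rewrite /cintegral !RintegralD//;
  try exact: bounded_measurable_integrable.
by rewrite opprD addrACA.
Qed.

Lemma cintegralZ nu D c f : measurable D -> bounded_measurable D f ->
  cintegral nu D (fun x => c * f x) = c * cintegral nu D f.
Proof.
move=> mD bf; rewrite /cintegral !RintegralZl//;
  try exact: bounded_measurable_integrable.
by rewrite mulrBr.
Qed.

Lemma cintegral_cst0 nu D : cintegral nu D (fun=> 0) = 0.
Proof. by rewrite /cintegral /Rintegral !integral0 subrr. Qed.

Lemma cintegralN nu D f : measurable D -> bounded_measurable D f ->
  cintegral nu D (fun x => - f x) = - cintegral nu D f.
Proof.
move=> mD bf; rewrite -mulN1r -cintegralZ//.
by apply: eq_cintegral => x _; rewrite mulN1r.
Qed.

Lemma cintegralB nu D f g : measurable D -> bounded_measurable D f ->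
  bounded_measurable D g ->
  cintegral nu D (fun x => f x - g x) = cintegral nu D f - cintegral nu D g.
Proof.
move=> mD bf bg; rewrite -cintegralN// cintegralD//.
exact: bounded_measurableN.
Qed.

Lemma cintegral_sum nu D (I : Type) (s : seq I) (F : I -> T -> R) :
  measurable D -> (forall i, bounded_measurable D (F i)) ->
  cintegral nu D (fun x => \sum_(i <- s) F i x) =
  \sum_(i <- s) cintegral nu D (F i).
Proof.
move=> mD bF; elim: s => [|i s IHs].
  under eq_cintegral do rewrite big_nil.
  by rewrite big_nil cintegral_cst0.
under eq_cintegral do rewrite big_cons.
by rewrite cintegralD// ?IHs ?big_cons//; exact: bounded_measurable_sum.
Qed.

Lemma cintegral_indic nu D A : measurable D -> measurable A ->
  cintegral nu D (\1_A) = fine (nu (A `&` D)).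
Proof.
move=> mD mA; rewrite /cintegral /Rintegral.
have E (m : {finite_measure set T -> \bar R}) :
  (\int[m]_(x in D) (\1_A x)%:E = m (A `&` D))%E by rewrite integral_indic.
rewrite !E -fineB ?fin_num_measure//; try exact: measurableI.
by rewrite -jordanE//; exact: measurableI.
Qed.

(** The negative Jordan part vanishes on [D]. *)
Lemma cintegral_charge_ge0 nu D f : measurable D -> bounded_measurable D f ->
  (forall A, measurable A -> A `<=` D -> (0 <= nu A)%E) ->
  (forall x, D x -> 0 <= f x) -> 0 <= cintegral nu D f.
Proof.
move=> mD bf nu0 f0; rewrite /cintegral.
suff -> : \int[jordan_neg (hahn nu)]_(x in D) f x = 0.
  by rewrite subr0 Rintegral_ge0.
rewrite /Rintegral (_ : integral _ _ _ = 0%E)//.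
rewrite -[RHS](@integral_measure_zero _ T R D (EFin \o f)).
apply: eq_measure_integral => A mA AD.
have [_ [mN _] _ _] := hahn nu.
suff : (jordan_neg (hahn nu) A <= 0)%E by rewrite measure_le0 => /eqP.
rewrite jordan_negE cjordan_negE /crestr0 mem_set// /crestr leeNl oppe0.
by apply: nu0; [exact: measurableI|move=> x [/AD]].
Qed.

Lemma cintegral_czero D f : cintegral (@czero _ T R) D f = 0.
Proof.
have E (m : {measure set T -> \bar R}) : (forall A, measurable A -> m A = 0%E) ->
    \int[m]_(x in D) f x = 0.
  move=> m0; rewrite /Rintegral (_ : integral _ _ _ = 0%E)//.
  rewrite -[RHS](@integral_measure_zero _ T R D (EFin \o f)).
  by apply: eq_measure_integral => A mA _; rewrite m0.
have [[mP _] [mN _] _ _] := hahn (@czero _ T R).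
rewrite /cintegral !E ?subrr// => A mA.
  suff : jordan_neg (hahn (@czero _ T R)) A = 0%E by [].
  by rewrite jordan_negE cjordan_negE /crestr0 mem_set// /crestr oppe0.
suff : jordan_pos (hahn (@czero _ T R)) A = 0%E by [].
by rewrite jordan_posE cjordan_posE /crestr0 mem_set.
Qed.

Lemma Rintegral_madd (p q : {finite_measure set T -> \bar R}) D f :
  measurable D -> bounded_measurable D f ->
  \int[madd p q]_(x in D) f x = \int[p]_(x in D) f x + \int[q]_(x in D) f x.
Proof.
move=> mD bf; rewrite /Rintegral -fineD; try exact: bounded_measurable_fin_num.
congr fine; rewrite -integral_measure_add//;
  try exact: bounded_measurable_integrable.
Qed.

Definition tvar nu : {finite_measure set T -> \bar R} :=
  madd (jordan_pos (hahn nu)) (jordan_neg (hahn nu)).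

Lemma tvarE nu A : tvar nu A = charge_variation (hahn nu) A.
Proof. exact: maddE. Qed.

Lemma ler_norm_cintegral nu D f : measurable D -> bounded_measurable D f ->
  `|cintegral nu D f| <= \int[tvar nu]_(x in D) `|f x|.
Proof.
move=> mD bf; have bnf := bounded_measurable_norm bf.
rewrite Rintegral_madd//.
rewrite (le_trans (ler_normB _ _))// lerD// le_normr_Rintegral//;
  exact: bounded_measurable_integrable.
Qed.

Lemma cintegral_cadd nu nu' D f : measurable D -> bounded_measurable D f ->
  cintegral (cadd nu nu') D f = cintegral nu D f + cintegral nu' D f.
Proof.
move=> mD bf.
rewrite (@cintegral_diff _ (madd (jordan_pos (hahn nu)) (jordan_pos (hahn nu')))
   (madd (jordan_neg (hahn nu)) (jordan_neg (hahn nu'))))//.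
  by rewrite !Rintegral_madd// /cintegral opprD addrACA.
move=> A mA _ /=; rewrite !maddE /cadd/= (jordanE nu mA) (jordanE nu' mA).
by rewrite fin_num_oppeD ?fin_num_measure// addeACA.
Qed.

(** For nonnegative integrands this is the scaling of extended integrals; a bounded integrand
    becomes nonnegative by adding the constant [|K|]. *)
Lemma Rintegral_mscale (m : {finite_measure set T -> \bar R}) (r : {nonneg R}) D f :
  measurable D -> bounded_measurable D f ->
  \int[mscale r m]_(x in D) f x = r%:num * \int[m]_(x in D) f x.
Proof.
move=> mD bf.
have ge0_case g : bounded_measurable D g -> (forall x, D x -> 0 <= g x) ->
    \int[mscale r m]_(x in D) g x = r%:num * \int[m]_(x in D) g x.
  move=> bg g0; rewrite /Rintegral ge0_integral_mscale//.
    by rewrite fineM// bounded_measurable_fin_num.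
  by apply/measurable_EFinP; case: bg.
have [mf [K fK]] := bf.
have bK := bounded_measurable_cst D `|K|.
have bfK := bounded_measurableD bf bK.
have E (m' : {finite_measure set T -> \bar R}) :
    \int[m']_(x in D) f x =
    \int[m']_(x in D) (f x + `|K|) - \int[m']_(x in D) `|K|.
  rewrite -RintegralB//; try exact: bounded_measurable_integrable.
  by apply: eq_Rintegral => x _; rewrite addrK.
rewrite !E mulrBr !ge0_case// => x Dx.
by have := fK x Dx; rewrite ler_norml => /andP[+ _]; have := ler_norm K; lra.
Qed.

Lemma cintegral_cscale nu (r : R) D f : measurable D -> bounded_measurable D f ->
  cintegral (cscale r nu) D f = r * cintegral nu D f.
Proof.
move=> mD bf; have [r0|/ltW r0] := leP 0 r.
  rewrite (@cintegral_diff _ (mscale (NngNum r0) (jordan_pos (hahn nu)))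
    (mscale (NngNum r0) (jordan_neg (hahn nu))))//.
    by rewrite !Rintegral_mscale// -mulrBr.
  move=> A mA _ /=; rewrite /mscale /cscale/= (jordanE nu mA).
  by rewrite muleBr// fin_num_adde_defr// fin_num_measure.
have r0' : 0 <= - r by rewrite oppr_ge0.
rewrite (@cintegral_diff _ (mscale (NngNum r0') (jordan_neg (hahn nu)))
    (mscale (NngNum r0') (jordan_pos (hahn nu))))//.
  by rewrite !Rintegral_mscale// -mulrBr/= mulNr -mulrN opprB.
move=> A mA _ /=; rewrite /mscale /cscale/= (jordanE nu mA).
rewrite muleBr ?fin_num_adde_defr ?fin_num_measure// EFinN !mulNe oppeK addeC.
by [].
Qed.

Lemma Rintegral_image d' (T' : measurableType d') (h : T -> T')
    (m : {finite_measure set T -> \bar R}) (m' : {finite_measure set T' -> \bar R})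
    (D : set T') (f : T' -> R) :
  measurable_fun setT h -> measurable D -> bounded_measurable D f ->
  (forall A, measurable A -> A `<=` D -> m' A = m (h @^-1` A)) ->
  \int[m']_(x in D) f x = \int[m]_(x in h @^-1` D) (f \o h) x.
Proof.
move=> mh mD bf mE.
have mhD : measurable (h @^-1` D) by rewrite -[X in measurable X]setTI; exact: mh.
have bfh : bounded_measurable (h @^-1` D) (f \o h).
  case: bf => mf [K fK]; split; last by exists K => x /fK.
  by apply: (measurable_comp _ _ mf) => //; [move=> _ [x ? <-]|exact: measurable_funTS].
have ge0_case (g : T' -> R) : bounded_measurable D g -> (forall x, D x -> 0 <= g x) ->
    \int[m']_(x in D) g x = \int[m]_(x in h @^-1` D) (g \o h) x.
  move=> [mg _] g0; rewrite /Rintegral; congr fine.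
  transitivity (\int[pushforward m h]_(x in D) (g x)%:E)%E.
    exact: eq_measure_integral.
  rewrite (ge0_integral_pushforward mh m)//.
  - exact/measurable_EFinP.
  - by move=> x; rewrite inE => Dx; rewrite /= lee_fin g0.
have [mf [K fK]] := bf.
have bK := bounded_measurable_cst D `|K|.
have bfK := bounded_measurableD bf bK.
have -> : \int[m']_(x in D) f x =
    \int[m']_(x in D) (f x + `|K|) - \int[m']_(x in D) `|K|.
  rewrite -RintegralB//; try exact: bounded_measurable_integrable.
  by apply: eq_Rintegral => x _; rewrite addrK.
rewrite !ge0_case//; last first.
  move=> x Dx; have := fK x Dx; rewrite ler_norml => /andP[+ _].
  by have := ler_norm K; lra.
have bK' := bounded_measurable_cst (h @^-1` D) `|K|.
rewrite -RintegralB//.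
- by apply: eq_Rintegral => x _ /=; rewrite addrK.
- exact: bounded_measurable_integrable (bounded_measurableD bfh bK').
- exact: bounded_measurable_integrable.
Qed.

End cintegral.

Section image_measure.
Context d d' (T : measurableType d) (T' : measurableType d') {R : realType}.
Variables (h : T -> T') (mh : measurable_fun setT h).
Variable m : {finite_measure set T -> \bar R}.

(** The measurability proof is an argument, so that the finite measure structure can be recovered
    from the term. *)
Definition image_measure of measurable_fun setT h : set T' -> \bar R :=
  pushforward m h.

Let image0 : image_measure mh set0 = 0%E.
Proof. by rewrite /image_measure /pushforward preimage_set0 measure0. Qed.

Let image_ge0 A : (0 <= image_measure mh A)%E.
Proof. exact: measure_ge0. Qed.

Let image_additive : semi_sigma_additive (image_measure mh).
Proof.
exact: (@measure_semi_sigma_additive _ _ _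
  (measure_function_pushforward__canonical__measure_function_Measure m mh)).
Qed.

HB.instance Definition _ := isMeasure.Build _ _ _ (image_measure mh)
  image0 image_ge0 image_additive.

Let image_fin : fin_num_fun (pushforward m h).
Proof.
move=> A mA; rewrite /pushforward fin_num_measure//.
by rewrite -[X in measurable X]setTI; exact: mh.
Qed.

HB.instance Definition _ :=
  @Measure_isFinite.Build _ _ _ (image_measure mh) image_fin.

End image_measure.

Section cintegral_image.
Context d d' (T : measurableType d) (T' : measurableType d') {R : realType}.

Lemma cintegral_pushforward (h : T -> T') (mh : measurable_fun setT h)
    (nu : {charge set T -> \bar R}) (nu' : {charge set T' -> \bar R}) D f :
  (forall A, measurable A -> A `<=` D -> nu' A = nu (h @^-1` A)) ->
  measurable D -> bounded_measurable D f ->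
  cintegral nu' D f = cintegral nu (h @^-1` D) (f \o h).
Proof.
move=> nuE mD bf.
rewrite (@cintegral_diff _ _ _ _ (image_measure (jordan_pos (hahn nu)) mh)
  (image_measure (jordan_neg (hahn nu)) mh))//.
  by rewrite /cintegral; congr (_ - _); exact: Rintegral_image.
move=> A mA AD /=; rewrite nuE// /image_measure /pushforward -jordanE//.
by rewrite -[X in measurable X]setTI; exact: mh.
Qed.

End cintegral_image.

(** * Charges through their densities *)

Section radon_nikodym.
Local Open Scope charge_scope.
Context d (T : measurableType d) {R : realType}.
Variable la : {finite_measure set T -> \bar R}.
Implicit Types (nu : {charge set T -> \bar R}) (D : set T) (f g : T -> R).

Lemma RN_fineK nu x : nu `<< la -> (fine (('d nu '/d la) x))%:E = ('d nu '/d la) x.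
Proof. by move=> nula; rewrite fineK// Radon_Nikodym_fin_num. Qed.

Lemma RN_integrable nu D : measurable D -> nu `<< la ->
  la.-integrable D (EFin \o (fun x => fine (('d nu '/d la) x))).
Proof.
move=> mD nula; apply: (@eq_integrable _ _ _ _ _ _ ('d nu '/d la)) => //.
  by move=> x _ /=; rewrite RN_fineK.
by apply: (integrableS measurableT) => //; exact: Radon_Nikodym_integrable.
Qed.

Lemma charge_RN nu A : measurable A -> nu `<< la ->
  fine (nu A) = \int[la]_(x in A) fine (('d nu '/d la) x).
Proof.
move=> mA nula; rewrite (Radon_Nikodym_integral nula mA) /Rintegral.
by congr fine; apply: eq_integral => x _; rewrite RN_fineK.
Qed.

Lemma integrable_bounded_measurableM D f g : measurable D -> bounded_measurable D f ->
  la.-integrable D (EFin \o g) -> la.-integrable D (EFin \o (fun x => f x * g x)).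
Proof.
move=> mD [mf [K fK]] ig.
have : la.-integrable D ((EFin \o f) \* (EFin \o g))%E.
  apply: integrableMr => //.
  exists K; split; first exact: num_real.
  by move=> y Ky x Dx; apply: le_trans (fK x Dx) (ltW Ky).
by [].
Qed.

(** Each Jordan part has its own density. The density of [nu] agrees with their difference almost
    everywhere, because both have the same integral over every measurable set. *)
Lemma cintegral_RN nu D f : measurable D -> bounded_measurable D f -> nu `<< la ->
  cintegral nu D f = \int[la]_(x in D) (f x * fine (('d nu '/d la) x)).
Proof.
move=> mD bf nula.
pose jp := charge_of_finite_measure (jordan_pos (hahn nu)).
pose jn := charge_of_finite_measure (jordan_neg (hahn nu)).
have jpla : jp `<< la by exact: jordan_pos_dominates.
have jnla : jn `<< la by exact: jordan_neg_dominates.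
have I nu' : nu' `<< la ->
    la.-integrable D (EFin \o (fun x => f x * fine (('d nu' '/d la) x))).
  by move=> nu'la; apply: integrable_bounded_measurableM => //; exact: RN_integrable.
have C (m : {finite_measure set T -> \bar R}) : charge_of_finite_measure m `<< la ->
    \int[m]_(x in D) f x =
    \int[la]_(x in D) (f x * fine (('d (charge_of_finite_measure m) '/d la) x)).
  move=> mla; rewrite /Rintegral; congr fine.
  rewrite -(@Radon_Nikodym_change_of_variables _ _ _ m la mla)//; last first.
    exact: bounded_measurable_integrable.
  by apply: eq_integral => x _; rewrite EFinM RN_fineK.
rewrite /cintegral (C _ jpla) (C _ jnla) -RintegralB//; try exact: I.
rewrite /Rintegral; congr fine; apply: ae_eq_integral => //.
- by apply: (measurable_int la); under eq_fun do rewrite EFinB; apply: integrableB => //; exact: I.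
- by apply: (measurable_int la); exact: I.
have : ae_eq la D (fun x => ('d jp '/d la) x - ('d jn '/d la) x)%E ('d nu '/d la).
  apply: integral_ae_eq => //.
  - by apply: integrableB => //; apply: (integrableS measurableT) => //; exact: Radon_Nikodym_integrable.
  - apply: (measurable_int la). by apply: (integrableS measurableT) => //; exact: Radon_Nikodym_integrable.
  - move=> E ED mE; rewrite integralB//.
    + by rewrite -!Radon_Nikodym_integral// -jordanE.
    + by apply: (integrableS measurableT) => //; exact: Radon_Nikodym_integrable.
    + by apply: (integrableS measurableT) => //; exact: Radon_Nikodym_integrable.
apply: filterS => x /= + Dx => /(_ Dx) <-.
rewrite fineB ?Radon_Nikodym_fin_num//.
by rewrite mulrBr.
Qed.

End radon_nikodym.

(** * Weak* compactness *)

(** Tychonoff's theorem gives a cluster point [l] in a product of segments. The index [F n] is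
    picked so that the first [n] coordinates are within [1 / (n + 1)] of those of [l]. *)
Lemma diagonal_subsequence {R : realType} (u : nat -> nat -> R) (M : nat -> R) :
  (forall j e, `|u j e| <= M e) ->
  exists (phi : nat -> nat) (l : nat -> R), {homo phi : i j / (i < j)%N} /\
    forall e, u (phi j) e @[j --> \oo] --> l e.
Proof.
move=> uM.
have cK : compact [set f : prod_topology (fun _ : nat => R) |
    forall e, (`[- M e, M e]%classic : set R) (f e)].
  exact: (@tychonoff nat (fun=> R) (fun e => `[- M e, M e]%classic)
    (fun e => @segment_compact _ _ _)).
have uK : (u j @[j --> \oo]) [set f : prod_topology (fun _ : nat => R) |
    forall e, (`[- M e, M e]%classic : set R) (f e)].
  by exists 0%N => // j _ /= e; rewrite in_itv/= -ler_norml; exact: uM.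
have [l [_ lcl]] := cK _ _ uK.
have near_l N : nbhs l [set f : prod_topology (fun _ : nat => R) |
    forall e, (e < N)%N -> `|l e - f e| < N.+1%:R^-1].
  suff H k : nbhs l [set f : prod_topology (fun _ : nat => R) |
      forall e, (e < k)%N -> `|l e - f e| < N.+1%:R^-1] by exact: H.
  elim: k => [|k IH]; first by apply: filterS filterT => f _ e.
  have Hk : nbhs l [set f : prod_topology (fun _ : nat => R) |
      `|l k - f k| < N.+1%:R^-1].
    have B : nbhs (l k : R) [set y : R | `|l k - y| < N.+1%:R^-1].
      by apply: (@nbhsx_ballx _ R (l k) N.+1%:R^-1); rewrite invr_gt0.
    exact: (@proj_continuous nat (fun=> R) k l _ B).
  apply: filterS (filterI IH Hk) => f [Hf fk] e.
  by rewrite ltnS leq_eqVlt => /predU1P[->|]; [exact: fk|exact: Hf].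
have H N n : exists j, (n < j)%N /\ forall e, (e < N)%N -> `|l e - u j e| < N.+1%:R^-1.
  have A : (u j @[j --> \oo]) [set f : prod_topology (fun _ : nat => R) |
      exists2 j, (n < j)%N & f = u j].
    by exists n.+1 => // j /= nj; exists j.
  by have [_ [[j nj ->] /= Hj]] := lcl _ _ A (near_l N); exists j.
pose F := fix F n : nat := match n with
  | 0%N => 0%N | n'.+1 => sval (cid (H n'.+1 (F n'))) end.
have F1 n : (F n < F n.+1)%N by rewrite /=; case: cid => j [].
have F2 n e : (e < n)%N -> `|l e - u (F n) e| < n.+1%:R^-1.
  by case: n => // n; rewrite [F _]/=; case: cid => j [_ ] /=; exact.
exists F, l; split; first by apply: homo_ltn => //; exact: ltn_trans.
move=> e; apply/cvgrPdist_lt => eps eps0; near=> n.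
apply: lt_trans (F2 n e _) _; first by near: n; exact: nbhs_infty_gt.
by near: n; exact: near_infty_natSinv_lt (PosNum eps0).
Unshelve. all: by end_near. Qed.

(** * Sums over the cells of a binary tree *)

Section tree.
Context {R : realType}.

(** Words carry their last choice at the head, so [b :: w] is a child of [w]; the sum runs over the
    descendants of [w] that are [N] levels below it. *)
Fixpoint tree_sum (N : nat) (F : seq bool -> R) (w : seq bool) : R :=
  if N is N'.+1 then tree_sum N' F (false :: w) + tree_sum N' F (true :: w)
  else F w.

Lemma eq_tree_sum N F G w : (forall v, size v = (N + size w)%N -> F v = G v) ->
  tree_sum N F w = tree_sum N G w.
Proof.
elim: N w => [|N IH] w FG /=; first exact: FG.
by rewrite !IH// => v /= vN; apply: FG; rewrite vN addnS.
Qed.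

Lemma cvg_tree_sum (F : nat -> seq bool -> R) G N w :
  (forall v, F j v @[j --> \oo] --> G v) ->
  tree_sum N (F j) w @[j --> \oo] --> tree_sum N G w.
Proof.
move=> FG; elim: N w => [|N IH] w /=; first exact: FG.
by apply: cvgD; exact: IH.
Qed.

(** On a cell of the last level the error is at most [e] times the mass, and both quantities add up
    when two disjoint children are joined. *)
Lemma tree_integral d (Y : measurableType d) (nu : {finite_measure set Y -> \bar R})
    (C : seq bool -> set Y) (f : Y -> R) (c : seq bool -> R) (e : R) N w :
  (forall v, measurable (C v)) ->
  (forall v, C v = C (false :: v) `|` C (true :: v)) ->
  (forall v, [disjoint C (false :: v) & C (true :: v)]) ->
  (forall v, bounded_measurable (C v) f) ->
  (forall v y, size v = (N + size w)%N -> C v y -> `|f y - c v| <= e) ->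
  `|\int[nu]_(x in C w) f x - tree_sum N (fun v => c v * fine (nu (C v))) w|
    <= e * fine (nu (C w)).
Proof.
move=> mC CU CI bf; elim: N w => [|N IH] w fc /=.
  have -> : c w * fine (nu (C w)) = \int[nu]_(x in C w) c w by rewrite Rintegral_cst.
  have bc := bounded_measurable_cst (C w) (c w).
  rewrite -RintegralB//; try exact: bounded_measurable_integrable.
  apply: le_trans (le_normr_Rintegral _ _) _ => //.
    by apply: bounded_measurable_integrable => //; exact: bounded_measurableB.
  have -> : e * fine (nu (C w)) = \int[nu]_(x in C w) e by rewrite Rintegral_cst.
  apply: le_Rintegral => //.
  - apply: bounded_measurable_integrable => //; apply: bounded_measurable_norm.
    exact: bounded_measurableB.
  - by apply: bounded_measurable_integrable => //; exact: bounded_measurable_cst.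
  - by move=> x Cx; exact: fc.
have -> : \int[nu]_(x in C w) f x =
    \int[nu]_(x in C (false :: w)) f x + \int[nu]_(x in C (true :: w)) f x.
  rewrite CU Rintegral_setU//.
  by rewrite -CU; exact: bounded_measurable_integrable.
have -> : fine (nu (C w)) = fine (nu (C (false :: w))) + fine (nu (C (true :: w))).
  rewrite CU measureU// ?fineD ?fin_num_measure//.
  exact/eqP/CI.
rewrite opprD addrACA mulrDr (le_trans (ler_normD _ _))// lerD// IH// => v y vN;
  by apply: fc; rewrite vN addnS.
Qed.

End tree.

(** * Rational balls and the cells they cut out *)

Section borel.
Context {R : realType} (d : nat).
Local Notation T := (R * 'rV[R]_d)%type.

Lemma borel_open (X : ptopologicalType) (U : set X) :
  open U -> measurable (U : set (borel X)).
Proof. by move=> oU; apply: sub_sigma_algebra. Qed.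

Lemma borel_closed (X : ptopologicalType) (F : set X) :
  closed F -> measurable (F : set (borel X)).
Proof.
move=> cF; rewrite -[F]setCK; apply: measurableC; apply: borel_open.
exact: closed_openC.
Qed.

Lemma continuous_borel_measurable (X Y : ptopologicalType) (h : X -> Y) :
  continuous h -> measurable_fun [set: borel X] (h : borel X -> borel Y).
Proof.
move=> /continuousP ch; apply: (@measurability _ _ (borel X) (borel Y) setT h (@open Y)) => // _ [U oU <-].
by rewrite setTI; apply: borel_open; exact: ch.
Qed.

Lemma within_continuous_borel_measurable (X : ptopologicalType) (D : set X)
    (f : X -> R) : closed D ->
  {within D, continuous f} -> measurable_fun (D : set (borel X)) (f : borel X -> R).
Proof.
move=> cD /continuousP cf.
apply: (@measurability _ _ (borel X) R D f _ (RGenOpens.measurableE R)).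
move=> A [B [a [b ->]] <-].
have oI : open (`]a, b[%classic : set R) by exact: interval_open.
have [V oV VE] := (@open_subspaceP _ D _).1 (cf _ oI).
rewrite setIC -VE; apply: measurableI; [exact: borel_open|exact: borel_closed].
Qed.

Lemma ball_measurable (x : T) (e : R) : measurable (ball x e : set (borel T)).
Proof. by apply: borel_open; exact: (@ball_open R T). Qed.

Lemma rational_ball (x : T) (e : R) : 0 < e ->
  exists (q : rat) (v : 'rV[rat]_d) (m : nat),
    ball ((ratr q, map_mx ratr v) : T) m.+1%:R^-1 x /\
    ball ((ratr q, map_mx ratr v) : T) m.+1%:R^-1 `<=` ball x e.
Proof.
move=> e0.
have [m me] : exists m : nat, m.+1%:R^-1 + m.+1%:R^-1 < e.
  have e2 : 0 < e / 2 by lra.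
  have [m _ /(_ _ (leqnn m)) /= H] := near_infty_natSinv_lt (PosNum e2).
  by exists m; rewrite [ltRHS]splitr ltrD.
have i0 : (0 : R) < m.+1%:R^-1 by rewrite invr_gt0.
have [q xq] : exists q : rat, `|x.1 - ratr q| < m.+1%:R^-1.
  have [|q] := @rat_in_itvoo R (x.1 - m.+1%:R^-1) (x.1 + m.+1%:R^-1).
    by rewrite ltrBlDr -addrA ltrDl addr_gt0.
  by rewrite in_itv/= => /andP[q1 q2]; exists q; rewrite ltr_distlC q1.
have [v xv] : exists v : 'rV[rat]_d, forall i j, `|x.2 i j - ratr (v i j)| < m.+1%:R^-1.
  have [v_ vv] := rat_mx_approx x.2.
  have : \forall t \near \oo, forall i j, `|x.2 i j - ratr (v_ t i j)| < m.+1%:R^-1.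
    apply: filter_forall => i; apply: filter_forall => j.
    by move/cvgrPdist_lt : (vv i j); apply.
  by move=> [t _ /(_ _ (leqnn t)) /= H]; exists (v_ t).
exists q, v, m.
have bx : ball ((ratr q, map_mx ratr v) : T) m.+1%:R^-1 x.
  split => /=; first by apply: ball_sym.
  by split => // i j; rewrite mxE; apply: ball_sym; exact: xv.
split => // y qy; apply: (le_ball (ltW me)).
exact: ball_triangle (ball_sym bx) qy.
Qed.

(** An enumeration of the balls with rational centre and radius [1 / (m + 1)]. An index that codes
    no ball gives [setT], which separates nothing. *)
Definition rball (i : nat) : set T :=
  if unpickle i is Some (q, v, m)
  then ball ((ratr q, map_mx ratr (v : 'rV[rat]_d)) : T) m.+1%:R^-1 else setT.

Lemma rball_measurable i : measurable (rball i : set (borel T)).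
Proof.
rewrite /rball; case: unpickle => [[[q v] m]|]; last exact: measurableT.
exact: ball_measurable.
Qed.

(** Near each point a single small rational ball does it; compactness then bounds the index of the
    balls uniformly on [Q]. *)
Lemma rball_separates (Q : set T) (e : R) : compact Q -> 0 < e ->
  exists N, forall x y, Q x -> (forall i, (i < N)%N -> rball i x -> rball i y) ->
    ball x e y.
Proof.
move=> /compact_near_coveringP cQ e0.
have [|N _ H] := cQ nat \oo (fun N x => forall y,
    (forall i, (i < N)%N -> rball i x -> rball i y) -> ball x e y) _.
  move=> x Qx; have e20 : 0 < e / 2 by lra.
  have [q [v [m [xq qx]]]] := rational_ball x e20.
  have rE : rball (pickle (q, v, m)) =
      ball ((ratr q, map_mx ratr (v : 'rV[rat]_d)) : T) m.+1%:R^-1.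
    by rewrite /rball pickleK.
  exists (rball (pickle (q, v, m)), [set N | (pickle (q, v, m) < N)%N]).
    split=> /=; last by exists (pickle (q, v, m)).+1.
    by rewrite rE; apply: open_nbhs_nbhs; split => //; exact: (@ball_open R T).
  move=> [x' N] /= [x'q Nq] y /(_ _ Nq x'q); rewrite rE in x'q * => yq.
  rewrite [e]splitr; apply: ball_triangle (qx _ yq).
  by apply: ball_sym; exact: qx.
by exists N => x y Qx; exact: (H N (leqnn N)).
Qed.

(** Heine-Cantor, by the same covering argument. *)
Lemma within_unif_continuous (Q : set T) (f : T -> R) (e : R) :
  compact Q -> {within Q, continuous f} -> 0 < e ->
  exists2 r, 0 < r & forall x y, Q x -> Q y -> ball x r y -> `|f x - f y| <= e.
Proof.
move=> /compact_near_coveringP cQ /subspace_continuousP cf e0.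
have [|N _ H] := cQ nat \oo (fun N x => Q x -> forall y, Q y ->
    ball x N.+1%:R^-1 y -> `|f x - f y| <= e) _.
  move=> x Qx; have e20 : 0 < e / 2 by lra.
  have /cvgrPdist_lt/(_ _ e20) := cf x Qx.
  rewrite near_withinE => /nbhs_ballP[r /= r0 xr].
  have r20 : 0 < r / 2 by lra.
  exists (ball x (r / 2), [set N | N.+1%:R^-1 < r / 2]).
    by split=> /=; [exact: nbhsx_ballx|exact: near_infty_natSinv_lt (PosNum r20)].
  move=> [x' N] /= [xx' Nr] Qx' y Qy x'y.
  have xy : ball x r y.
    rewrite [r]splitr; apply: ball_triangle xx' _; exact: le_ball (ltW Nr) _ x'y.
  have h1 := xr _ xy Qy; have h2 := xr x' (le_ball _ xx') Qx'.
  have -> : f x' - f y = (f x - f y) - (f x - f x') by ring.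
  by rewrite [e]splitr (le_trans (ler_normB _ _))// lerD// ltW// h2//; lra.
exists N.+1%:R^-1; first by rewrite invr_gt0.
by move=> x y Qx Qy; exact: (H N (leqnn N) _ Qx Qx).
Qed.

(** The letter added at depth [i] decides membership in [rball i]. The cells of a given depth
    partition [Q], and by [rball_separates] two points of a deep cell are close. *)
Fixpoint cell (Q : set T) (w : seq bool) : set T :=
  if w is b :: v then cell Q v `&` (if b then rball (size v) else ~` rball (size v))
  else Q.

Lemma cell_sub Q w : cell Q w `<=` Q.
Proof. by elim: w => [|b w IH] x //= [/IH]. Qed.

Lemma cell_measurable Q w : measurable (Q : set (borel T)) ->
  measurable (cell Q w : set (borel T)).
Proof.
move=> mQ; elim: w => [//|b w IH] /=; apply: measurableI => //.
by case: b; [|apply: measurableC]; exact: rball_measurable.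
Qed.

Lemma cell_split Q w : cell Q w = cell Q (false :: w) `|` cell Q (true :: w).
Proof. by rewrite /= -setIUr setvU setIT. Qed.

Lemma cell_disj Q w : [disjoint cell Q (false :: w) & cell Q (true :: w)].
Proof. by apply/eqP; rewrite /= setIACA setICl setI0. Qed.

Lemma cell_rball Q w x y i : cell Q w x -> cell Q w y -> (i < size w)%N ->
  rball i x -> rball i y.
Proof.
elim: w => [//|b w IH] /= [xw xb] [yw yb]; rewrite ltnS leq_eqVlt.
move=> /predU1P[-> xi|iw]; last exact: IH.
by case: b xb yb.
Qed.

End borel.

Lemma within_continuous_bounded_measurable {R : realType} (X : ptopologicalType)
    (Q : set X) (f : X -> R) : compact Q -> closed Q -> {within Q, continuous f} ->
  bounded_measurable (Q : set (borel X)) f.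
Proof.
move=> cQ clQ cf; split; first exact: within_continuous_borel_measurable.
have /compact_bounded[M [_ HM]] := continuous_compact cf cQ.
exists (`|M| + 1) => x Qx; apply: HM; last by exists x.
by rewrite (le_lt_trans (ler_norm M))// ltrDl.
Qed.

(* Masses [p w] of the cells of a binary tree are realised as lengths of nested
   intervals [seg w]; reading off the cells containing [u] gives a map from
   [seg [::]] to [Q] whose image measure of Lebesgue measure is the limit. *)
Section skorokhod.
Context {R : realType} (d : nat).
Local Notation T := (R * 'rV[R]_d)%type.
Variables (Q : set T) (x0 : T) (p : seq bool -> R).
Hypotheses (compQ : compact Q) (Qx0 : Q x0).
Hypothesis p_ge0 : forall w, 0 <= p w.
Hypothesis p_split : forall w, p w = p (false :: w) + p (true :: w).
Hypothesis p_cell : forall w, 0 < p w -> cell Q w !=set0.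

Let closedQ : closed Q.
Proof. by apply: compact_closed compQ; exact: (@norm_hausdorff R T). Qed.

Let mQ : measurable (Q : set (borel T)).
Proof. exact: borel_closed. Qed.

Fixpoint left (w : seq bool) : R :=
  if w is b :: v then left v + (if b then p (false :: v) else 0) else 0.

(** Half-open, so that two siblings tile their parent and a word of mass 0 gets the empty
    interval. *)
Definition seg (w : seq bool) : set R := `[left w, left w + p w[%classic.

Fixpoint path (N : nat) (u : R) : seq bool :=
  if N is N'.+1 then
    let w := path N' u in (left w + p (false :: w) <= u) :: w
  else [::].

Lemma size_path N u : size (path N u) = N.
Proof. by elim: N => //= N ->. Qed.

Lemma seg_split w : seg w = seg (false :: w) `|` seg (true :: w).
Proof.
apply/seteqP; split=> u; rewrite /seg /= !in_itv/= addr0 (p_split w).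
  by move=> /andP[-> u2]; case: ltP => _; [left|right; lra].
have := p_ge0 (false :: w); have := p_ge0 (true :: w).
by move=> ? ? [] /andP[]; lra.
Qed.

Lemma seg_disj w : [disjoint seg (false :: w) & seg (true :: w)].
Proof.
apply/eqP; rewrite -subset0 => u; rewrite /seg /= !in_itv/= addr0.
by move=> [/andP[_ u1] /andP[u2 _]]; lra.
Qed.

Lemma seg_sub w : seg w `<=` seg [::].
Proof.
elim: w => [//|b w IH]; apply: subset_trans IH; rewrite [X in _ `<=` X]seg_split.
by case: b => u; [right|left].
Qed.

Lemma seg_path N u : seg [::] u -> seg (path N u) u.
Proof.
move=> Hu; elim: N => [//|N IH] /=.
move: IH; rewrite /seg/= !in_itv/= => /andP[u1]; rewrite (p_split (path N u)) => u2.
case: ifPn => h /=; [rewrite h/=|rewrite addr0 u1/= ltNge//].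
by rewrite -addrA.
Qed.

Lemma path_seg w u : seg w u -> path (size w) u = w.
Proof.
elim: w => [//|b w IH] Hu /=.
have Hw : seg w u by rewrite seg_split; case: b Hu; [right|left].
rewrite (IH Hw); congr (_ :: _); move: Hu; rewrite /seg/= in_itv/=.
by case: b => /= /andP[]; [move=> ->|rewrite addr0 => _; rewrite leNgt => ->].
Qed.

(** A sample point of the cell. The default [x0] occurs only for an empty cell, which has mass 0 by
    [p_cell]. *)
Definition pt (w : seq bool) : T := xget x0 (cell Q w).

Lemma cell_pt w u : seg w u -> cell Q w (pt w).
Proof.
rewrite /seg/= in_itv/= => /andP[u1 u2]; apply: xgetPex; apply: p_cell; lra.
Qed.

Lemma cell_path N k u : cell Q (path (k + N) u) `<=` cell Q (path N u).
Proof. by elim: k => [//|k IH] x [/IH]. Qed.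

(** [y] is a cluster point of the sample points along the branch of [u]. The cells of a branch are
    nested, so past a depth [N] at which the balls separate at scale [e], all sample points are
    within [e] of the one at depth [N]; another [e] reaches the cluster point. *)
Lemma skorokhod_ex u : exists y, [/\ Q y, ~ seg [::] u -> y = x0 &
  seg [::] u -> forall e N, 0 < e ->
    (forall x z, Q x -> (forall i, (i < N)%N -> rball i x -> rball i z) -> ball x e z) ->
    ball (pt (path N u)) (e + e) y].
Proof.
have [Hu|Hu] := pselect (seg [::] u); last by exists x0.
have sQ n : cell Q (path n u) (pt (path n u)) by apply: cell_pt; exact: seg_path.
have [y [Qy ycl]] := compQ (F := (pt (path n u) @[n --> \oo])) _
   (ex_intro2 _ _ 0%N I (fun n _ => cell_sub (sQ n))).
exists y; split=> // _ e N e0 HN.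
have [_ [[n Nn <-] yn]] := ycl [set pt (path n u) | n in [set n | (N <= n)%N]]
   (ball y e) (ex_intro2 _ _ N I (fun n Nn => ex_intro2 _ _ n Nn erefl))
   (nbhsx_ballx y e e0).
apply: ball_triangle (ball_sym yn); apply: HN; first exact: cell_sub (sQ N).
move=> i iN; apply: (cell_rball (sQ N)); last by rewrite size_path.
by apply: (@cell_path N (n - N)); rewrite subnK.
Qed.

Definition skorokhod (u : R) : T := sval (cid (skorokhod_ex u)).

Lemma skorokhod_in u : Q (skorokhod u).
Proof. by rewrite /skorokhod; case: cid => y []. Qed.

Lemma skorokhod_out u : ~ seg [::] u -> skorokhod u = x0.
Proof. by rewrite /skorokhod; case: cid => y []. Qed.

Lemma skorokhod_ball u e N : seg [::] u -> 0 < e ->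
  (forall x z, Q x -> (forall i, (i < N)%N -> rball i x -> rball i z) -> ball x e z) ->
  ball (pt (path N u)) (e + e) (skorokhod u).
Proof. by move=> Hu e0 HN; rewrite /skorokhod; case: cid => y [_ _] /=; apply. Qed.

Lemma seg_measurable w : measurable (seg w : set (measurableTypeR R)).
Proof. exact: measurable_itv. Qed.

(** Within [seg [::]] the preimage of a closed [F] is a countable intersection of countable unions
    of intervals: for each [m], those [seg w] at depth [N m] whose sample point is within
    [2 / (m + 1)] of a point of [F]. Elsewhere the map is constant. *)
Lemma skorokhod_measurable :
  measurable_fun [set: measurableTypeR R] (skorokhod : _ -> borel T).
Proof.
suff H (F : set T) : closed F -> measurable (skorokhod @^-1` F : set (measurableTypeR R)).
  apply: (@measurability _ _ (measurableTypeR R) (borel T) setT skorokhod (@open T)) => //.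
  move=> B [U oU <-]; rewrite setTI -[U]setCK preimage_setC; apply: measurableC.
  exact: (H (~` U) (open_closedC oU)).
move=> cF.
have -> : skorokhod @^-1` F = ((skorokhod @^-1` F) `&` ~` seg [::]) `|`
    ((skorokhod @^-1` F) `&` seg [::]) by rewrite -setIUr setvU setIT.
apply: measurableU.
  have [Fx0|Fx0] := pselect (F x0).
    rewrite (_ : _ `&` _ = ~` seg [::]).
      by apply: measurableC; exact: seg_measurable.
    by apply/seteqP; split=> u /=; [case|move=> Hu; split=> //; rewrite skorokhod_out].
  rewrite (_ : _ `&` _ = set0); first exact: measurable0.
  by apply/seteqP; split=> u [] //= Fu Hu; apply: Fx0; rewrite -(skorokhod_out Hu).
have i0 m : (0 : R) < m.+1%:R^-1 by rewrite invr_gt0.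
pose N m := sval (cid (rball_separates compQ (i0 m))).
have NP m : forall x y, Q x ->
    (forall i, (i < N m)%N -> rball i x -> rball i y) -> ball x m.+1%:R^-1 y.
  by rewrite /N; case: cid.
pose W m := [set w | size w = N m /\
  exists y, F y /\ ball (pt w) (m.+1%:R^-1 + m.+1%:R^-1) y].
rewrite (_ : _ `&` _ = \bigcap_m \bigcup_(w in W m) seg w).
  apply: bigcapT_measurable => m; rewrite bigcup_mkcond.
  apply: countable_bigcupT_measurable; first exact: countableP.
  by move=> w; case: ifP => _ //; exact: seg_measurable.
apply/seteqP; split=> u.
  move=> [Fu Hu] m _; exists (path (N m) u); last exact: seg_path.
  split; first exact: size_path.
  by exists (skorokhod u); split=> //; exact: (skorokhod_ball Hu (i0 m) (@NP m)).
move=> Hu; have [w0 _ w0u] := Hu 0%N Logic.I; have Hu0 := seg_sub w0u.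
split=> //; apply: cF => B /nbhs_ballP[e /= e0 eB].
(* Two distances below [2 / (m + 1)] are added at the end, hence the quarter. *)
have e4 : 0 < e / 4 by lra.
have [m _ /(_ _ (leqnn m)) /= me] := near_infty_natSinv_lt (PosNum e4).
have [w [wN [y [Fy wy]]] wu] := Hu m I.
exists y; split=> //; apply: eB.
have := skorokhod_ball Hu0 (i0 m) (@NP m).
rewrite -wN (path_seg wu) => /ball_sym /ball_triangle /(_ wy).
by apply: le_ball; move: me; move: (m.+1%:R^-1) => r; lra.
Qed.

Let seg_fin : (lebesgue_measure (seg [::]) < +oo)%E.
Proof. by rewrite lebesgue_measure_itv/=; case: ifP => _; rewrite ?ltry. Qed.

Definition skorokhod_measure : {finite_measure set (borel T) -> \bar R} :=
  image_measure (mfrestr (seg_measurable [::]) seg_fin) skorokhod_measurable.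

Lemma seg_length w :
  mfrestr (seg_measurable [::]) seg_fin (seg w) = (p w)%:E.
Proof.
rewrite /mfrestr /mrestr setIidl; last exact: seg_sub.
rewrite lebesgue_measure_itv/= lte_fin ltrDl; case: ltP => p0.
  by rewrite -EFinB addrAC subrr add0r.
by congr EFin; apply/eqP; rewrite eq_le p0 p_ge0.
Qed.

Lemma skorokhod_measure_conc A : measurable A ->
  skorokhod_measure A = skorokhod_measure (A `&` Q).
Proof.
move=> mA; rewrite /skorokhod_measure/= /image_measure /pushforward.
congr (_ _); apply/seteqP; split=> u //= => [Au|[]//].
by split=> //; exact: skorokhod_in.
Qed.

(** The depth depends only on the modulus of continuity of [f], so one [N] and one choice of sample
    points serve every measure. For the constructed measure the weights are the prescribed masses
    [p], because its integral is split along the intervals and not along the cells. *)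
Lemma skorokhod_approx (f : T -> R) (e : R) :
  {within Q, continuous f} -> 0 < e ->
  exists N, (forall m : {finite_measure set (borel T) -> \bar R},
      `|\int[m]_(x in Q) f x -
        tree_sum N (fun w => f (pt w) * fine (m (cell Q w))) [::]| <= e * fine (m Q)) /\
    `|\int[skorokhod_measure]_(x in Q) f x -
        tree_sum N (fun w => f (pt w) * p w) [::]| <= e * p [::].
Proof.
move=> cf e0; have bf := within_continuous_bounded_measurable compQ closedQ cf.
have [r r0 Hr] := within_unif_continuous compQ cf e0.
have r20 : 0 < r / 2 by lra.
have [N HN] := rball_separates compQ r20.
exists N; split=> [m|].
  apply: (@tree_integral R _ (borel T) m (cell Q) f (fun w => f (pt w)) e N [::]) => //.
  - by move=> v; exact: cell_measurable.
  - exact: cell_split.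
  - exact: cell_disj.
  - by move=> v; apply: (bounded_measurableS mQ) => //; exact: cell_sub.
  - move=> v y; rewrite addn0 => vN vy.
    have vp : cell Q v (pt v) by apply: xgetPex; exists y.
    have Qy := cell_sub vy; have Qp := cell_sub vp; apply: Hr => //.
    apply: (@le_ball _ _ _ (r / 2)); first lra.
    by apply: HN => // i; rewrite -vN; exact: (cell_rball vy vp).
have sQ : skorokhod @^-1` Q = setT.
  by apply/seteqP; split=> // u _; exact: skorokhod_in.
pose nu : {finite_measure set (measurableTypeR R) -> \bar R} :=
  mfrestr (seg_measurable [::]) seg_fin.
have -> := @Rintegral_image _ (measurableTypeR R) R _ (borel T) skorokhod nu
  skorokhod_measure Q f skorokhod_measurable mQ bf (fun _ _ _ => erefl).
rewrite sQ.
have bfs : bounded_measurable [set: measurableTypeR R] (f \o skorokhod).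
  case: bf => mf [K fK]; split; last by exists K => u _; exact/fK/skorokhod_in.
  apply: (measurable_comp _ _ mf) => //; first by move=> _ [u _ <-]; exact: skorokhod_in.
  exact: skorokhod_measurable.
have -> : \int[nu]_x (f \o skorokhod) x = \int[nu]_(x in seg [::]) (f \o skorokhod) x.
  rewrite -(setUv (seg [::])) Rintegral_setU//.
  - rewrite [X in _ + X](_ : _ = 0) ?addr0//.
    rewrite /Rintegral null_set_integral//.
    + by apply: measurableC; exact: seg_measurable.
    + apply/measurable_EFinP; apply: measurable_funTS; by case: bfs.
    + transitivity (lebesgue_measure (~` seg [::] `&` seg [::])); first by [].
      by rewrite setICl measure0.
  - exact: seg_measurable.
  - by apply: measurableC; exact: seg_measurable.
  - by rewrite setUv; exact: bounded_measurable_integrable.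
  - by apply/eqP; rewrite setICr.
have nuE v : nu (seg v) = (p v)%:E by exact: seg_length.
have -> : tree_sum N (fun w => f (pt w) * p w) [::] =
    tree_sum N (fun w => f (pt w) * fine (nu (seg w))) [::].
  by apply: eq_tree_sum => v _; rewrite nuE.
have -> : p [::] = fine (nu (seg [::])) by rewrite nuE.
apply: (@tree_integral R _ _ nu seg _ (fun w => f (pt w)) e N [::]).
- exact: seg_measurable.
- exact: seg_split.
- exact: seg_disj.
- by move=> v; exact: bounded_measurableS bfs.
- move=> v u; rewrite addn0 => vN vu; rewrite distrC /=.
  apply: Hr; [exact: cell_sub (cell_pt vu)|exact: skorokhod_in|].
  rewrite -(path_seg vu) vN [r]splitr; apply: skorokhod_ball => //.
  exact: seg_sub vu.
Qed.

End skorokhod.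

(** Along a subsequence the masses of all cells converge. The limits are additive over children and
    vanish on empty cells, so they are the lengths of a tree of intervals. The limit measure need
    not give [cell Q w] the mass [p i w]; only integrals of continuous functions are compared,
    through tree sums. *)
Lemma weak_compactness {R : realType} (d : nat) (Q : set (R * 'rV[R]_d)%type)
    (I : countType) (m : I -> nat -> {finite_measure set (borel (R * 'rV[R]_d)%type) -> \bar R})
    (M : R) :
  compact Q -> Q !=set0 -> (forall i j, fine (m i j Q) <= M) ->
  exists (phi : nat -> nat) (nu : I -> {finite_measure set (borel (R * 'rV[R]_d)%type) -> \bar R}),
    [/\ {homo phi : i j / (i < j)%N},
      forall i A, measurable A -> nu i A = nu i (A `&` Q) &
      forall i f, {within Q, continuous f} ->
        \int[m i (phi j)]_(x in Q) f x @[j --> \oo] --> \int[nu i]_(x in Q) f x].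
Proof.
move=> cQ [x0 Qx0] mM.
have clQ : closed Q by apply: compact_closed cQ; exact: (@norm_hausdorff R (R * 'rV[R]_d)%type).
have mQ : measurable (Q : set (borel (R * 'rV[R]_d)%type)) by exact: borel_closed.
pose u j e : R := if unpickle e is Some (i, w) then fine (m i j (cell Q w)) else 0.
have mC w := cell_measurable w mQ.
have m0 i j w : 0 <= fine (m i j (cell Q w)) by rewrite fine_ge0.
have mle i j w : fine (m i j (cell Q w)) <= M.
  apply: le_trans (mM i j); rewrite fine_le ?fin_num_measure//.
  by rewrite le_measure ?inE//; exact: cell_sub.
(* With an empty [I] nothing forces [M] to be nonnegative. *)
have M0 : 0 <= M \/ forall i : I, False.
  have [[i _]|h] := pselect (exists i : I, True); last by right=> i; apply: h; exists i.
  by left; apply: le_trans (mM i 0%N); exact: (m0 i 0%N [::]).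
have uM j e : `|u j e| <= `|M|.
  rewrite /u; case: unpickle => [[i w]|]; last by rewrite normr0.
  by rewrite ger0_norm// (le_trans (mle _ _ _))// ler_norm.
have [phi [l [phi_lt ul]]] := diagonal_subsequence uM.
pose p (i : I) (w : seq bool) : R := l (pickle (i, w)).
have cp i w : fine (m i (phi j) (cell Q w)) @[j --> \oo] --> p i w.
  have := ul (pickle (i, w)); apply: cvg_trans; apply: near_eq_cvg.
  by apply: nearW => j; rewrite /u pickleK.
have p_ge0 i w : 0 <= p i w.
  rewrite -(cvg_lim _ (cp i w))//; apply: limr_ge; first exact: cvgP (cp i w).
  by apply: nearW => j; exact: m0.
have p_split i w : p i w = p i (false :: w) + p i (true :: w).
  suff : fine (m i (phi j) (cell Q w)) @[j --> \oo] -->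
      p i (false :: w) + p i (true :: w) by exact: cvg_unique (cp i w).
  have E j : fine (m i (phi j) (cell Q w)) =
      fine (m i (phi j) (cell Q (false :: w))) + fine (m i (phi j) (cell Q (true :: w))).
    rewrite cell_split measureU// ?fineD ?fin_num_measure//.
    exact/eqP/cell_disj.
  under eq_cvg do rewrite E.
  by apply: cvgD; exact: cp.
have p_cell i w : 0 < p i w -> cell Q w !=set0.
  move=> pw; apply/set0P/negP => /eqP cw.
  have : p i w = 0.
    suff : fine (m i (phi j) (cell Q w)) @[j --> \oo] --> (0 : R).
      exact: cvg_unique (cp i w).
    by rewrite cw; under eq_cvg do rewrite measure0; exact: cvg_cst.
  by move=> p0; rewrite p0 ltxx in pw.
exists phi, (fun i => skorokhod_measure cQ Qx0 (p_ge0 i) (p_split i) (p_cell i)).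
split=> // [i A mA|i f cf]; first exact: skorokhod_measure_conc.
have {}M0 : 0 <= M by case: M0 => // /(_ i).
apply/cvgrPdist_le => e e0.
(* Three errors are added, two of which are at most [e1] times a mass bounded by [M]. *)
pose e1 := e / (3 * (M + 1)).
have e10 : 0 < e1 by rewrite divr_gt0// mulr_gt0// ltr_pwDr.
have e1M x : x <= M -> e1 * x <= e / 3.
  move=> xM; rewrite /e1 invfM mulrA -mulrA ger_pMr; last by rewrite divr_gt0.
  by rewrite mulrC ler_pdivrMr ?ltr_pwDr// mul1r; lra.
have [N [H1 H2]] := skorokhod_approx cQ Qx0 (p_ge0 i) (p_split i) (p_cell i) cf e10.
have pM : p i [::] <= M.
  rewrite -(cvg_lim _ (cp i [::]))//; apply: limr_le; first exact: cvgP (cp i [::]).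
  by apply: nearW => j; exact: mle.
have e30 : 0 < e / 3 by rewrite divr_gt0.
have ct : tree_sum N (fun w => f (pt Q x0 w) * fine (m i (phi j) (cell Q w))) [::]
    @[j --> \oo] --> tree_sum N (fun w => f (pt Q x0 w) * p i w) [::].
  by apply: cvg_tree_sum => w; apply: cvgM; [exact: cvg_cst|exact: cp].
have /cvgrPdist_le/(_ _ e30) := ct.
have L (a b x y : R) : `|x - a| <= e / 3 -> `|y - b| <= e / 3 ->
    `|a - b| <= e / 3 -> `|x - y| <= e.
  move=> h1 h2 h3; have -> : x - y = (x - a) + (a - b) - (y - b) by ring.
  rewrite (le_trans (ler_normB _ _))//.
  have := ler_normD (x - a) (a - b); lra.
apply: filterS => j; apply: L; first exact: le_trans H2 (e1M _ pM).
exact: le_trans (H1 (m i (phi j))) (e1M _ (mM i (phi j))).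
Qed.

(** * Approximation of Borel sets by continuous functions *)

Section approximation.
Context {R : realType} (d : nat).
Local Notation T := (R * 'rV[R]_d)%type.
Variable la : {finite_measure set (borel T) -> \bar R}.

(** The sets with this property form a sigma-algebra that contains the open sets. *)
Definition continuous_approx (A : set T) : Prop :=
  measurable (A : set (borel T)) /\ forall e, 0 < e -> exists phi : T -> R,
    [/\ continuous phi, forall x, 0 <= phi x <= 1 &
        \int[la]_x `|phi x - \1_A x| <= e].

Lemma continuous_unit_bounded_measurable (phi : T -> R) :
  continuous phi -> (forall x, 0 <= phi x <= 1) ->
  bounded_measurable [set: borel T] phi.
Proof.
move=> cphi phi01; split; last first.
  by exists 1 => x _; rewrite ger0_norm; case/andP: (phi01 x).
apply: (@within_continuous_borel_measurable R T setT); first exact: closedT.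
exact: continuous_subspaceT.
Qed.

Lemma approx_err_integrable (phi : T -> R) A :
  continuous phi -> (forall x, 0 <= phi x <= 1) ->
  measurable (A : set (borel T)) ->
  la.-integrable [set: borel T] (EFin \o (fun x => `|phi x - \1_A x|)).
Proof.
move=> cphi phi01 mA; apply: bounded_measurable_integrable => //.
apply: bounded_measurable_norm; apply: bounded_measurableB.
  exact: continuous_unit_bounded_measurable.
exact: bounded_measurable_indic.
Qed.

Lemma continuous_approxC A : continuous_approx A -> continuous_approx (~` A).
Proof.
move=> [mA HA]; split; first exact: measurableC.
move=> e e0; have [phi [cphi phi01 He]] := HA e e0.
exists (fun x => 1 - phi x); split.
- by move=> x; apply: cvgB; [exact: cvg_cst|exact: cphi].
- by move=> x; have := phi01 x; lra.
- rewrite (_ : Rintegral _ _ _ = \int[la]_x `|phi x - \1_A x|)//.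
  apply: eq_Rintegral => x _; rewrite -normrN !indicE in_setC.
  by congr `|_|; case: (x \in A) => /=; lra.
Qed.

Lemma continuous_approxU A B : continuous_approx A -> continuous_approx B ->
  continuous_approx (A `|` B).
Proof.
move=> [mA HA] [mB HB]; split; first exact: measurableU.
move=> e e0; have e20 : 0 < e / 2 by lra.
have [phi [cphi phi01 He]] := HA _ e20.
have [psi [cpsi psi01 Hf]] := HB _ e20.
have cm : continuous (fun x => Num.max (phi x) (psi x)).
  by move=> x; apply: continuous_max; [exact: cphi|exact: cpsi].
have m01 x : 0 <= Num.max (phi x) (psi x) <= 1.
  by have := phi01 x; have := psi01 x; case: (leP (phi x) (psi x)) => _; lra.
exists (fun x => Num.max (phi x) (psi x)); split => //.
rewrite [e]splitr (le_trans _ (lerD He Hf))//.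
rewrite -RintegralD//; try exact: approx_err_integrable.
apply: le_Rintegral => //.
- by apply: approx_err_integrable => //; exact: measurableU.
- apply: bounded_measurable_integrable => //; apply: bounded_measurableD;
    apply: bounded_measurable_norm; apply: bounded_measurableB;
    try exact: continuous_unit_bounded_measurable;
    exact: bounded_measurable_indic.
- move=> x _; have := phi01 x; have := psi01 x; rewrite !indicE in_setU.
  have n1 (a : R) : a <= `|a| by rewrite ler_norm.
  have n2 (a : R) : - a <= `|a| by rewrite -normrN ler_norm.
  have := n1 (phi x - (x \in A)%:R); have := n2 (phi x - (x \in A)%:R).
  have := n1 (psi x - (x \in B)%:R); have := n2 (psi x - (x \in B)%:R).
  rewrite ler_norml.
  case: (leP (phi x) (psi x)) => ?; case: (x \in A); case: (x \in B) => /=; lra.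
Qed.

(** Finite unions, already covered by taking maxima, exhaust the countable union in measure. *)
Lemma continuous_approx_bigcup (A : (set T)^nat) :
  (forall n, continuous_approx (A n)) -> continuous_approx (\bigcup_n A n).
Proof.
move=> HA; have mA n : measurable (A n : set (borel T)) by case: (HA n).
split; first exact: bigcupT_measurable.
have mU : measurable (\bigcup_n A n : set (borel T)) by exact: bigcupT_measurable.
pose B n := \big[setU/set0]_(i < n.+1) A i.
have HB n : continuous_approx (B n).
  rewrite /B; elim: n.+1 => [|k IH]; last by rewrite big_ord_recr; exact: continuous_approxU.
  rewrite big_ord0; split; first exact: measurable0.
  move=> e e0; exists (fun=> 0); split.
  - by move=> x; exact: cvg_cst.
  - by move=> x; rewrite lexx ler01.
  - rewrite (_ : Rintegral _ _ _ = 0) ?ltW//.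
    rewrite /Rintegral integral0_eq// => x _.
    by rewrite indicE in_set0 subr0 normr0.
have BU n : B n `<=` \bigcup_n A n.
  by rewrite /B -bigcup_mkord => x [k _ Akx]; exists k.
move=> e e0; have e20 : 0 < e / 2 by lra.
have cB : la (B n) @[n --> \oo] --> la (\bigcup_n A n).
  rewrite -bigcup_bigsetU_bigcup; apply: nondecreasing_cvg_mu.
  - by move=> n; case: (HB n).
  - by apply: bigcupT_measurable => n; case: (HB n).
  - by move=> i j ij; apply/subsetPset; apply: subset_bigsetU; rewrite ltnS.
have {}cB : fine (la (B n)) @[n --> \oo] --> fine (la (\bigcup_n A n)).
  by apply: fine_cvg; rewrite fineK ?fin_num_measure.
have /cvgrPdist_le/(_ _ e20)[n _ /(_ n (leqnn n)) Hn] := cB.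
have [mB /(_ _ e20)[phi [cphi phi01 He]]] := HB n.
exists phi; split => //.
have bi (C : set T) : measurable (C : set (borel T)) ->
  bounded_measurable [set: borel T] (\1_C : _ -> R) by exact: bounded_measurable_indic.
have I2 : \int[la]_x (\1_(\bigcup_n A n) x - \1_(B n) x) <= e / 2.
  rewrite RintegralB//; try by apply: bounded_measurable_integrable => //; exact: bi.
  rewrite /Rintegral !integral_indic// !setIT.
  exact: le_trans (ler_norm _) Hn.
rewrite [e]splitr (le_trans _ (lerD He I2))//.
have ib : la.-integrable [set: borel T] (EFin \o (fun x => \1_(\bigcup_n A n) x - \1_(B n) x)).
  by apply: bounded_measurable_integrable => //; apply: bounded_measurableB; exact: bi.
rewrite -RintegralD//; last exact: approx_err_integrable.
apply: le_Rintegral => //.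
- exact: approx_err_integrable.
- apply: bounded_measurable_integrable => //; apply: bounded_measurableD.
    apply: bounded_measurable_norm; apply: bounded_measurableB; last exact: bi.
    exact: continuous_unit_bounded_measurable.
  by apply: bounded_measurableB; exact: bi.
- move=> x _; have := phi01 x; rewrite !indicE.
  have n1 (a : R) : a <= `|a| by rewrite ler_norm.
  have n2 (a : R) : - a <= `|a| by rewrite -normrN ler_norm.
  have := n1 (phi x - (x \in B n)%:R); have := n2 (phi x - (x \in B n)%:R).
  rewrite ler_norml.
  have [xB|xB] := boolP (x \in B n); have [xU|xU] := boolP (x \in \bigcup_n A n) => /=; try lra.
  by move: xU; rewrite (mem_set (BU n x (set_mem xB))).
Qed.

Definition dist_to (F : set T) (x : T) : R := fine (edist_inf F x).

Lemma edist_fin_num (x y : T) : edist (x, y) \is a fin_num.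
Proof.
apply/edist_finP; exists (`|x - y| + 1) => /=; first by rewrite ltr_wpDl.
by rewrite -ball_normE /ball_/= ltrDl.
Qed.

Lemma edist_inf_fin_num (F : set T) (x : T) : F !=set0 -> edist_inf F x \is a fin_num.
Proof.
move=> [y Fy]; rewrite ge0_fin_numE ?edist_inf_ge0//.
apply: (@le_lt_trans _ _ (edist (x, y))); first by apply: ereal_inf_lbound; exists y.
by rewrite ltey_eq edist_fin_num.
Qed.

Lemma continuous_dist_to (F : set T) : F !=set0 -> continuous (dist_to F).
Proof.
move=> F0 x; apply: fine_cvg; rewrite fineK ?edist_inf_fin_num//.
exact: edist_inf_continuous.
Qed.

Lemma dist_to_gt0 (F : set T) x : closed F -> F !=set0 -> ~ F x -> 0 < dist_to F x.
Proof.
move=> cF F0 Fx; rewrite lt_neqAle fine_ge0 ?edist_inf_ge0// andbT eq_sym.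
apply/eqP => d0; apply: Fx; apply: cF => B /nbhs_ballP[e /= e0 eB].
have : (edist_inf F x < e%:E)%E.
  by rewrite -[edist_inf F x]fineK ?edist_inf_fin_num// -/(dist_to F x) d0 lte_fin.
move=> /ereal_inf_lt[_ [y Fy <-]] xy; exists y; split => //; apply: eB.
exact: (edist_lt_ball xy).
Qed.

(** [phi n] is the distance to the complement of [U], multiplied by [n] and cut at 1. It tends
    pointwise to the indicator, and dominated convergence applies. An empty complement is at
    infinite distance and treated apart. *)
Lemma continuous_approx_open (U : set T) : open U -> continuous_approx U.
Proof.
move=> oU; split; first exact: borel_open.
move=> e e0; have [UT|U0] := eqVneq (~` U) set0.
  exists (fun=> 1); split.
  - by move=> x; exact: cvg_cst.
  - by move=> x; rewrite lexx ler01.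
  - rewrite (_ : Rintegral _ _ _ = 0) ?ltW// /Rintegral integral0_eq// => x _.
    by rewrite indicE -[U]setCK UT setC0 in_setT subrr normr0.
have {}U0 : ~` U !=set0 by apply/set0P.
pose phi n (x : T) := Num.min 1 (n%:R * dist_to (~` U) x).
have d0 x : 0 <= dist_to (~` U) x by rewrite fine_ge0 ?edist_inf_ge0.
have phi01 n x : 0 <= phi n x <= 1.
  by rewrite le_min ler01 mulr_ge0//= ge_min lexx.
have cphi n : continuous (phi n).
  move=> x; apply: (@continuous_min R T (fun=> 1) (fun x => n%:R * dist_to (~` U) x)); first exact: cvg_cst.
  by apply: cvgM; [exact: cvg_cst|exact: continuous_dist_to].
have bE n : bounded_measurable [set: borel T] (fun x => `|phi n x - \1_U x|).
  apply: bounded_measurable_norm; apply: bounded_measurableB.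
    exact: continuous_unit_bounded_measurable.
  by apply: bounded_measurable_indic; exact: borel_open.
have mE n : measurable_fun [set: borel T] (fun x => (`|phi n x - \1_U x|)%:E).
  by apply/measurable_EFinP; case: (bE n).
have H := @dominated_convergence _ (borel T) R la setT measurableT
  (fun n x => (`|phi n x - \1_U x|)%:E) (fun=> 0%E) (fun=> 1%E) mE (measurable_cst _).
rewrite integral0 in H.
have : \int[la]_x `|phi n x - \1_U x| @[n --> \oo] --> (0 : R).
  apply: fine_cvg; have [||| _ _] := H; last by [].
  - apply: aeW => x _; apply: cvg_EFin; first by near=> n.
    apply/cvgrPdist_le => r r0.
    have [Ux|Ux] := pselect (U x); last first.
      near=> n; rewrite indicE memNset//= subr0 /phi /dist_to edist_inf0//=.
      by rewrite mulr0 min_r// normr0 subr0 normr0 ltW.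
    have dx : 0 < dist_to (~` U) x.
      by apply: dist_to_gt0 => //; exact: open_closedC.
    near=> n; have phi1 : phi n x = 1.
      apply: min_l; rewrite -ler_pdivrMr// mul1r ltW//.
      near: n; exact: nbhs_infty_gtr.
    by rewrite indicE mem_set//= phi1 subrr normr0 subr0 normr0 ltW.
  - by apply: finite_measure_integrable_cst.
  - apply: aeW => x n _ /=; rewrite normr_id lee_fin indicE.
    by have := phi01 n x; rewrite ler_norml; case: (x \in U) => /=; lra.
move/cvgrPdist_le => /(_ _ e0)[n _ /(_ n (leqnn n))].
rewrite sub0r normrN => Hn; exists (phi n); split => //.
exact: le_trans (ler_norm _) Hn.
Unshelve. all: by end_near. Qed.

Lemma borel_continuous_approx (A : set T) :
  measurable (A : set (borel T)) -> continuous_approx A.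
Proof.
apply: smallest_sub; last by move=> U; exact: continuous_approx_open.
split.
- by apply: continuous_approx_open; exact: open0.
- by move=> B HB; rewrite setTD; exact: continuous_approxC.
- exact: continuous_approx_bigcup.
Qed.

End approximation.

(** * Lower semicontinuity of the action *)

Section nonmeasurable_integrand.
Local Open Scope ereal_scope.
Context d (T : measurableType d) {R : realType}.
Variables (mu : {measure set T -> \bar R}) (D : set T) (mD : measurable D).

Import HBNNSimple.

(* [f] and [g] need not be measurable: the integral is then a lower integral. *)
Lemma ge0_le_lower_integral (f g : T -> \bar R) :
  (forall x, D x -> 0 <= f x) -> (forall x, D x -> f x <= g x) ->
  \int[mu]_(x in D) f x <= \int[mu]_(x in D) g x.
Proof.
move=> f0 fg; rewrite !ge0_integralE//; last first.
  by move=> x Dx; apply: le_trans (fg x Dx); exact: f0.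
apply: ereal_sup_le => _ [h /= hf <-]; exists h => //= x; apply: le_trans (hf x) _; apply: lee_restrict => //.
Qed.

(** A simple function below [f] is measurable, so it can be compared with [g] off a null set; the
    integral of [f] is the supremum over such functions. *)
Lemma ae_ge0_le_lower_integral (f g : T -> \bar R) :
  (forall x, D x -> 0 <= f x) -> (forall x, D x -> 0 <= g x) ->
  measurable_fun D g -> {ae mu, forall x, D x -> f x <= g x} ->
  \int[mu]_(x in D) f x <= \int[mu]_(x in D) g x.
Proof.
move=> f0 g0 mg fg; rewrite ge0_integralE//.
apply: ge_ereal_sup => _ [h /= hf <-].
rewrite -integralT_nnsfun [leRHS]integral_mkcond.
apply: ae_ge0_le_integral => //.
- by move=> x _; rewrite lee_fin.
- exact/measurable_EFinP.
- by move=> x _; exact: erestrict_ge0.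
- exact/(measurable_restrictT _ _).1.
apply: filterS fg => x /= fg _; apply: le_trans (hf x) _.
by rewrite !patchE; case: ifPn => // xD; apply: fg; rewrite inE in xD.
Qed.

End nonmeasurable_integrand.

Lemma Rintegral_sum d (T : measurableType d) {R : realType}
    (m : {finite_measure set T -> \bar R}) (D : set T) (I : Type) (s : seq I)
    (F : I -> T -> R) :
  measurable D -> (forall i, bounded_measurable D (F i)) ->
  \int[m]_(x in D) (\sum_(i <- s) F i x) = \sum_(i <- s) \int[m]_(x in D) F i x.
Proof.
move=> mD bF; elim: s => [|i s IHs].
  by under eq_Rintegral do rewrite big_nil; rewrite big_nil /Rintegral integral0.
under eq_Rintegral do rewrite big_cons.
rewrite RintegralD// ?IHs ?big_cons//; try exact: bounded_measurable_integrable.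
by apply: bounded_measurable_integrable => //; exact: bounded_measurable_sum.
Qed.

Section set_approximation.
Context {R : realType} (d : nat).
Local Notation T := (R * 'rV[R]_d)%type.
Variable la : {finite_measure set (borel T) -> \bar R}.

Definition dominated_charge (nu : {charge set (borel T) -> \bar R}) : Prop :=
  forall A : set (borel T), measurable A -> (tvar nu A <= la A)%E.

Lemma ler_norm_cintegral_dominated nu (Q : set T) (f : T -> R) :
  dominated_charge nu -> measurable (Q : set (borel T)) ->
  bounded_measurable [set: borel T] f ->
  `|cintegral nu Q f| <= \int[la]_x `|f x|.
Proof.
move=> nula mQ bf; have bfQ : bounded_measurable (Q : set (borel T)) f by exact: bounded_measurableS bf.
have bn := bounded_measurable_norm bf.
apply: le_trans (ler_norm_cintegral nu mQ bfQ) _.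
rewrite /Rintegral; apply: fine_le.
- by apply: bounded_measurable_fin_num => //; exact: bounded_measurable_norm.
- exact: bounded_measurable_fin_num.
apply: (@le_trans _ _ (\int[tvar nu]_x (`|f x|)%:E)%E).
  apply: ge0_subset_integral => //; first by apply/measurable_EFinP; case: bn.
apply: ge0_le_measure_integral => //.
by apply/measurable_EFinP; case: bn.
Qed.

(** Each indicator is approximated by some [psi], and division by [Num.max 1 (S m x)] brings the sum
    back to at most 1. The division costs at most the sum of the errors [|psi_j - 1_(A j)|], because
    the indicators of disjoint sets already sum to at most 1. *)
Lemma subpartition_approx (N : nat) (A : 'I_N -> set T) :
  (forall i, measurable (A i : set (borel T))) ->
  (forall i j, i != j -> A i `&` A j = set0) ->
  exists phi : nat -> 'I_N -> T -> R,
    [/\ forall m i, continuous (phi m i), forall m i x, 0 <= phi m i x,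
        forall m x, \sum_i phi m i x <= 1 &
        forall i, \int[la]_x `|phi m i x - \1_(A i) x| @[m --> \oo] --> (0 : R)].
Proof.
move=> mA tA.
have H (m : nat) i : exists phi : T -> R,
    [/\ continuous phi, forall x, 0 <= phi x <= 1 &
        \int[la]_x `|phi x - \1_(A i) x| <= m.+1%:R^-1].
  by have [_] := borel_continuous_approx la (mA i); apply; rewrite invr_gt0.
pose psi m i := sval (cid (H m i)).
have cpsi m i : continuous (psi m i) by rewrite /psi; case: cid => ? [].
have psi01 m i x : 0 <= psi m i x <= 1 by rewrite /psi; case: cid => ? [].
have ipsi m i : \int[la]_x `|psi m i x - \1_(A i) x| <= m.+1%:R^-1.
  by rewrite /psi; case: cid => ? [].
pose S m x := \sum_i psi m i x.
pose phi m i x := psi m i x / Num.max 1 (S m x).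
have M1 m x : 1 <= Num.max 1 (S m x) by rewrite le_max lexx.
have M0 m x : 0 < Num.max 1 (S m x) by exact: lt_le_trans (M1 m x).
have cS m : continuous (S m).
  by move=> x; apply: cvg_sumR => i; exact: cpsi.
have phi0 m i x : 0 <= phi m i x.
  by apply: divr_ge0; [case/andP: (psi01 m i x)|exact: ltW].
have cphi m i : continuous (phi m i).
  move=> x; apply: cvgM; first exact: cpsi.
  apply: cvgV; first by rewrite gt_eqF.
  by apply: (@continuous_max R T (fun=> 1) (S m)); [exact: cvg_cst|exact: cS].
have sphi m x : \sum_i phi m i x <= 1.
  by rewrite -mulr_suml ler_pdivrMr// mul1r le_max lexx orbT.
have phi01 m i x : 0 <= phi m i x <= 1.
  rewrite phi0/= (le_trans _ (sphi m x))// (bigD1 i)//= lerDl.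
  by apply: sumr_ge0 => j _.
have sA x : \sum_i (\1_(A i) x : R) <= 1.
  have [[i Aix]|noA] := pselect (exists i, A i x).
    rewrite (bigD1 i)//= big1 ?addr0; last first.
      move=> j ji; rewrite indicE memNset// => Ajx.
      by have : (A j `&` A i) x by []; rewrite tA.
    by rewrite indicE; case: (_ \in _).
  rewrite big1// => i _; rewrite indicE memNset// => Aix.
  by apply: noA; exists i.
have err m i x : `|phi m i x - \1_(A i) x| <=
    `|psi m i x - \1_(A i) x| + \sum_j `|psi m j x - \1_(A j) x|.
  have -> : phi m i x - \1_(A i) x =
    (psi m i x - \1_(A i) x) - (psi m i x - phi m i x) by ring.
  rewrite (le_trans (ler_normB _ _))// lerD2l.
  have /andP[p0 p1] := psi01 m i x.
  have phile : phi m i x <= psi m i x by rewrite ler_pdivrMr// ler_peMr.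
  rewrite ger0_norm ?subr_ge0//.
  apply: (@le_trans _ _ (Num.max 1 (S m x) - 1)).
    have E : psi m i x = phi m i x * Num.max 1 (S m x) by rewrite divfK// gt_eqF.
    rewrite {1}E -[X in _ - X]mulr1 -mulrBr; apply: ler_piMl; first by rewrite subr_ge0.
    by case/andP: (phi01 m i x).
  rewrite lerBlDr ge_max; apply/andP; split.
    by rewrite lerDr sumr_ge0.
  apply: (@le_trans _ _ (\sum_j (`|psi m j x - \1_(A j) x| + \1_(A j) x))).
    by apply: ler_sum => j _; rewrite -lerBlDr ler_norm.
  by rewrite big_split/= lerD2l.
have mpsi m i : bounded_measurable [set: borel T] (fun x => `|psi m i x - \1_(A i) x|).
  apply: bounded_measurable_norm; apply: bounded_measurableB.
    exact: continuous_unit_bounded_measurable.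
  exact: bounded_measurable_indic.
exists phi; split=> // i.
apply/cvgrPdist_le => e e0.
have eN : 0 < e / N.+1%:R by rewrite divr_gt0.
near=> m.
rewrite sub0r normrN ger0_norm; last by apply: Rintegral_ge0.
(* The factor counts the [N] errors of the sum and the one of index [i] itself. *)
apply: (@le_trans _ _ (N.+1%:R * m.+1%:R^-1)).
  apply: (@le_trans _ _ (\int[la]_x (`|psi m i x - \1_(A i) x| +
      \sum_j `|psi m j x - \1_(A j) x|))).
    apply: le_Rintegral => //; first exact: approx_err_integrable.
    apply: bounded_measurable_integrable => //; apply: bounded_measurableD => //.
    exact: bounded_measurable_sum.
  have bsum : bounded_measurable [set: borel T] (fun x => \sum_j `|psi m j x - \1_(A j) x|).
    exact: bounded_measurable_sum.
  rewrite RintegralD//; try exact: bounded_measurable_integrable.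
  rewrite Rintegral_sum// -natr1 mulrDl mul1r addrC; apply: lerD => //.
  rewrite mulr_natl -[X in _ *+ X](card_ord N) -sumr_const.
  by apply: ler_sum => j _; exact: ipsi.
rewrite mulrC -ler_pdivlMr// ltW//.
near: m; exact: near_infty_natSinv_lt (PosNum eN).
Unshelve. all: by end_near. Qed.

End set_approximation.

(** * Integrals of countable suprema *)

Section max_of_countably_many.
Context d (T : measurableType d) {R : realType}.
Variables (la : {finite_measure set T -> \bar R}) (Q : set T) (mQ : measurable Q).

(** [Q] is cut into pieces on each of which one [h i] is the maximum, so the integral of the maximum
    is a sum as in the hypothesis. *)
Lemma partition_max_integral (N : nat) (h : 'I_N.+1 -> T -> R) (C : R) :
  (forall i, la.-integrable Q (EFin \o h i)) ->
  (forall x, h ord0 x = 0) ->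
  (forall A : 'I_N.+1 -> set T, (forall i, measurable (A i)) ->
     (forall i, A i `<=` Q) -> (forall i j, i != j -> A i `&` A j = set0) ->
     \sum_i \int[la]_(x in A i) h i x <= C) ->
  (\int[la]_(x in Q) (\big[Num.max/0]_i h i x)%:E <= C%:E)%E.
Proof.
move=> ih h0 HC.
have mh i : measurable_fun Q (h i).
  by apply/measurable_EFinP; exact: measurable_int (ih i).
(* Strict inequality against the smaller indices selects the least maximiser, which makes the pieces
   disjoint. *)
pose A (i : 'I_N.+1) := \bigcap_(l in [set: 'I_N.+1])
  (Q `&` [set x | if (l < i)%N then h l x < h i x else h l x <= h i x]).
have mA i : measurable (A i).
  apply: fin_bigcap_measurable => // l _.
  have mB : measurable_fun Q (fun x => h i x - h l x) by exact: measurable_funB.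
  case: (ltnP l i) => _.
    rewrite (_ : [set x | _] = (fun x => h i x - h l x) @^-1` `]0, +oo[%classic).
      by apply: mB => //; exact: measurable_itv.
    by apply/seteqP; split=> x /=; rewrite in_itv/= andbT subr_gt0.
  rewrite (_ : [set x | _] = (fun x => h i x - h l x) @^-1` `[0, +oo[%classic).
    by apply: mB => //; exact: measurable_itv.
  by apply/seteqP; split=> x /=; rewrite in_itv/= andbT subr_ge0.
have AQ i : A i `<=` Q by move=> x /(_ ord0 I) [].
have tA i j : i != j -> A i `&` A j = set0.
  move=> ij; rewrite -subset0 => x [Ai Aj].
  have [_ /=] := Ai j I; have [_ /=] := Aj i I.
  have [ltij|ltji|eij] := ltngtP i j.
  - by move=> h1 h2; have := lt_le_trans h1 h2; rewrite ltxx.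
  - by move=> h1 h2; have := lt_le_trans h2 h1; rewrite ltxx.
  - by move/negP : ij => + _ _; apply; apply/eqP/val_inj.
have QA : Q = \big[setU/set0]_(i <- index_enum 'I_N.+1) A i.
  apply/seteqP; split=> [x Qx|x]; last first.
    by rewrite -bigcup_seq => -[i _ /AQ].
  pose P m := [exists i : 'I_N.+1, (i == m :> nat) && [forall l, h l x <= h i x]].
  have exP : exists m, P m.
    have [i _ /= Hi] := @arg_maxP _ _ _ ord0 xpredT (fun i => h i x) isT.
    exists (val i); apply/existsP; exists i; rewrite eqxx/=.
    by apply/forallP => l; exact: Hi.
  have [m /existsP[i /andP[/eqP im /forallP Hi]] mmin] := ex_minnP exP.
  rewrite -bigcup_seq; exists i; first by rewrite /= mem_index_enum.
  move=> l _; split=> //=; case: ifPn => [li|_]; last exact: Hi.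
  rewrite lt_neqAle Hi andbT; apply/eqP => hli.
  suff /mmin : P l by rewrite -im leqNgt li.
  apply/existsP; exists l; rewrite eqxx/=; apply/forallP => l'.
  by rewrite hli; exact: Hi.
have mg : measurable_fun Q (fun x => \big[Num.max/0]_i h i x).
  elim: (index_enum _) => [|i s IH].
    by under eq_fun do rewrite big_nil; exact: measurable_cst.
  by under eq_fun do rewrite big_cons; exact: measurable_maxr.
have g0 x : 0 <= \big[Num.max/0]_i h i x by rewrite -{1}(h0 x) le_bigmax.
rewrite {1}QA ge0_integral_bigsetU//=; last 4 first.
- exact: index_enum_uniq.
- by apply/trivIsetP => i j _ _; exact: tA.
- by rewrite -QA; exact/measurable_EFinP.
- by move=> x _; rewrite lee_fin.
apply: le_trans (_ : (\sum_i \int[la]_(x in A i) h i x)%:E <= _)%E; last first.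
  by rewrite lee_fin HC.
rewrite -sumEFin lee_sum// => i _.
rewrite (_ : integral _ _ _ = \int[la]_(x in A i) (h i x)%:E)%E.
  rewrite /Rintegral fineK//; apply: integrable_fin_num => //.
  exact: integrableS (ih i).
apply: eq_integral => x; rewrite inE => Ax; congr EFin.
apply/eqP; rewrite eq_le le_bigmax andbT; apply/bigmax_leP; split.
  by have [_ /=] := Ax ord0 I; rewrite h0; case: ifP => // _ /ltW.
by move=> l _; have [_ /=] := Ax l I; case: ifP => // _ /ltW.
Qed.

(* Monotone convergence along the finite maxima; [J] may be non-measurable. *)
Lemma sup_integral_le (h : nat -> T -> R) (J : T -> \bar R) (C : R) :
  (forall i, la.-integrable Q (EFin \o h i)) ->
  (forall x, h 0%N x = 0) -> (forall x, Q x -> (0 <= J x)%E) ->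
  (forall N (A : 'I_N.+1 -> set T), (forall i, measurable (A i)) ->
     (forall i, A i `<=` Q) -> (forall i j, i != j -> A i `&` A j = set0) ->
     \sum_i \int[la]_(x in A i) h i x <= C) ->
  {ae la, forall x, Q x -> forall c : R, (forall i, h i x <= c) -> (J x <= c%:E)%E} ->
  (\int[la]_(x in Q) J x <= C%:E)%E.
Proof.
move=> ih h0 J0 HC HJ.
pose g N x : R := \big[Num.max/0]_(i < N.+1) h i x.
have mg N : measurable_fun Q (g N).
  rewrite /g; elim: (index_enum _) => [|i s IH].
    by under eq_fun do rewrite big_nil; exact: measurable_cst.
  under eq_fun do rewrite big_cons; apply: measurable_maxr => //.
  by apply/measurable_EFinP; exact: measurable_int (ih i).
have g0 N x : 0 <= g N x.
  by rewrite -(h0 x); exact: (@le_bigmax _ _ _ 0 (fun i : 'I_N.+1 => h i x) ord0).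
have gh N x (i : nat) : (i <= N)%N -> h i x <= g N x.
  by move=> iN; exact: (@le_bigmax _ _ _ 0 (fun i : 'I_N.+1 => h i x) (Ordinal (iN : (i < N.+1)%N))).
have ndg x : {homo (fun N => (g N x)%:E) : m n / (m <= n)%N >-> (m <= n)%E}.
  move=> m n mn; rewrite lee_fin; apply/bigmax_leP; split=> // i _.
  by apply: gh; rewrite (leq_trans _ mn)// -ltnS.
have mge N : measurable_fun Q (fun x => (g N x)%:E) by exact/measurable_EFinP.
have ge0e N x : Q x -> (0 <= (g N x)%:E)%E by rewrite lee_fin.
have cg x : cvgn (fun N => (g N x)%:E) by apply: ereal_nondecreasing_is_cvgn; exact: ndg.
apply: (@le_trans _ _ (\int[la]_(x in Q) limn (fun N => (g N x)%:E))%E).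
  apply: ae_ge0_le_lower_integral => //.
  - by move=> x Qx; apply: lime_ge => //; apply: nearW => N; exact: ge0e.
  - apply: (@emeasurable_fun_cvg _ _ _ _ (fun N x => (g N x)%:E)) => //.
  apply: filterS HJ => x HJ Qx.
  have le N : ((g N x)%:E <= limn (fun N => (g N x)%:E))%E.
    rewrite (cvg_lim _ (ereal_nondecreasing_cvgn (@ndg x)))//.
    by apply: ereal_sup_ubound; exists N.
  case: (limn _) le => [c| |] le; last 2 first.
  - by rewrite leey.
  - by have := le 0%N; rewrite leeNy_eq.
  apply: HJ => // i; have := le i; rewrite lee_fin; apply: le_trans; exact: gh.
rewrite monotone_convergence//.
apply: lime_le.
  apply: ereal_nondecreasing_is_cvgn => m n mn; apply: ge0_le_integral => //.
  - by move=> x; exact: ge0e.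
  - by move=> x _; exact: ndg.
apply: nearW => N; apply: (@partition_max_integral N (fun i => h i)) => //.
by move=> A; exact: HC.
Qed.

End max_of_countably_many.

Section matrix_limits.
Context {R : realType}.

Lemma cvg_mxdot m n (C : 'M[R]_(m, n)) (X_ : nat -> 'M[R]_(m, n)) (X : 'M[R]_(m, n)) :
  (forall i j, X_ t i j @[t --> \oo] --> X i j) ->
  mxdot C (X_ t) @[t --> \oo] --> mxdot C X.
Proof.
move=> XX; rewrite mxdotE; under eq_cvg do rewrite mxdotE.
by do 2!(apply: cvg_sumR => ?); apply: cvgM; [exact: cvg_cst|exact: XX].
Qed.

Lemma cvg_Jdual n (M B : 'M[R]_n) (X_ Z_ : nat -> 'M[R]_n) (X Z : 'M[R]_n) :
  (forall i j, X_ t i j @[t --> \oo] --> X i j) ->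
  (forall i j, Z_ t i j @[t --> \oo] --> Z i j) ->
  Jdual M B (X_ t) (Z_ t) @[t --> \oo] --> Jdual M B X Z.
Proof.
move=> XX ZZ; apply: cvgB; first exact: cvg_mxdot.
by apply: cvgM; [exact: cvg_cst|exact: cvg_mxdot].
Qed.

Lemma quad_mxdot_outer n (X : 'M[R]_n) (u : 'cV[R]_n) :
  (u^T *m X *m u) 0 0 = mxdot (u *m u^T) X.
Proof. by rewrite quad_mxdot mxdot_mulmxr. Qed.

Lemma psd_cvg n (X_ : nat -> 'M[R]_n) (X : 'M[R]_n) : (forall t, psd_mx (X_ t)) ->
  (forall i j, X_ t i j @[t --> \oo] --> X i j) -> psd_mx X.
Proof.
move=> psdX XX; split.
  apply/matrixP => i j; rewrite mxE.
  suff : X_ t i j @[t --> \oo] --> X j i by move=> h; exact: cvg_unique h (XX i j).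
  under eq_cvg => t do rewrite -(proj1 (psdX t)) mxE.
  exact: XX.
move=> u; rewrite quad_mxdot_outer.
have cv := cvg_mxdot (C := u *m u^T) XX.
rewrite -(cvg_lim _ cv)//; apply: limr_ge; first exact: cvgP cv.
by apply: nearW => t; rewrite -quad_mxdot_outer; case: (psdX t).
Qed.

(** Countably many vectors suffice, so positivity can be tested off a single null set. *)
Lemma psd_of_rat n (X : 'M[R]_n) : X^T = X ->
  (forall v : 'cV[rat]_n, 0 <= mxdot (map_mx ratr v *m (map_mx ratr v)^T) X) ->
  psd_mx X.
Proof.
move=> sX HX; split => // u.
have [u_ uu] := rat_mx_approx u.
rewrite quad_mxdot_outer.
have cv : mxdot (map_mx ratr (u_ t) *m (map_mx ratr (u_ t))^T) X @[t --> \oo] -->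
    mxdot (u *m u^T) X.
  rewrite mxdotC; under eq_cvg do rewrite mxdotC.
  apply: cvg_mxdot => i j; rewrite mxE; under eq_cvg do rewrite mxE.
  apply: cvg_sumR => l; rewrite !mxE; under eq_cvg do rewrite !mxE.
  by apply: cvgM; exact: uu.
rewrite -(cvg_lim _ cv)//; apply: limr_ge; first exact: cvgP cv.
exact: nearW.
Qed.

End matrix_limits.

Section density_integrals.
Local Open Scope charge_scope.
Context d (T : measurableType d) {R : realType}.
Variable la : {finite_measure set T -> \bar R}.

Lemma integrable_sumR (I : Type) (s : seq I) (F : I -> T -> R) D : measurable D ->
  (forall i, la.-integrable D (EFin \o F i)) ->
  la.-integrable D (EFin \o (fun x => \sum_(i <- s) F i x)) /\
  \int[la]_(x in D) (\sum_(i <- s) F i x) = \sum_(i <- s) \int[la]_(x in D) F i x.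
Proof.
move=> mD iF; elim: s => [|i s [IHi IHs]].
  split; last by under eq_Rintegral do rewrite big_nil; rewrite big_nil /Rintegral integral0.
  rewrite (_ : _ \o _ = cst 0%E); first exact: integrable0.
  by apply/funext => x /=; rewrite big_nil.
have E : (fun x => \sum_(j <- i :: s) F j x) = (fun x => F i x + \sum_(j <- s) F j x).
  by apply/funext => x; rewrite big_cons.
rewrite E big_cons -IHs; split; last exact: RintegralD.
have := integrableD mD (iF i) IHi.
by apply: eq_integrable.
Qed.

Lemma integrable_mxdot_RN m n (C : 'M[R]_(m, n)) (nu : mxcharge T m n) A :
  measurable A -> (forall i j, nu i j `<< la) ->
  la.-integrable A (EFin \o (fun x => mxdot C (mxRN nu la x))) /\
  \int[la]_(x in A) mxdot C (mxRN nu la x) = mxdot C (mxvalue nu A).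
Proof.
move=> mA nula.
have E : (fun x => mxdot C (mxRN nu la x)) =
    (fun x => \sum_i \sum_j C i j * fine (('d (nu i j) '/d la) x)).
  by apply/funext => x; rewrite mxdotE; do 2!apply: eq_bigr => ? _; rewrite mxE.
have I i j : la.-integrable A (EFin \o (fun x => C i j * fine (('d (nu i j) '/d la) x))).
  have := @integrableZl _ _ _ la _ mA (C i j) _ (RN_integrable mA (nula i j)).
  by apply: eq_integrable.
have I2 i := @integrable_sumR _ (index_enum 'I_n) _ _ mA (I i).
have [I31 I32] := integrable_sumR (index_enum 'I_m) mA (fun i => proj1 (I2 i)).
rewrite E; split => //; rewrite I32 mxdotE; apply: eq_bigr => i _.
rewrite (I2 i).2; apply: eq_bigr => j _.
by rewrite mxE (charge_RN mA (nula i j)) RintegralZl//; exact: RN_integrable.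
Qed.

(** The set where [f] is negative has a nonnegative integral, so it is null. *)
Lemma ae_ge0_of_integral (f : T -> R) Q : measurable Q ->
  la.-integrable Q (EFin \o f) ->
  (forall A, measurable A -> A `<=` Q -> 0 <= \int[la]_(x in A) f x) ->
  {ae la, forall x, Q x -> 0 <= f x}.
Proof.
move=> mQ jf f0; have mf : measurable_fun Q f.
  by apply/measurable_EFinP; exact: measurable_int jf.
pose E := Q `&` f @^-1` `]-oo, 0[%classic.
have mE : measurable E by apply: mf => //; exact: measurable_itv.
have EQ : E `<=` Q by move=> x [].
have jE : la.-integrable E (EFin \o f) by exact: integrableS jf.
have fE x : E x -> f x < 0 by move=> [_]; rewrite /= in_itv.
have : ae_eq la E (EFin \o f) (cst 0%E).
  apply/ae_eq_integral_abs => //; first exact: measurable_int jE.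
  apply/eqP; rewrite eq_le integral_ge0// andbT.
  rewrite (_ : integral _ _ _ = (- \int[la]_(x in E) f x)%:E)%E; last first.
    rewrite -mulN1r -RintegralZl// /Rintegral fineK; last first.
      by apply: integrable_fin_num => //; have := integrableZl mE (-1) jE.
    apply: eq_integral => x; rewrite inE => /fE fx /=.
    by rewrite mulN1r ltr0_norm.
  by rewrite lee_fin oppr_le0 f0.
apply: filterS => x /= H Qx; rewrite leNgt; apply/negP => fx.
have /H[fx0] : E x by split => //=; rewrite in_itv.
by rewrite fx0 ltxx in fx.
Qed.

Lemma ae_eq0_of_integral (nu : {charge set T -> \bar R}) Q : measurable Q ->
  nu `<< la -> (forall A, measurable A -> A `<=` Q -> nu A = 0%E) ->
  {ae la, forall x, Q x -> fine (('d nu '/d la) x) = 0}.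
Proof.
move=> mQ nula nu0.
have : ae_eq la Q ('d nu '/d la) (cst 0%E).
  apply: integral_ae_eq => //.
    by apply: (integrableS measurableT) => //; exact: Radon_Nikodym_integrable.
  by move=> E EQ mE; rewrite -Radon_Nikodym_integral// nu0// integral0.
by apply: filterS => x /= H Qx; rewrite H.
Qed.

Lemma ae_eq_RN (nu nu' : {charge set T -> \bar R}) Q : measurable Q ->
  nu `<< la -> nu' `<< la -> (forall A, measurable A -> A `<=` Q -> nu A = nu' A) ->
  {ae la, forall x, Q x -> fine (('d nu '/d la) x) = fine (('d nu' '/d la) x)}.
Proof.
move=> mQ nula nu'la nuE.
have I (nu0 : {charge set T -> \bar R}) : nu0 `<< la -> la.-integrable Q ('d nu0 '/d la).
  by move=> h; apply: (integrableS measurableT) => //; exact: Radon_Nikodym_integrable.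
have : ae_eq la Q ('d nu '/d la) ('d nu' '/d la).
  apply: integral_ae_eq => //; [exact: I|exact: measurable_int (I _ nu'la)|].
  by move=> E EQ mE; rewrite -!Radon_Nikodym_integral// nuE.
by apply: filterS => x /= H Qx; rewrite H.
Qed.

End density_integrals.

(** * From continuous tests to a bound on the action *)

Section dual_tests.
Context {R : realType} (d n k : nat).
Local Notation T := (R * 'rV[R]_d)%type.
Local Notation Xch := (Xcharge (borel T) (R := R) n k).

Definition mxint m p (nu : mxcharge (borel T) (R := R) m p) (Q : set T)
    (f : T -> R) : 'M[R]_(m, p) :=
  \matrix_(i, j) cintegral (nu i j) Q f.

(* The form of [action 0 L2 mu Q <= C] that is stable under weak* limits. *)
Definition dual_bounded (mu : Xch) (Q : set T) (M : 'M[R]_n) (C : R) : Prop :=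
  forall N (B : 'I_N -> 'M[R]_n) (phi : 'I_N -> T -> R),
    (forall i, continuous (phi i)) -> (forall i x, 0 <= phi i x) ->
    (forall x, \sum_i phi i x <= 1) ->
    \sum_i Jdual M (B i) (mxint (XG mu) Q (phi i)) (mxint (XR mu) Q (phi i)) <= C.

(** The companion of [dual_bounded] for the constraint on the first component; it passes to weak*
    limits as well. *)
Definition psd_tested (mu : Xch) (Q : set T) : Prop :=
  forall phi : T -> R, continuous phi -> (forall x, 0 <= phi x <= 1) ->
    psd_mx (mxint (XG mu) Q phi).

(** A quantitative form of [variation_dominates]: the constant is 1, so L1 closeness for the
    variation controls the integrals against every coordinate. *)
Lemma variation_ge (mu : Xch) :
  [/\ forall i j, dominated_charge (Defs.variation mu) (XG mu i j),
      forall i j, dominated_charge (Defs.variation mu) (Xq mu i j) &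
      forall i j, dominated_charge (Defs.variation mu) (XR mu i j)].
Proof.
have ge0 (I : finType) (f : I -> {charge set (borel T) -> \bar R}) A :
    (0 <= \sum_(i : I) charge_variation (hahn (f i)) A)%E by exact: sume_ge0.
have H (I : finType) (f : I -> {charge set (borel T) -> \bar R}) i :
    (forall A, (\sum_(i : I) charge_variation (hahn (f i)) A <= Defs.variation mu A)%E) ->
    dominated_charge (Defs.variation mu) (f i).
  move=> fle A mA; rewrite tvarE; apply: le_trans (fle A).
  by rewrite (bigD1 i)//= leeDl//; exact: sume_ge0.
split=> i j; [pose f (p : 'I_n * 'I_n) := XG mu p.1 p.2|
  pose f (p : 'I_n * 'I_k) := Xq mu p.1 p.2|
  pose f (p : 'I_n * 'I_n) := XR mu p.1 p.2]; apply: (H _ f (i, j)) => A;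
  rewrite /Defs.variation !big_cat !big_map /=.
- by rewrite leeDl// adde_ge0//; exact: ge0.
- rewrite addeCA leeDl// adde_ge0//.
    exact: (ge0 _ (fun p => XG mu p.1 p.2)).
  exact: (ge0 _ (fun p => XR mu p.1 p.2)).
- rewrite addeA leeDr// adde_ge0//.
    exact: (ge0 _ (fun p => XG mu p.1 p.2)).
  exact: (ge0 _ (fun p => Xq mu p.1 p.2)).
Qed.

Section set_tests.
Variables (mu : Xch) (Q : set T).
Hypothesis mQ : measurable (Q : set (borel T)).

Lemma cvg_cintegral_indic (nu : {charge set (borel T) -> \bar R})
    (phi : nat -> T -> R) (A : set T) :
  dominated_charge (Defs.variation mu) nu -> measurable (A : set (borel T)) ->
  (forall m, bounded_measurable [set: borel T] (phi m)) ->
  \int[Defs.variation mu]_x `|phi m x - \1_A x| @[m --> \oo] --> (0 : R) ->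
  cintegral nu Q (phi m) @[m --> \oo] --> fine (nu (A `&` Q)).
Proof.
move=> nud mA bphi /cvgrPdist_le cphi; apply/cvgrPdist_le => e /cphi.
apply: filterS => m; rewrite sub0r normrN => le.
have bA : bounded_measurable [set: borel T] (\1_A : _ -> R).
  exact: bounded_measurable_indic.
rewrite -cintegral_indic// -cintegralB//; try exact: bounded_measurableS bA;
  try exact: bounded_measurableS (bphi m).
apply: le_trans (ler_norm_cintegral_dominated nud mQ _) _.
  exact: bounded_measurableB.
apply: le_trans le; apply: le_trans (ler_norm _).
by under eq_Rintegral do rewrite distrC.
Qed.

(** Disjoint sets are replaced by the functions of [subpartition_approx], which are admissible tests
    and converge in L1 of the variation. *)
Lemma dual_bounded_sets M C : dual_bounded mu Q M C ->
  forall N (B : 'I_N -> 'M[R]_n) (A : 'I_N -> set T),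
  (forall i, measurable (A i : set (borel T))) ->
  (forall i j, i != j -> A i `&` A j = set0) ->
  \sum_i Jdual M (B i) (mxvalue (XG mu) (A i `&` Q)) (mxvalue (XR mu) (A i `&` Q)) <= C.
Proof.
move=> HC N B A mA tA.
have [phi [cphi phi0 phi1 cv]] := subpartition_approx (Defs.variation mu) mA tA.
have [dG _ dR] := variation_ge mu.
have phi01 m i x : 0 <= phi m i x <= 1.
  rewrite phi0/= (le_trans _ (phi1 m x))// (bigD1 i)//= lerDl.
  by apply: sumr_ge0 => j _.
have bphi i m : bounded_measurable [set: borel T] (phi m i).
  exact: continuous_unit_bounded_measurable.
have cS : \sum_i Jdual M (B i) (mxint (XG mu) Q (phi m i)) (mxint (XR mu) Q (phi m i))
   @[m --> \oo] --> \sum_i Jdual M (B i) (mxvalue (XG mu) (A i `&` Q))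
     (mxvalue (XR mu) (A i `&` Q)).
  apply: cvg_sumR => i; apply: cvg_Jdual => a b; rewrite mxE;
    under eq_cvg do rewrite mxE; apply: cvg_cintegral_indic => //; exact: cv.
rewrite -(cvg_lim _ cS)//; apply: limr_le; first exact: cvgP cS.
by apply: nearW => m; exact: HC.
Qed.

Lemma psd_tested_sets (A : set T) : psd_tested mu Q ->
  measurable (A : set (borel T)) -> psd_mx (mxvalue (XG mu) (A `&` Q)).
Proof.
move=> HP mA.
have [phi [cphi phi0 phi1 cv]] := @subpartition_approx R d (Defs.variation mu) 1 (fun=> A)
  (fun=> mA) (fun i j => ltac:(by rewrite !ord1)).
have [dG _ _] := variation_ge mu.
have phi01 m x : 0 <= phi m ord0 x <= 1.
  by rewrite phi0/= (le_trans _ (phi1 m x))// big_ord1.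
apply: (@psd_cvg _ _ (fun m => mxint (XG mu) Q (phi m ord0))).
  by move=> m; exact: HP.
move=> a b; rewrite mxE; under eq_cvg do rewrite mxE.
apply: (@cvg_cintegral_indic _ (fun m => phi m ord0) A) => //.
by move=> m; exact: continuous_unit_bounded_measurable.
Qed.

(** Over a set, [Jdual] of the densities integrates to [Jdual] of the masses, so the tests on
    disjoint sets bound the integral of the supremum over rational [B]. By [J0_le_of_dual] this
    supremum dominates the density at almost every point, where [X] is positive semidefinite and [Y]
    is 0. *)
Lemma action_le_of_dual (L2 : 'M[R]_n) C : pd_mx L2 ->
  dual_bounded mu Q (invmx L2) C -> psd_tested mu Q ->
  (forall i j A, measurable A -> Xq mu i j A = 0%E) ->
  (action 0 L2 mu Q <= C%:E)%E.
Proof.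
move=> pdL2 HC HP q0; set M := invmx L2; pose la : {finite_measure set (borel T) -> \bar R} := Defs.variation mu.
have [dG dq dR] := variation_dominates mu.
pose X x := mxRN (XG mu) la x; pose Z x := mxRN (XR mu) la x.
(* Index 0 is reserved for [B = 0], whose test vanishes, so that the finite maxima start from 0. *)
pose b m : 'M[R]_n := if m is m'.+1 then
   (if unpickle m' is Some B then map_mx ratr (B : 'M[rat]_n) else 0) else 0.
have setI_sub (A : set T) : A `<=` Q -> A `&` Q = A by move=> AQ; apply/setIidPl.
have valsym (A : set T) : measurable (A : set (borel T)) -> A `<=` Q ->
    psd_mx (mxvalue (XG mu) A).
  by move=> mA AQ; rewrite -(setI_sub A AQ); exact: psd_tested_sets.
have JI B (A : set T) : measurable (A : set (borel T)) ->
    la.-integrable A (EFin \o (fun x => Jdual M B (X x) (Z x))) /\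
    \int[la]_(x in A) Jdual M B (X x) (Z x) = Jdual M B (mxvalue (XG mu) A) (mxvalue (XR mu) A).
  move=> mA; have [i1 e1] := integrable_mxdot_RN (B *m M^T) mA dR.
  have [i2 e2] := integrable_mxdot_RN (B *m B^T) mA dG.
  have i2' := @integrableZl _ _ _ la _ mA (2^-1) _ i2.
  have i2'' : la.-integrable A (EFin \o (fun x => 2^-1 * mxdot (B *m B^T) (X x))).
    by apply: eq_integrable i2'.
  split; last by rewrite /Jdual RintegralB// RintegralZl// e1 e2.
  by have := integrableB mA i1 i2''; apply: eq_integrable.
rewrite /action /action_wrt.
apply: (@sup_integral_le _ (borel T) R la Q mQ (fun m x => Jdual M (b m) (X x) (Z x))).
- by move=> i; exact: (JI (b i) Q mQ).1.
- by move=> x; rewrite /Jdual /= !mul0mx !mxdot0l mulr0 subr0.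
- by move=> x _; exact: J_density_ge0.
- move=> N A mA AQ tA.
  have := dual_bounded_sets HC (fun i : 'I_N.+1 => b i) mA tA.
  apply: le_trans; apply: ler_sum => i _.
  by rewrite (JI _ _ (mA i)).2 setI_sub.
have aeF : Filter (nbhs (almost_everywhere la)) by exact: ae_filter_ringOfSetsType.
have aesym : {ae la, forall x, Q x -> (X x)^T = X x}.
  have : {ae la, forall x, forall i j, Q x -> X x i j = X x j i}.
    apply: filter_forall => i; apply: filter_forall => j.
    have GE (A : set T) : measurable (A : set (borel T)) -> A `<=` Q ->
        XG mu i j A = XG mu j i A.
      move=> mA AQ; have [sG _] := valsym A mA AQ.
      have := congr1 (fun N : 'M[R]_n => N j i) sG; rewrite !mxE.
      by move=> h; rewrite -[LHS]fineK ?fin_num_measure// -[RHS]fineK ?fin_num_measure// h.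
    have := ae_eq_RN mQ (dG i j) (dG j i) GE.
    by apply: filterS => x H Qx; rewrite !mxE; exact: H.
  move=> Hsym; apply: filterS Hsym => x H Qx; apply/matrixP => i j.
  by rewrite mxE H.
(* Vectors are enumerated by their codes, so countably many null sets merge into one. *)
have aequad : {ae la, forall x, forall m, Q x ->
    forall v : 'cV[rat]_n, unpickle m = Some v ->
    0 <= mxdot (map_mx ratr v *m (map_mx ratr v)^T) (X x)}.
  apply: ae_foralln => m; case: (unpickle m) => [v|]; last first.
    by apply: aeW.
  have I (A : set T) (mA : measurable (A : set (borel T))) :=
    integrable_mxdot_RN (map_mx ratr v *m (map_mx ratr v)^T) mA dG.
  have := ae_ge0_of_integral mQ (I Q mQ).1.
  move=> H; have {}H : {ae la, forall x, Q x ->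
      0 <= mxdot (map_mx ratr v *m (map_mx ratr v)^T) (X x)}.
    apply: H => A mA AQ; rewrite (I A mA).2 -quad_mxdot_outer.
    by case: (valsym A mA AQ).
  by apply: filterS H => x H Qx w [<-]; exact: H.
have aeY : {ae la, forall x, forall i j, Q x -> mxRN (Xq mu) la x i j = 0}.
  apply: filter_forall => i; apply: filter_forall => j.
  have := ae_eq0_of_integral mQ (dq i j) (fun A mA _ => q0 i j A mA).
  by apply: filterS => x H Qx; rewrite mxE; exact: H.
apply: filterS (filterI aesym (filterI aequad aeY)) => x [Hs [Hq HY]] Qx c Hc.
rewrite (_ : mxRN (Xq mu) la x = 0); last first.
  by apply/matrixP => i j; rewrite HY// mxE.
apply: J0_le_of_dual => //.
  apply: psd_of_rat; first exact: Hs.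
  by move=> v; apply: (Hq (pickle v)) => //; exact: pickleK.
by move=> B; have := Hc (pickle B).+1; rewrite /b pickleK.
Qed.

End set_tests.

End dual_tests.

(** * Compactness for bounded action *)

Section lower_bounds.
Local Open Scope charge_scope.
Context d (T : measurableType d) {R : realType}.
Variable la : {finite_measure set T -> \bar R}.

(** [g] may be negative, so it is replaced by its positive part, which is still below [J] and can be
    compared with it through lower integrals. *)
Lemma Rintegral_le_lower_integral (Q : set T) (g : T -> R) (J : T -> \bar R) (C : R) :
  measurable Q -> la.-integrable Q (EFin \o g) ->
  (forall x, Q x -> (0 <= J x)%E) -> (forall x, Q x -> ((g x)%:E <= J x)%E) ->
  (\int[la]_(x in Q) J x <= C%:E)%E -> \int[la]_(x in Q) g x <= C.
Proof.
move=> mQ ig J0 gJ JC.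
have mg := measurable_int _ ig.
have ig' : la.-integrable Q (EFin \o (fun x => Num.max (g x) 0)).
  apply: (le_integrable mQ _ _ ig) => //.
    apply/measurable_EFinP; apply: measurable_maxr; last exact: measurable_cst.
    exact/measurable_EFinP.
  move=> x _ /=; rewrite lee_fin.
  by case: (leP (g x) 0) => // gx; rewrite normr0.
have H1 : \int[la]_(x in Q) g x <= \int[la]_(x in Q) Num.max (g x) 0.
  by apply: le_Rintegral => // x _; rewrite le_max lexx.
apply: le_trans H1 _; rewrite -lee_fin /Rintegral fineK; last exact: integrable_fin_num ig'.
apply: le_trans JC; apply: ge0_le_lower_integral => // x Qx.
  by rewrite lee_fin le_max lexx orbT.
by rewrite EFin_max ge_max gJ// J0.
Qed.

(** The variation of [Q] is the difference of the values of [nu] on the two Hahn pieces of [Q]; each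
    is at most the integral, hence the factor 2. *)
Lemma tvar_le_RN (nu : {charge set T -> \bar R}) (Q : set T) : measurable Q ->
  nu `<< la -> fine (tvar nu Q) <= 2 * \int[la]_(x in Q) `|fine (('d nu '/d la) x)|.
Proof.
move=> mQ nula; have [[mP _] [mN _] _ _] := hahn nu.
have iQ := RN_integrable mQ nula.
have iQn := integrable_norm iQ.
have le (A : set T) : measurable A ->
    `|fine (nu (Q `&` A))| <= \int[la]_(x in Q) `|fine (('d nu '/d la) x)|.
  move=> mA; have mQA : measurable (Q `&` A) by exact: measurableI.
  rewrite (charge_RN mQA nula).
  apply: le_trans (le_normr_Rintegral mQA _) _; first exact: RN_integrable.
  have iA : la.-integrable (Q `&` A) (EFin \o (fun x => `|fine (('d nu '/d la) x)|)).
    exact: integrableS iQn.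
  rewrite /Rintegral; apply: fine_le; [exact: integrable_fin_num iA|exact: integrable_fin_num iQn|].
  apply: ge0_subset_integral => //; exact: measurable_int iQn.
have E : tvar nu Q = (nu (Q `&` (sval (cid (hahn_ex nu))).1) - nu (Q `&` (sval (cid (hahn_ex nu))).2))%E.
  rewrite tvarE /charge_variation jordan_posE cjordan_posE jordan_negE cjordan_negE.
  by rewrite /crestr0 mem_set.
rewrite E fineB ?fin_num_measure//; try exact: measurableI.
rewrite mulr_natl mulr2n (le_trans _ (lerD (le _ mP) (le _ mN)))//.
by rewrite (le_trans (ler_norm _))// ler_normB.
Qed.

Lemma mxdot_mxint_RN m n (C : 'M[R]_(m, n)) (nu : mxcharge T m n) (Q : set T) (phi : T -> R) :
  measurable Q -> bounded_measurable Q phi -> (forall i j, nu i j `<< la) ->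
  la.-integrable Q (EFin \o (fun x => phi x * mxdot C (mxRN nu la x))) /\
  \int[la]_(x in Q) (phi x * mxdot C (mxRN nu la x)) =
    mxdot C (\matrix_(i, j) cintegral (nu i j) Q phi).
Proof.
move=> mQ bphi nula.
have [IC _] := integrable_mxdot_RN C mQ nula.
split; first exact: integrable_bounded_measurableM.
have E : (fun x => phi x * mxdot C (mxRN nu la x)) =
    (fun x => \sum_i \sum_j C i j * (phi x * fine (('d (nu i j) '/d la) x))).
  apply/funext => x; rewrite mxdotE mulr_sumr; apply: eq_bigr => i _.
  by rewrite mulr_sumr; apply: eq_bigr => j _; rewrite mxE mulrCA.
have I0 i j : la.-integrable Q (EFin \o (fun x => phi x * fine (('d (nu i j) '/d la) x))).
  by apply: integrable_bounded_measurableM => //; exact: RN_integrable.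
have I i j : la.-integrable Q
    (EFin \o (fun x => C i j * (phi x * fine (('d (nu i j) '/d la) x)))).
  have := @integrableZl _ _ _ la _ mQ (C i j) _ (I0 i j).
  by apply: eq_integrable.
have I2 i := @integrable_sumR _ T R la _ (index_enum 'I_n) _ _ mQ (I i).
have [_ I32] := integrable_sumR (index_enum 'I_m) mQ (fun i => proj1 (I2 i)).
rewrite E I32 mxdotE; apply: eq_bigr => i _; rewrite (I2 i).2; apply: eq_bigr => j _.
by rewrite mxE (cintegral_RN mQ bphi (nula i j)) RintegralZl.
Qed.

End lower_bounds.

(** * Bounds on a measure of finite action *)

Section finite_action.
Context {R : realType} (d n k : nat).
Local Notation T := (R * 'rV[R]_d)%type.
Local Notation Xch := (Xcharge (borel T) (R := R) n k).
Variables (mu : Xch) (Q : set T) (L1 : 'M[R]_k) (L2 : 'M[R]_n) (C : R).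
Hypothesis mQ : measurable (Q : set (borel T)).
Hypothesis muQ : in_MX mu Q.
Hypothesis actC : (action L1 L2 mu Q <= C%:E)%E.

Let la : {finite_measure set (borel T) -> \bar R} := Defs.variation mu.
Let X := mxRN (XG mu) la.
Let Y := mxRN (Xq mu) la.
Let Z := mxRN (XR mu) la.
Let J x := J_density L1 L2 (X x) (Y x) (Z x).

Let mass : R := \sum_i fine (XG mu i i Q).

Let dG i j : XG mu i j `<< la. Proof. by have [] := variation_dominates mu. Qed.
Let dq i j : Xq mu i j `<< la. Proof. by have [] := variation_dominates mu. Qed.
Let dR i j : XR mu i j `<< la. Proof. by have [] := variation_dominates mu. Qed.

(** Every bound of the section amounts to choosing an integrable minorant of the density. *)
Let test (g : T -> R) : la.-integrable Q (EFin \o g) ->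
  (forall x, ((g x)%:E <= J x)%E) -> \int[la]_(x in Q) g x <= C.
Proof.
move=> ig gJ; apply: (@Rintegral_le_lower_integral _ _ _ la Q g J C mQ ig) => //.
by move=> x _; exact: J_density_ge0.
Qed.

Let Qcont (phi : T -> R) : continuous phi -> (forall x, 0 <= phi x <= 1) ->
  bounded_measurable (Q : set (borel T)) phi.
Proof.
move=> cphi phi01; apply: (@bounded_measurableS _ _ _ setT) => //.
exact: continuous_unit_bounded_measurable.
Qed.

(** The combination of the [Jdual] with weights [phi i] is at most the density times the sum of the
    weights; the density is nonnegative and the sum at most 1. *)
Lemma finite_action_dual_bounded : dual_bounded mu Q (invmx L2) C.
Proof.
move=> N B phi cphi phi0 phi1; set M := invmx L2.
have phi01 i x : 0 <= phi i x <= 1.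
  rewrite phi0/= (le_trans _ (phi1 x))// (bigD1 i)//= lerDl.
  by apply: sumr_ge0 => j _.
have JI i : la.-integrable Q (EFin \o (fun x => phi i x * Jdual M (B i) (X x) (Z x))) /\
   \int[la]_(x in Q) (phi i x * Jdual M (B i) (X x) (Z x)) =
   Jdual M (B i) (mxint (XG mu) Q (phi i)) (mxint (XR mu) Q (phi i)).
  have [i1 e1] := mxdot_mxint_RN (B i *m M^T) mQ (Qcont (cphi i) (phi01 i)) dR.
  have [i2 e2] := mxdot_mxint_RN (B i *m (B i)^T) mQ (Qcont (cphi i) (phi01 i)) dG.
  have i2' := @integrableZl _ _ _ la _ mQ (2^-1) _ i2.
  have i2'' : la.-integrable Q
     (EFin \o (fun x => 2^-1 * (phi i x * mxdot (B i *m (B i)^T) (X x)))).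
    by apply: eq_integrable i2'.
  have E : (fun x => phi i x * Jdual M (B i) (X x) (Z x)) =
    (fun x => phi i x * mxdot (B i *m M^T) (Z x) -
              2^-1 * (phi i x * mxdot (B i *m (B i)^T) (X x))).
    by apply/funext => x; rewrite /Jdual mulrBr mulrCA.
  rewrite E; split; last by rewrite RintegralB// RintegralZl// e1 e2.
  by have := integrableB mQ i1 i2''; apply: eq_integrable.
have [I1 I2] := integrable_sumR (index_enum 'I_N) mQ (fun i => (JI i).1).
under eq_bigr do rewrite -(JI _).2.
rewrite -I2; apply: test => // x.
have := J_density_ge0 L1 L2 (X x) (Y x) (Z x).
have := fun i => J_density_ge_dual L1 L2 (B i) (X x) (Y x) (Z x).
rewrite -/(J x); case: (J x) => [c| |] H c0 //; last by rewrite leey.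
rewrite lee_fin in c0; rewrite lee_fin.
apply: (@le_trans _ _ (\sum_i phi i x * c)).
  by apply: ler_sum => i _; rewrite ler_wpM2l//; have := H i; rewrite lee_fin.
by rewrite -mulr_suml ler_piMl.
Qed.

Lemma scaled_bound_ge0 (a : R) : (forall s, 0 < s -> - (s * a) <= C) -> 0 <= a.
Proof.
move=> H; rewrite leNgt; apply/negP => a0.
have := H ((`|C| + 1) / - a).
rewrite divr_gt0 ?oppr_gt0 ?ltr_wpDl// => /(_ isT).
rewrite -mulrN divfK ?oppr_eq0 ?lt_eqF//.
by have := ler_norm C; lra.
Qed.

(** For every [s > 0], [- s phi (u u^T . X)] is a minorant of the density: it is nonpositive where
    [X] is positive semidefinite, and elsewhere the density is infinite. Letting [s] grow gives the
    sign. *)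
Lemma finite_action_psd_tested : psd_tested mu Q.
Proof.
move=> phi cphi phi01; have bphi := Qcont cphi phi01; split.
  apply/matrixP => i j; rewrite !mxE; apply: eq_cintegral_charge => // A mA _.
  have [_ _ _ /(_ A mA) sG] := muQ.
  have := congr1 (fun N : 'M[R]_n => N i j) sG; rewrite !mxE => h.
  by rewrite -[LHS]fineK ?fin_num_measure// -[RHS]fineK ?fin_num_measure// h.
move=> u; rewrite quad_mxdot_outer.
have [i1 e1] := mxdot_mxint_RN (u *m u^T) mQ bphi dG.
rewrite -e1; apply: scaled_bound_ge0 => s s0.
have i2 : la.-integrable Q
    (EFin \o (fun x => - s * (phi x * mxdot (u *m u^T) (X x)))).
  by have := @integrableZl _ _ _ la _ mQ (- s) _ i1; apply: eq_integrable.
rewrite -mulNr -RintegralZl//; apply: test => // x.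
have := J_density_ge0 L1 L2 (X x) (Y x) (Z x).
have := @J_density_lty_psd _ _ _ L1 L2 (X x) (Y x) (Z x).
rewrite -/(J x); case: (J x) => [c| |] H c0 //; last by rewrite leey.
have [_ /(_ u)] := H (ltry _); rewrite quad_mxdot_outer => Xu.
apply: le_trans c0; rewrite lee_fin mulNr oppr_le0 mulr_ge0 ?(ltW s0)//.
by rewrite mulr_ge0//; case/andP: (phi01 x).
Qed.

Let itrX : la.-integrable Q (EFin \o (fun x => \tr (X x))) /\
  \int[la]_(x in Q) \tr (X x) = mass.
Proof.
have [i1 e1] := integrable_mxdot_RN 1%:M mQ dG.
have E A : mxdot 1%:M A = \tr A by rewrite /mxdot trmx1 mul1mx.
have F : (fun x => \tr (X x)) = (fun x => mxdot 1%:M (mxRN (XG mu) la x)).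
  by apply/funext => x; rewrite E.
rewrite F; split => //; rewrite e1 E /mass /mxtrace.
by apply: eq_bigr => i _; rewrite mxE.
Qed.

Let iabs m p (nu : mxcharge (borel T) m p) : (forall i j, nu i j `<< la) ->
  forall i j, la.-integrable Q (EFin \o (fun x => `|mxRN nu la x i j|)).
Proof.
move=> nula i j; apply: integrable_norm => //.
by under eq_fun do rewrite mxE; exact: RN_integrable.
Qed.

Let test_abs m p (nu : mxcharge (borel T) m p) i j (s t : R) :
  (forall i j, nu i j `<< la) ->
  (forall x, ((s * `|mxRN nu la x i j| - t * \tr (X x))%:E <= J x)%E) ->
  s * \int[la]_(x in Q) `|mxRN nu la x i j| <= t * mass + C.
Proof.
move=> nula H; have [i2 e2] := itrX; have i1 := iabs nula i j.
have i1' : la.-integrable Q (EFin \o (fun x => s * `|mxRN nu la x i j|)).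
  by have := @integrableZl _ _ _ la _ mQ s _ i1; apply: eq_integrable.
have i2' : la.-integrable Q (EFin \o (fun x => t * \tr (X x))).
  by have := @integrableZl _ _ _ la _ mQ t _ i2; apply: eq_integrable.
have i3 : la.-integrable Q (EFin \o (fun x => s * `|mxRN nu la x i j| - t * \tr (X x))).
  by have := integrableB mQ i1' i2'; apply: eq_integrable.
have := test i3 H; rewrite RintegralB// !RintegralZl// e2; lra.
Qed.

(** Where the density is finite, the entries of [X] are bounded by its trace; elsewhere any minorant
    will do. *)
Lemma finite_action_G i j : \int[la]_(x in Q) `|X x i j| <= mass + C.
Proof.
have := @test_abs _ _ (XG mu) i j 1 1 dG; rewrite !mul1r; apply => x.
have := J_density_ge0 L1 L2 (X x) (Y x) (Z x).
have := @J_density_lty_psd _ _ _ L1 L2 (X x) (Y x) (Z x).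
rewrite -/(J x); case: (J x) => [c| |] H c0 //; last by rewrite leey.
apply: le_trans c0; rewrite lee_fin !mul1r subr_le0.
by apply: psd_entry_le_tr; exact: H (ltry _).
Qed.

Lemma finite_action_q i j s : psd_mx L1 -> 0 <= s ->
  s * (k%:R * frobenius L1) <= 1 ->
  s * \int[la]_(x in Q) `|Y x i j| <= mass + C.
Proof.
move=> pL1 s0 sL; rewrite -[mass]mul1r; apply: test_abs => // x.
by rewrite mul1r; exact: J_density_ge_Y.
Qed.

(** [K] is an argument because the same constant must serve along a whole sequence. *)
Lemma finite_action_R (K : R) i j e :
  (forall (L1 : 'M[R]_k) (X : 'M[R]_n) (Y : 'M[R]_(n, k)) (Z : 'M[R]_n) i j (e : R),
    0 < e -> ((e * `|Z i j| - K * e ^+ 2 * \tr X)%:E <= J_density L1 L2 X Y Z)%E) ->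
  0 < e -> e * \int[la]_(x in Q) `|Z x i j| <= K * e ^+ 2 * mass + C.
Proof. by move=> HK e0; apply: test_abs => // x; exact: HK. Qed.

End finite_action.

Lemma cvg_homo_infty (phi : nat -> nat) :
  {homo phi : i j / (i < j)%N} -> phi j @[j --> \oo] --> \oo.
Proof.
move=> phi_lt; have ge j : (j <= phi j)%N.
  by elim: j => // j IH; exact: leq_ltn_trans IH (phi_lt _ _ (ltnSn j)).
by move=> A [N _ NA]; exists N => // j /= Nj; apply: NA => /=; exact: leq_trans Nj (ge j).
Qed.

(** * Weak* limits of bounded sequences *)

Section weak_limit.
Context {R : realType} (d n k : nat).
Local Notation T := (R * 'rV[R]_d)%type.
Local Notation Xch := (Xcharge (borel T) (R := R) n k).
Variable Q : set T.
Hypotheses (compQ : compact Q) (Q0 : Q !=set0).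

Let closedQ : closed Q.
Proof. by apply: compact_closed compQ; exact: (@norm_hausdorff R T). Qed.

Let mQ : measurable (Q : set (borel T)).
Proof. exact: borel_closed. Qed.

Definition charge_difference (p q : {finite_measure set (borel T) -> \bar R}) :
    {charge set (borel T) -> \bar R} :=
  cadd (charge_of_finite_measure p) (cscale (-1) (charge_of_finite_measure q)).

Lemma charge_differenceE p q A : charge_difference p q A = (p A - q A)%E.
Proof. by rewrite /charge_difference /= /cadd/= /cscale/= EFinN mulN1e. Qed.

(** Working entry by entry with scalar functions treats the test fields of [CE] and those of
    [weak_star_cvg] alike. *)
Definition componentwise_cvg (mu_ : nat -> Xch) (mu : Xch) : Prop :=
  [/\ forall a b f, {within Q, continuous f} ->
        cintegral (XG (mu_ j) a b) Q f @[j --> \oo] --> cintegral (XG mu a b) Q f,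
      forall a b f, {within Q, continuous f} ->
        cintegral (Xq (mu_ j) a b) Q f @[j --> \oo] --> cintegral (Xq mu a b) Q f &
      forall a b f, {within Q, continuous f} ->
        cintegral (XR (mu_ j) a b) Q f @[j --> \oo] --> cintegral (XR mu a b) Q f].

Lemma within_continuous_entry m p (F : T -> 'M[R]_(m, p)) i j :
  {within Q, continuous F} -> {within Q, continuous (fun x => F x i j)}.
Proof.
move=> cF x.
exact: (cvg_comp _ _ (cF x) (@coord_continuous R m p i j (F x))).
Qed.

Lemma cvg_mxintegral m p (nu_ : nat -> mxcharge (borel T) (R := R) m p)
    (nu : mxcharge (borel T) (R := R) m p)
    (F : T -> 'M[R]_(m, p)) :
  (forall a b f, {within Q, continuous f} ->
    cintegral (nu_ j a b) Q f @[j --> \oo] --> cintegral (nu a b) Q f) ->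
  (forall a b, {within Q, continuous (fun x => F x a b)}) ->
  mxintegral (nu_ j) Q F @[j --> \oo] --> mxintegral nu Q F.
Proof. by move=> H cF; apply: cvg_sumR => a; apply: cvg_sumR => b; exact: H. Qed.

Lemma componentwise_weak_star mu_ mu :
  componentwise_cvg mu_ mu -> weak_star_cvg Q mu_ mu.
Proof.
move=> [cG cq cR] F H K cF cH cK _.
by apply: cvgD; [apply: cvgD|]; apply: cvg_mxintegral => // a b;
  exact: within_continuous_entry.
Qed.

(** Weak compactness is applied to the Jordan parts of all entries of [G] and [R]. The limits of the
    parts need not be the Jordan parts of the limit, but their difference has the right integrals.
    Both test properties are closed, and they yield the bound for the limit, whose [q] is the zero
    charge. *)
Lemma weak_limit (mu_ : nat -> Xch) (L2 : 'M[R]_n) (M C : R) :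
  pd_mx L2 ->
  (forall j a b, fine (tvar (XG (mu_ j) a b) Q) <= M) ->
  (forall j a b, fine (tvar (XR (mu_ j) a b) Q) <= M) ->
  (forall a b f, {within Q, continuous f} ->
    cintegral (Xq (mu_ j) a b) Q f @[j --> \oo] --> (0 : R)) ->
  (forall j, dual_bounded (mu_ j) Q (invmx L2) C) ->
  (forall j, psd_tested (mu_ j) Q) ->
  exists (phi : nat -> nat) (mu : Xch), [/\ {homo phi : i j / (i < j)%N},
    in_MX mu Q, componentwise_cvg (mu_ \o phi) mu & (action 0 L2 mu Q <= C%:E)%E].
Proof.
move=> pdL2 bG bR qto0 HC HP.
(* The first boolean selects [G] or [R], the second the positive or the negative part. *)
pose m (idx : bool * bool * ('I_n * 'I_n)) j : {finite_measure set (borel T) -> \bar R} :=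
  let nu := if idx.1.1 then XG (mu_ j) idx.2.1 idx.2.2 else XR (mu_ j) idx.2.1 idx.2.2 in
  if idx.1.2 then (jordan_pos (hahn nu) : {finite_measure set (borel T) -> \bar R})
  else (jordan_neg (hahn nu) : {finite_measure set (borel T) -> \bar R}).
have tv (nu : {charge set (borel T) -> \bar R}) :
    fine (jordan_pos (hahn nu) Q) <= fine (tvar nu Q) /\
    fine (jordan_neg (hahn nu) Q) <= fine (tvar nu Q).
  have -> : fine (tvar nu Q) = fine (jordan_pos (hahn nu) Q) + fine (jordan_neg (hahn nu) Q).
    by rewrite tvarE /charge_variation fineD// fin_num_measure.
  by rewrite lerDl lerDr !fine_ge0.
have mM idx j : fine (m idx j Q) <= M.
  rewrite /m; case: idx => [[[] []] [a b]] /=.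
  - exact: le_trans (tv _).1 (bG _ _ _).
  - exact: le_trans (tv _).2 (bG _ _ _).
  - exact: le_trans (tv _).1 (bR _ _ _).
  - exact: le_trans (tv _).2 (bR _ _ _).
have [phi [nu [phi_lt nuQ cnu]]] := weak_compactness compQ Q0 mM.
pose mu : Xch := XCharge
  (fun a b => charge_difference (nu (true, true, (a, b))) (nu (true, false, (a, b))))
  (fun a b => @czero _ (borel T) R)
  (fun a b => charge_difference (nu (false, true, (a, b))) (nu (false, false, (a, b)))).
have bQ f : {within Q, continuous f} -> bounded_measurable (Q : set (borel T)) f.
  exact: within_continuous_bounded_measurable.
have cc : componentwise_cvg (mu_ \o phi) mu.
  split=> a b f cf /=.
  - rewrite (@cintegral_diff _ _ _ _ (nu (true, true, (a, b))) (nu (true, false, (a, b)))) //.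
    + by apply: cvgB; [exact: (cnu (true, true, (a, b)))|exact: (cnu (true, false, (a, b)))].
    + exact: bQ.
    + by move=> A mA _; exact: charge_differenceE.
  - rewrite cintegral_czero; exact: (cvg_comp phi _ (cvg_homo_infty phi_lt) (qto0 a b f cf)).
  - rewrite (@cintegral_diff _ _ _ _ (nu (false, true, (a, b))) (nu (false, false, (a, b)))) //.
    + by apply: cvgB; [exact: (cnu (false, true, (a, b)))|exact: (cnu (false, false, (a, b)))].
    + exact: bQ.
    + by move=> A mA _; exact: charge_differenceE.
have [cG _ cR] := cc.
have cT (f : T -> R) : continuous f -> {within Q, continuous f}.
  by move=> cf; exact: continuous_subspaceT.
have HP' : psd_tested mu Q.
  move=> f cf f01; apply: (@psd_cvg _ _ (fun j => mxint (XG ((mu_ \o phi) j)) Q f)).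
    by move=> j; exact: HP.
  move=> a b; rewrite mxE; under eq_cvg do rewrite mxE.
  by apply: cG; exact: cT.
have HC' : dual_bounded mu Q (invmx L2) C.
  move=> N B f cf f0 f1.
  have cv : \sum_i Jdual (invmx L2) (B i) (mxint (XG ((mu_ \o phi) j)) Q (f i))
      (mxint (XR ((mu_ \o phi) j)) Q (f i)) @[j --> \oo] -->
      \sum_i Jdual (invmx L2) (B i) (mxint (XG mu) Q (f i)) (mxint (XR mu) Q (f i)).
    apply: cvg_sumR => i; apply: cvg_Jdual => a b; rewrite mxE;
      under eq_cvg do rewrite mxE; [apply: cG|apply: cR]; exact: cT.
  rewrite -(cvg_lim _ cv)//; apply: limr_le; first exact: cvgP cv.
  by apply: nearW => j; exact: HC.
have conc (p q : {finite_measure set (borel T) -> \bar R}) :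
    (forall A, measurable A -> p A = p (A `&` Q)) ->
    (forall A, measurable A -> q A = q (A `&` Q)) ->
    concentrated (charge_difference p q) Q.
  by move=> pQ qQ A mA; rewrite !charge_differenceE pQ// qQ.
exists phi, mu; split=> //; last exact: action_le_of_dual.
split=> [a b|a b|a b|A mA].
- by apply: conc => A mA; exact: nuQ.
- by move=> A mA.
- by apply: conc => A mA; exact: nuQ.
- have [sG _] := psd_tested_sets mQ HP' mA.
  suff -> : mxvalue (XG mu) A = mxvalue (XG mu) (A `&` Q) by [].
  apply/matrixP => a b; rewrite !mxE; congr fine.
  by apply: conc => // B mB; exact: nuQ.
Qed.

End weak_limit.

Lemma is_derive_affine {R : realType} (V W : normedModType R) (f : V -> W) (x v : V) (w : W) :
  (forall h : R, f (h *: v + x) = f x + h *: w) -> is_derive x v f w.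
Proof.
move=> fE.
have cv : (fun h : R => h^-1 *: ((f \o shift x) (h *: v) - f x)) @ 0^' --> w.
  apply: cvg_near_cst; near=> h => /=.
  rewrite fE addrAC subrr add0r scalerA mulVf ?scale1r//.
  by near: h; exact: nbhs_dnbhs_neq.
by apply: DeriveDef; [apply/cvg_ex; exists w|exact: cvg_lim cv].
Unshelve. all: by end_near. Qed.

(** * Mass bound and compactness for the continuity equation *)

Section continuity_equation.
Context {R : realType} (n k d : nat).
Local Notation T := (R * 'rV[R]_d)%type.
Local Notation Xch := (Xcharge (borel T) (R := R) n k).
Variables (Omega : set 'rV[R]_d).
Hypotheses (compO : compact Omega) (O0 : Omega !=set0).
Variables (L0 : {linear 'M[R]_n -> 'M[R]_(n, k)})
  (L : 'I_d -> {linear 'M[R]_n -> 'M[R]_(n, k)}).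
Variables (G0 G1 : mxcharge (borel 'rV[R]_d) (R := R) n n).

Lemma cylinder_compact : compact (cylinder Omega).
Proof. by apply: compact_setX => //; exact: segment_compact. Qed.

Lemma cylinder_nonempty : cylinder Omega !=set0.
Proof. by case: O0 => x Ox; exists (0, x); split => //=; rewrite in_itv/= lexx ler01. Qed.

Let closedQ : closed (cylinder Omega).
Proof. by apply: compact_closed cylinder_compact; exact: (@norm_hausdorff R T). Qed.

Lemma cylinder_measurable : measurable (cylinder Omega : set (borel T)).
Proof. exact: borel_closed. Qed.

Lemma linear_entry m p (f : {linear 'M[R]_n -> 'M[R]_(m, p)}) A i j :
  f A i j = \sum_a \sum_b A a b * f (delta_mx a b) i j.
Proof.
rewrite {1}[A]matrix_sum_delta linear_sum summxE; apply: eq_bigr => a _.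
by rewrite linear_sum summxE; apply: eq_bigr => b _; rewrite linearZ mxE.
Qed.

Lemma within_continuous_sum (I : finType) (D : set T) (F : I -> T -> R) :
  (forall i, {within D, continuous (F i)}) -> {within D, continuous (fun x => \sum_i F i x)}.
Proof. by move=> cF x; apply: (@cvg_sumR R _ _ (nbhs (x : subspace D))) => i; exact: cF. Qed.

Lemma within_continuous_linear m p (f : {linear 'M[R]_n -> 'M[R]_(m, p)})
    (D : set T) (F : T -> 'M[R]_n) i j :
  {within D, continuous F} -> {within D, continuous (fun x => f (F x) i j)}.
Proof.
move=> cF; under eq_fun do rewrite linear_entry.
apply: within_continuous_sum => a; apply: within_continuous_sum => b x.
by apply: cvgM; [exact: within_continuous_entry|exact: cvg_cst].
Qed.

Lemma within_continuous_Dstar Phi dtPhi dxPhi i j :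
  C1_sym (cylinder Omega) Phi dtPhi dxPhi ->
  {within cylinder Omega, continuous (fun x => Dstar L0 L Phi dxPhi x i j)}.
Proof.
move=> [_ cPhi _ cdx _]; rewrite /Dstar; under eq_fun do rewrite mxE summxE.
move=> x; apply: cvgD; first exact: within_continuous_linear.
by apply: within_continuous_sum => l; exact: within_continuous_linear.
Qed.

Lemma CE_limit (mu_ : nat -> Xch) (mu : Xch) :
  (forall j, CE L0 L Omega G0 G1 (mu_ j)) -> in_MX mu (cylinder Omega) ->
  componentwise_cvg (cylinder Omega) mu_ mu -> CE L0 L Omega G0 G1 mu.
Proof.
move=> HCE inQ [cG cq cR]; split=> // Phi dtPhi dxPhi HPhi.
have [_ cPhi cdt cdx _] := HPhi.
have cv : mxintegral (XG (mu_ j)) (cylinder Omega) dtPhi +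
      mxintegral (Xq (mu_ j)) (cylinder Omega) (Dstar L0 L Phi dxPhi) +
      mxintegral (XR (mu_ j)) (cylinder Omega) Phi @[j --> \oo] -->
    mxintegral (XG mu) (cylinder Omega) dtPhi +
      mxintegral (Xq mu) (cylinder Omega) (Dstar L0 L Phi dxPhi) +
      mxintegral (XR mu) (cylinder Omega) Phi.
  apply: cvgD; first apply: cvgD; apply: cvg_mxintegral => // a b.
  - exact: within_continuous_entry.
  - exact: within_continuous_Dstar HPhi.
  - exact: within_continuous_entry.
rewrite -(cvg_lim _ cv)//; apply: lim_near_cst => //.
by apply: nearW => j; exact: (HCE j).2 _ _ _ HPhi.
Qed.

Hypothesis L0_id : L0 1%:M = 0.

Let Phi0 (z : T) : 'M[R]_n := (z.1 - 1) *: 1%:M.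

Let Phi0_C1 : C1_sym (cylinder Omega) Phi0 (fun=> 1%:M) (fun _ _ => 0).
Proof.
have cPhi0 : continuous Phi0.
  move=> z; apply: cvgZr_tmp; apply: cvgB; last exact: cvg_cst.
  exact: cvg_fst.
split.
- by move=> z _; rewrite /Phi0 linearZ/= trmx1.
- exact: continuous_subspaceT.
- by apply: continuous_subspaceT => z; exact: cvg_cst.
- by move=> j; apply: continuous_subspaceT => z; exact: cvg_cst.
- move=> z _; split=> [|j]; apply: (@is_derive_affine R T) => h; rewrite /Phi0 /=.
    by rewrite -scalerDl; congr (_ *: _); rewrite [h *: _]mulr1 -addrA addrC.
  by rewrite scaler0 add0r scaler0 addr0.
Qed.

(** This is the trace of [G0] on [Omega]: [Phi0] vanishes at time 1 and is [- 1%:M] at time 0. *)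
Definition initial_mass : R :=
  mxintegral G1 Omega (fun x => Phi0 (1, x)) - mxintegral G0 Omega (fun x => Phi0 (0, x)).

Let Q : set T := cylinder Omega.
Let mQ : measurable (Q : set (borel T)) := cylinder_measurable.

Let cintegral_cst nu (c : R) : cintegral nu (Q : set (borel T)) (fun=> c) = c * fine (nu Q).
Proof.
have -> : nu Q = nu ([set: borel T] `&` Q) by rewrite setTI.
rewrite -cintegral_indic// -cintegralZ//; last exact: bounded_measurable_indic.
by apply: eq_cintegral => x _; rewrite indicE in_setT mulr1.
Qed.

(** Tested with [Phi0], the term in [R] carries the weight [t - 1], of absolute value at most 1 on
    the cylinder. *)
Lemma CE_mass_le (mu : Xch) : CE L0 L Omega G0 G1 mu ->
  \sum_i fine (XG mu i i Q) <= initial_mass + \sum_i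
    \int[Defs.variation mu]_(x in Q) `|mxRN (XR mu) (Defs.variation mu) x i i|.
Proof.
move=> [_ /(_ _ _ _ Phi0_C1)]; rewrite -/initial_mass -/Q.
have -> : mxintegral (XG mu) Q (fun=> 1%:M) = \sum_i fine (XG mu i i Q).
  apply: eq_bigr => i _; rewrite (bigD1 i)//= cintegral_cst mxE eqxx mul1r.
  rewrite big1 ?addr0// => j ji.
  by rewrite cintegral_cst mxE eq_sym (negPf ji) mul0r.
have -> : mxintegral (Xq mu) Q (Dstar L0 L Phi0 (fun _ _ => 0)) = 0.
  apply: big1 => i _; apply: big1 => j _.
  rewrite -[RHS](cintegral_cst0 (Xq mu i j) (Q : set (borel T))).
  apply: eq_cintegral => x _.
  rewrite /Dstar /Phi0 linearZ/= L0_id scaler0 add0r summxE big1// => l _.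
  by rewrite linear0 mxE.
rewrite addr0 => <-; rewrite -addrA lerDl.
set mR := mxintegral _ _ _; suff : - mR <= \sum_i
    \int[Defs.variation mu]_(x in Q) `|mxRN (XR mu) (Defs.variation mu) x i i| by lra.
have -> : mR = \sum_i cintegral (XR mu i i) Q (fun z => z.1 - 1).
  apply: eq_bigr => i _; rewrite (bigD1 i)//= big1 ?addr0.
    by apply: eq_cintegral => x _; rewrite !mxE eqxx mulr1.
  move=> j ji; rewrite -[RHS](cintegral_cst0 (XR mu i j) (Q : set (borel T))).
  by apply: eq_cintegral => x _; rewrite !mxE eq_sym (negPf ji) mulr0.
rewrite -sumrN; apply: ler_sum => i _.
have [_ _ dR] := variation_dominates mu.
have bz : bounded_measurable (Q : set (borel T)) (fun z => z.1 - 1).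
  apply: within_continuous_bounded_measurable => //; first exact: cylinder_compact.
  apply: continuous_subspaceT => z; apply: cvgB; last exact: cvg_cst.
  exact: cvg_fst.
pose la : {finite_measure set (borel T) -> \bar R} := Defs.variation mu.
have iR : la.-integrable (Q : set (borel T)) (EFin \o (fun x => mxRN (XR mu) la x i i)).
  by under eq_fun do rewrite mxE; exact: RN_integrable.
have iM := integrable_bounded_measurableM mQ bz iR.
rewrite (cintegral_RN mQ bz (dR i i)).
rewrite (le_trans (ler_norm _))// normrN.
have -> : \int[Defs.variation mu]_(x in (Q : set (borel T)))
    ((x.1 - 1) * fine (Radon_Nikodym (XR mu i i) (Defs.variation mu) x)) =
    \int[la]_(x in (Q : set (borel T))) ((x.1 - 1) * mxRN (XR mu) la x i i).
  by apply: eq_Rintegral => x _; rewrite mxE.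
apply: (le_trans (le_normr_Rintegral mQ iM)).
apply: le_Rintegral => //; [exact: integrable_norm iM|exact: integrable_norm iR|].
move=> x [/= + _]; rewrite in_itv/= => /andP[x0 x1].
rewrite normrM ler_piMl// ler_norml; lra.
Qed.

(** Only a uniform bound on the actions is asked for, so the lemma serves near minimizers as well as
    minimizers. *)
Lemma CE_compactness (n_gt0 : (0 < n)%N) (L2 : 'M[R]_n) (L1_ : nat -> 'M[R]_k)
    (mu_ : nat -> Xch) (C : R) : pd_mx L2 ->
  (forall j, psd_mx (L1_ j)) -> frobenius (L1_ j) @[j --> \oo] --> (0 : R) ->
  (forall j, CE L0 L Omega G0 G1 (mu_ j)) ->
  (forall j, (action (L1_ j) L2 (mu_ j) Q <= C%:E)%E) ->
  exists (phi : nat -> nat) (mu : Xch), [/\ {homo phi : i j / (i < j)%N},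
    CE L0 L Omega G0 G1 mu, weak_star_cvg Q (mu_ \o phi) mu &
    (action 0 L2 mu Q <= C%:E)%E].
Proof.
move=> pdL2 psdL cL HCE HC.
have [K K0 HK] := J_density_ge_Z k pdL2.
pose mass j : R := \sum_i fine (XG (mu_ j) i i Q).
pose la j : {finite_measure set (borel T) -> \bar R} := Defs.variation (mu_ j).
have intR j a b (e : R) : 0 < e ->
    e * \int[la j]_(x in Q) `|mxRN (XR (mu_ j)) (la j) x a b| <= K * e ^+ 2 * mass j + C.
  by move=> e0; apply: (finite_action_R mQ (HC j)) => // *; exact: HK.
have nR0 : (0 : R) < n%:R by rewrite ltr0n.
(* This solves [mass <= initial_mass + mass / 2 + 2 n^2 K C]. *)
pose tau := 2 * initial_mass + 4 * n%:R ^+ 2 * K * C.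
have massle j : mass j <= tau.
  (* For this [e] one has [n K e = 1 / 2], so half of the mass is absorbed. *)
  pose e : R := (2 * n%:R * K)^-1.
  have e0 : 0 < e by rewrite invr_gt0 !mulr_gt0.
  have eE : e * (2 * n%:R * K) = 1 by rewrite mulVf// gt_eqF// !mulr_gt0.
  have h1 := CE_mass_le (HCE j).
  have h2 : \sum_i \int[la j]_(x in Q) `|mxRN (XR (mu_ j)) (la j) x i i| <=
      \sum_(i < n) (K * e * mass j + C * (2 * n%:R * K)).
    apply: ler_sum => i _; rewrite -(ler_pM2l e0); apply: le_trans (intR j i i e e0) _.
    have -> : e * (K * e * mass j + C * (2 * n%:R * K)) =
      K * e ^+ 2 * mass j + C * (e * (2 * n%:R * K)) by ring.
    by rewrite eE mulr1.
  have := le_trans h1 (lerD (lexx _) h2).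
  have -> : \sum_(i < n) (K * e * mass j + C * (2 * n%:R * K)) =
      2^-1 * (e * (2 * n%:R * K)) * mass j + 2 * n%:R ^+ 2 * K * C.
    by rewrite sumr_const card_ord -[LHS]mulr_natl; field.
  by rewrite eE mulr1 /tau -/(mass j); lra.
have [dG dq dR] : [/\ forall j a b, XG (mu_ j) a b `<< la j,
    forall j a b, Xq (mu_ j) a b `<< la j & forall j a b, XR (mu_ j) a b `<< la j].
  by split=> j a b; have [] := variation_dominates (mu_ j).
have tvle (nu : mxcharge (borel T) (R := R) n n) j a b B : nu a b `<< la j ->
    \int[la j]_(x in Q) `|mxRN nu (la j) x a b| <= B -> fine (tvar (nu a b) Q) <= 2 * B.
  move=> nula le; apply: (le_trans (tvar_le_RN mQ nula)).
  rewrite ler_pM2l//; apply: le_trans le.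
  by rewrite le_eqVlt; apply/orP; left; apply/eqP; apply: eq_Rintegral => x _; rewrite mxE.
pose M := Num.max (2 * (tau + C)) (2 * (K * tau + C)).
have bG j a b : fine (tvar (XG (mu_ j) a b) Q) <= M.
  rewrite le_max; apply/orP; left; apply: (tvle _ j) => //.
  apply: le_trans (finite_action_G mQ (HC j) a b) _.
  by rewrite lerD2r; exact: massle.
have bR j a b : fine (tvar (XR (mu_ j) a b) Q) <= M.
  rewrite le_max; apply/orP; right; apply: (tvle _ j) => //.
  have := intR j a b 1 ltr01; rewrite mul1r expr1n mulr1 => h; apply: le_trans h _.
  by rewrite lerD2r ler_pM2l//; exact: massle.
have inMX j : in_MX (mu_ j) Q by case: (HCE j).
have qto0 a b f : {within Q, continuous f} ->
    cintegral (Xq (mu_ j) a b) Q f @[j --> \oo] --> (0 : R).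
  move=> cf; have [mf [Kf fK]] := within_continuous_bounded_measurable cylinder_compact closedQ cf.
  have bf : bounded_measurable (Q : set (borel T)) f by split => //; exists Kf.
  have qle j : `|cintegral (Xq (mu_ j) a b) Q f| <=
      `|Kf| * \int[la j]_(x in Q) `|mxRN (Xq (mu_ j)) (la j) x a b|.
    have iY : (la j).-integrable (Q : set (borel T)) (EFin \o (fun x => mxRN (Xq (mu_ j)) (la j) x a b)).
      by under eq_fun do rewrite mxE; exact: RN_integrable.
    have iM := integrable_bounded_measurableM mQ bf iY.
    rewrite (cintegral_RN mQ bf (dq j a b)) -RintegralZl//; last exact: integrable_norm iY.
    have -> : \int[la j]_(x in (Q : set (borel T)))
       (f x * fine (Radon_Nikodym (Xq (mu_ j) a b) (la j) x)) =
       \int[la j]_(x in (Q : set (borel T))) (f x * mxRN (Xq (mu_ j)) (la j) x a b).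
      by apply: eq_Rintegral => x _; rewrite mxE.
    apply: (le_trans (le_normr_Rintegral mQ iM)).
    apply: le_Rintegral => //; first exact: integrable_norm iM.
      have := @integrableZl _ _ _ (la j) _ mQ `|Kf| _ (integrable_norm iY).
      by apply: eq_integrable.
    move=> x Qx; rewrite normrM ler_wpM2r//; exact: le_trans (fK x Qx) (ler_norm _).
  apply/cvgrPdist_le => e e0.
  pose D := `|tau + C|.
  (* With this [s], the bound [D] on [s] times the integral of [|Y|] makes the integral against [f]
     at most [e]. It requires [s k |L1| <= 1], which holds once [|L1|] is at most the inverse of
     [s (k + 1)]; the added units keep [s] and [k + 1] positive. *)
  pose s := (`|Kf| * D + 1) / e.
  have s0 : 0 < s by apply: divr_gt0 => //; apply: ltr_wpDl => //; apply: mulr_ge0; exact: normr_ge0.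
  have k1 : (0 : R) < k%:R + 1 by rewrite ltr_wpDl.
  have e'0 : 0 < (s * (k%:R + 1))^-1 by rewrite invr_gt0 mulr_gt0.
  have /cvgrPdist_le/(_ _ e'0) := cL; apply: filterS => j.
  rewrite !sub0r !normrN => Lj; apply: le_trans (qle j) _.
  have frob0 : 0 <= frobenius (L1_ j) by rewrite sqrtr_ge0.
  have sL : s * (k%:R * frobenius (L1_ j)) <= 1.
    apply: (@le_trans _ _ (s * (k%:R + 1) * frobenius (L1_ j))).
      by rewrite mulrA ler_wpM2r// ler_pM2l// lerDl.
    have sk0 : 0 < s * (k%:R + 1) by exact: mulr_gt0.
    by rewrite mulrC -ler_pdivlMr// mul1r; apply: le_trans Lj; exact: ler_norm.
  have := finite_action_q mQ (HC j) a b (psdL j) (ltW s0) sL.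
  set y := \int[_]_(x in _) _ => h.
  have sy : s * y <= D.
    by apply: (le_trans h); apply: le_trans (ler_norm _); rewrite lerD2r; exact: massle.
  rewrite -(ler_pM2l s0) mulrCA.
  apply: (@le_trans _ _ (`|Kf| * D)); first by rewrite ler_wpM2l.
  by rewrite /s divfK ?gt_eqF// lerDl.
have [phi [mu [phi_lt muQ cc act]]] := weak_limit cylinder_compact cylinder_nonempty
  pdL2 bG bR qto0 (fun j => finite_action_dual_bounded mQ (HC j))
  (fun j => finite_action_psd_tested mQ (inMX j) (HC j)).
exists phi, mu; split=> //.
  by apply: (@CE_limit (mu_ \o phi)) => // j; exact: HCE.
exact: componentwise_weak_star.
Qed.

End continuity_equation.

(** * A competitor of finite action *)

Section charge_sums.
Context d (T : measurableType d) {R : realType}.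
Implicit Types (s : seq (R * {charge set T -> \bar R})).

Definition csum s : {charge set T -> \bar R} :=
  foldr (fun p nu => cadd (cscale p.1 p.2) nu) (@czero _ T R) s.

Lemma fine_csum s A : measurable A ->
  fine (csum s A) = \sum_(p <- s) p.1 * fine (p.2 A).
Proof.
move=> mA; elim: s => [|p s IH]; first by rewrite big_nil.
rewrite big_cons -IH /= /cadd/= fineD ?fin_num_measure//.
by rewrite /cscale fineM// fin_num_measure.
Qed.

Lemma cintegral_csum s D f : measurable D -> bounded_measurable D f ->
  cintegral (csum s) D f = \sum_(p <- s) p.1 * cintegral p.2 D f.
Proof.
move=> mD bf; elim: s => [|p s IH]; first by rewrite big_nil cintegral_czero.
by rewrite big_cons -IH /= cintegral_cadd// cintegral_cscale.
Qed.

Lemma tvar_le_of_abs (nu : {charge set T -> \bar R}) (Q : set T) B : measurable Q ->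
  (forall A, measurable A -> `|fine (nu A)| <= B) -> fine (tvar nu Q) <= 2 * B.
Proof.
move=> mQ le; have [[mP _] [mN _] _ _] := hahn nu.
have E : tvar nu Q = (nu (Q `&` (sval (cid (hahn_ex nu))).1) -
    nu (Q `&` (sval (cid (hahn_ex nu))).2))%E.
  rewrite tvarE /charge_variation jordan_posE cjordan_posE jordan_negE cjordan_negE.
  by rewrite /crestr0 mem_set.
have mQP : measurable (Q `&` (sval (cid (hahn_ex nu))).1) by exact: measurableI.
have mQN : measurable (Q `&` (sval (cid (hahn_ex nu))).2) by exact: measurableI.
rewrite E fineB ?fin_num_measure//.
rewrite mulr_natl mulr2n (le_trans _ (lerD (le _ mQP) (le _ mQN)))//.
by rewrite (le_trans (ler_norm _))// ler_normB.
Qed.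

Lemma abs_charge_le_tvar (nu : {charge set T -> \bar R}) A : measurable A ->
  `|fine (nu A)| <= fine (tvar nu setT).
Proof.
move=> mA; apply: (@le_trans _ _ (fine (tvar nu A))); last first.
  by apply: fine_le; rewrite ?fin_num_measure// le_measure ?inE.
rewrite tvarE /charge_variation (jordanE nu mA) fineB ?fineD ?fin_num_measure//.
by rewrite (le_trans (ler_normB _ _))// !ger0_norm ?fine_ge0.
Qed.

(** The quadratic form of the integral at [u] is the integral against the charge [u^T G u], which is
    nonnegative on measurable sets. *)
Lemma psd_mxint_charge n (G : mxcharge T (R := R) n n) (D : set T) (psi : T -> R) :
  measurable D -> bounded_measurable D psi -> (forall x, D x -> 0 <= psi x) ->
  (forall A, measurable A -> psd_mx (mxvalue G A)) ->
  psd_mx (\matrix_(a, b) cintegral (G a b) D psi).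
Proof.
move=> mD bpsi psi0 Gpsd; split.
  apply/matrixP => a b; rewrite !mxE; apply: eq_cintegral_charge => // A mA _.
  have [sG _] := Gpsd A mA.
  have := congr1 (fun N : 'M[R]_n => N a b) sG; rewrite !mxE => h.
  by rewrite -[LHS]fineK ?fin_num_measure// -[RHS]fineK ?fin_num_measure// h.
move=> u; rewrite quad_mxdot_outer.
pose s : seq (R * {charge set T -> \bar R}) :=
  [seq ((u *m u^T) p.1 p.2, G p.1 p.2) | p <- index_enum ('I_n * 'I_n)%type].
have -> : mxdot (u *m u^T) (\matrix_(a, b) cintegral (G a b) D psi) =
    cintegral (csum s) D psi.
  rewrite cintegral_csum// big_map mxdotE pair_big/=.
  by apply: eq_bigr => p _; rewrite mxE.
apply: cintegral_charge_ge0 => // A mA AD.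
rewrite -[csum s A]fineK ?fin_num_measure// lee_fin fine_csum// big_map.
have [_ /(_ u)] := Gpsd A mA; rewrite quad_mxdot_outer mxdotE pair_big/= => h.
apply: (le_trans h); rewrite le_eqVlt; apply/orP; left; apply/eqP.
by apply: eq_bigr => p _; rewrite [mxvalue _ _ _ _]mxE.
Qed.

End charge_sums.

Section slices.
Context {R : realType} (d : nat).
Local Notation T := (R * 'rV[R]_d)%type.

Definition at_time (t : R) (x : 'rV[R]_d) : T := (t, x).

Lemma continuous_at_time t : continuous (at_time t).
Proof.
move=> x; rewrite /continuous_at /at_time.
by apply: (@cvg_pair _ _ _ (nbhs x) (nbhs t) (nbhs x)); [exact: cvg_cst|exact: cvg_id].
Qed.

Lemma at_time_measurable t :
  measurable_fun [set: borel 'rV[R]_d] (at_time t : borel 'rV[R]_d -> borel T).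
Proof. exact: (@continuous_borel_measurable _ T _ (@continuous_at_time t)). Qed.

(** This is the product of the Dirac mass at time [t] with [nu]. *)
Definition slice (t : R) (nu : {charge set (borel 'rV[R]_d) -> \bar R}) :
    {charge set (borel T) -> \bar R} :=
  measure_function_pushforward__canonical__charge_Charge nu (at_time_measurable t).

Lemma sliceE t nu A : slice t nu A = nu (at_time t @^-1` A).
Proof. by []. Qed.

Lemma within_continuous_precomp (X Y : topologicalType) (D : set X) (Q : set Y)
    (h : X -> Y) (f : Y -> R) :
  {within Q, continuous f} -> continuous h -> (forall y, D y -> Q (h y)) ->
  {within D, continuous (f \o h)}.
Proof.
move=> /subspace_continuousP cf ch DQ; apply/subspace_continuousP => y Dy.
apply: (cvg_comp _ _ _ (cf _ (DQ y Dy))).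
move=> A /ch; rewrite nbhs_simpl /= => hA.
by apply: filterS hA => z hz Dz; apply: hz; exact: DQ.
Qed.

Lemma cintegral_slice t nu (Omega : set 'rV[R]_d) (f : T -> R) :
  0 <= t <= 1 -> measurable (cylinder Omega : set (borel T)) ->
  bounded_measurable (cylinder Omega : set (borel T)) f ->
  cintegral (slice t nu) (cylinder Omega) f = cintegral nu Omega (fun x => f (t, x)).
Proof.
move=> t01 mQ bf.
rewrite (@cintegral_pushforward _ _ _ _ _ _ (at_time_measurable t) nu)//.
congr cintegral; apply/seteqP; split=> x //=; first by case.
Qed.

End slices.

(** * Riemann sums in time *)

Section riemann_sums.
Context {R : realType} (d : nat).
Local Notation T := (R * 'rV[R]_d)%type.
Variable Omega : set 'rV[R]_d.
Hypotheses (compO : compact Omega) (smoothO : smooth_boundary Omega).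

Let closedO : closed Omega.
Proof. by apply: compact_closed compO; exact: (@norm_hausdorff R 'rV[R]_d). Qed.

(** At a boundary point [psi] is 0, since a negative value would make the point interior. A small
    move along [e_j], against the sign of the nonzero derivative, makes [psi] negative and so
    reaches the interior. *)
Lemma interior_dense : Omega `<=` closure (Omega^°).
Proof.
move=> x Ox; have [xi|xi] := pselect (Omega^° x); first exact: subset_closure.
have [U [psi [Ux smooth_psi [j Dj] OU]]] := smoothO (conj (subset_closure Ox) xi).
have cpsi : continuous psi := smooth_psi 0%N.
have dpsi : derivable psi x (delta_mx 0 j) := (smooth_psi 1%N j).1 x.
have inside y : U^° y -> psi y < 0 -> Omega^° y.
  move=> Uy py; have pn : nbhs y [set z | psi z < 0].
    exact: (@cvgr_lt _ _ _ _ _ _ (cpsi y) 0 py).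
  apply: filterS (filterI Uy pn) => z [zU /= pz].
  suff : (Omega `&` U) z by case.
  by rewrite OU; split => //=; exact: ltW.
have psix : psi x <= 0.
  suff : ([set y | psi y <= 0] `&` U) x by case.
  by rewrite -OU; split => //; exact: nbhs_singleton.
have Uxi : nbhs x (U^°) by apply: nbhs_interior.
have psi0 : psi x = 0.
  apply/eqP; rewrite eq_le psix/= leNgt; apply/negP => /inside px.
  by apply: xi; apply: px; exact: nbhs_singleton.
move=> B Bx.
have cline : (fun h : R => h *: (delta_mx 0 j : 'rV[R]_d) + x) @ 0^' --> x.
  have : (fun h : R => h *: (delta_mx 0 j : 'rV[R]_d) + x) @ 0^' --> 0 *: (delta_mx 0 j : 'rV[R]_d) + x.
    apply: cvgD; last exact: cvg_cst.
    apply: cvgZr_tmp; exact: nbhs_dnbhs.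
  by rewrite scale0r add0r.
have nB : \forall h \near 0^', B (h *: (delta_mx 0 j : 'rV[R]_d) + x) by exact: (cline _ Bx).
have nU : \forall h \near 0^', (U^°) (h *: (delta_mx 0 j : 'rV[R]_d) + x) by exact: (cline _ Uxi).
set D := 'D_(delta_mx 0 j) psi x in Dj.
have nD : \forall h \near 0^', 0 < D * (h^-1 * psi (h *: (delta_mx 0 j : 'rV[R]_d) + x)).
  have : (fun h : R => D * (h^-1 *: ((psi \o shift x) (h *: (delta_mx 0 j : 'rV[R]_d)) - psi x)))
      @ 0^' --> D * D.
    by apply: cvgM; [exact: cvg_cst|exact: dpsi].
  have DD : 0 < D * D by rewrite -expr2 exprn_even_gt0.
  move=> /cvgr_gt /(_ _ DD); apply: filterS => h /=.
  by rewrite psi0 subr0.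
have [e /= e0 He] : \forall h \near 0^', [/\ B (h *: (delta_mx 0 j : 'rV[R]_d) + x),
    (U^°) (h *: (delta_mx 0 j : 'rV[R]_d) + x) &
    0 < D * (h^-1 * psi (h *: (delta_mx 0 j : 'rV[R]_d) + x))].
  by near=> h; split; near: h.
(* Half of the admissible size, with the sign opposite to that of [D]. *)
pose h : R := - (D / `|D|) * (e / 2).
have nD0 : 0 < `|D| by rewrite normr_gt0.
have hn : `|h| = e / 2.
  rewrite /h normrM normrN normrM normrV ?unitfE ?gt_eqF// normr_id divff ?gt_eqF// mul1r.
  by rewrite ger0_norm// divr_ge0// ltW.
have h0 : h != 0 by rewrite -normr_gt0 hn divr_gt0.
have [Bh Uh Dh] := He h ltac:(by rewrite /ball/= sub0r normrN hn; lra) h0.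
exists (h *: (delta_mx 0 j : 'rV[R]_d) + x); split => //.
apply: inside => //.
have Dh0 : D * h < 0.
  have -> : D * h = - (D * D / `|D| * (e / 2)) by rewrite /h; ring.
  rewrite oppr_lt0 mulr_gt0// ?divr_gt0//.
  by rewrite -expr2 exprn_even_gt0.
set p := psi _ in Dh *.
have : 0 < D * (h^-1 * p) * (h * h).
  by rewrite mulr_gt0// -expr2 exprn_even_gt0.
have -> : D * (h^-1 * p) * (h * h) = (D * h) * p by field.
by rewrite nmulr_rgt0.
Unshelve. all: by end_near. Qed.

Let Q : set T := cylinder Omega.

Let compQ : compact Q. Proof. exact: cylinder_compact. Qed.

Lemma is_derive_slice (f dtf : T -> R) (t : R) (x : 'rV[R]_d) :
  is_derive ((t, x) : T) ((1, 0) : T) f (dtf (t, x)) ->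
  is_derive t (1 : R) (fun u => f (u, x)) (dtf (t, x)).
Proof.
move=> [df fE].
have E : (fun h : R => h^-1 *: (((fun u => f (u, x)) \o shift t) (h *: (1 : R)) - f (t, x))) =
  (fun h : R => h^-1 *: ((f \o shift ((t, x) : T)) (h *: ((1, 0) : T)) - f (t, x))).
  apply/funext => h /=.
  have -> : h *: ((1, 0) : T) + (t, x) = (h *: (1 : R) + t, h *: (0 : 'rV[R]_d) + x) by [].
  by rewrite scaler0 add0r.
by apply: DeriveDef; [rewrite /derivable E|rewrite -fE /derive E].
Qed.

Lemma cylinder_interior (t : R) (x : 'rV[R]_d) :
  0 < t < 1 -> Omega^° x -> Q^° (t, x).
Proof.
move=> t01 Ox; exists (`]0, 1[%classic, Omega) => /=.
  by split => //; apply: open_nbhs_nbhs; split; [exact: interval_open|rewrite /= in_itv].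
by move=> [u y] [/= /andP[u0 u1] Oy]; split => //=; rewrite in_itv/= !ltW.
Qed.

(* Left Riemann sums of the [t]-derivative of [(t - s)^2 f].  [f] is only known to
   be differentiable in the interior, hence the closing density argument. *)
Lemma riemann_sum (f dtf : T -> R) (s e : R) :
  {within Q, continuous f} -> {within Q, continuous dtf} ->
  (forall z, Q^° z -> is_derive z ((1, 0) : T) f (dtf z)) -> 0 < e ->
  \forall m \near \oo, forall x, Omega x ->
    `|((1 - s) ^+ 2 * f (1, x) - s ^+ 2 * f (0, x)) -
      \sum_(i < m.+1) m.+1%:R^-1 * ((i%:R / m.+1%:R - s) ^+ 2 * dtf (i%:R / m.+1%:R, x) +
        2 * (i%:R / m.+1%:R - s) * f (i%:R / m.+1%:R, x))| <= e.
Proof.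
move=> cf cdf Hf e0.
pose D (z : T) : R := (z.1 - s) ^+ 2 * dtf z + 2 * (z.1 - s) * f z.
have cz (g : T -> R) : continuous g -> {within Q, continuous g} by exact: continuous_subspaceT.
have c1 : {within Q, continuous (fun z : T => z.1 - s)}.
  by apply: cz => z; apply: cvgB; [exact: cvg_fst|exact: cvg_cst].
have cD : {within Q, continuous D}.
  move=> z; apply: cvgD; apply: cvgM; [|exact: cdf| |exact: cf].
    by rewrite expr2; apply: cvgM; exact: c1.
  by apply: cvgM; [exact: cvg_cst|exact: c1].
have [r r0 Hr] := within_unif_continuous compQ cD e0.
near=> m.
have mr : m.+1%:R^-1 < r by near: m; exact: near_infty_natSinv_lt (PosNum r0).
have m0 : (0 : R) < m.+1%:R by [].
pose t (i : nat) : R := i%:R / m.+1%:R.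
have t01 i : (i <= m.+1)%N -> 0 <= t i <= 1.
  by move=> im; rewrite divr_ge0//= ler_pdivrMr// mul1r ler_nat.
have tS i : t i.+1 - t i = m.+1%:R^-1 by rewrite -mulrBl -natrB// subSnn mul1r.
pose E x : R := ((1 - s) ^+ 2 * f (1, x) - s ^+ 2 * f (0, x)) -
   \sum_(i < m.+1) m.+1%:R^-1 * D (t i, x).
suff HE x : Omega x -> `|E x| <= e by exact: HE.
have inner y : Omega^° y -> `|E y| <= e.
  move=> Oy; have Qy : Omega y by exact: interior_subset.
  pose F u := (u - s) ^+ 2 * f (u, y).
  (* By the mean value theorem the increment is the step times [D] at an intermediate time, which
     uniform continuity compares with [D] at the left node. *)
  have step (i : 'I_m.+1) : `|F (t i.+1) - F (t i) - m.+1%:R^-1 * D (t i, y)| <= e / m.+1%:R.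
    have ti := t01 i (ltnW (ltn_ord i)); have tSi := t01 i.+1 (ltn_ord i).
    have tt : t i < t i.+1 by rewrite -subr_gt0 tS invr_gt0.
    have [||c] := @MVT R F (fun u => D (u, y)) _ _ tt.
    - move=> u; rewrite in_itv/= => /andP[u0 u1].
      have du : is_derive u (1 : R) (fun v => f (v, y)) (dtf (u, y)).
        apply: is_derive_slice; apply: Hf; apply: cylinder_interior => //.
        by move: ti tSi => /andP[? ?] /andP[? ?]; apply/andP; split; lra.
      have du1 : is_derive u (1 : R) (fun v => v - s) (1 : R).
        by apply: (@is_derive_affine R R) => h; rewrite -addrA addrC.
      have du2 : is_derive u (1 : R) (fun v => (v - s) ^+ 2) (2 * (u - s)).
        have -> : (fun v => (v - s) ^+ 2) = (fun v => v - s) * (fun v => v - s).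
          by apply/funext => v; rewrite expr2.
        apply: (is_derive_eq (is_deriveM du1 du1)).
        by change ((u - s) * 1 + (u - s) * 1 = 2 * (u - s)); ring.
      apply: (is_derive_eq (is_deriveM du2 du)).
      by rewrite /D/= /GRing.scale/= [f _ * _]mulrC.
    - move=> u; rewrite /F; apply: cvgM; last first.
        suff cfy : {within `[t i, t i.+1], continuous (fun u : R => f (u, y))} by exact: cfy.
        apply: (@within_continuous_precomp R R T `[t i, t i.+1]%classic Q (fun u => (u, y)) f cf).
          by move=> v; apply: (@cvg_pair _ _ _ (nbhs v) (nbhs v) (nbhs y)); [exact: cvg_id|exact: cvg_cst].
        move=> v; rewrite /= in_itv/= => /andP[v0 v1]; split => //=; rewrite in_itv/=.
        by move: ti tSi => /andP[? ?] /andP[? ?]; apply/andP; split; lra.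
      have cs : continuous (fun v : R => (v - s) ^+ 2).
        move=> v; rewrite /continuous_at expr2; under eq_fun do rewrite expr2.
        by apply: cvgM; apply: cvgB; [exact: cvg_id|exact: cvg_cst|exact: cvg_id|exact: cvg_cst].
      exact: (@continuous_subspaceT _ _ `[t i, t i.+1]%classic _ cs u).
    - rewrite in_itv/= => /andP[c0 c1'] ->.
      rewrite tS mulrC -mulrBr normrM ger0_norm ?invr_ge0// mulrC ler_pM2r ?invr_gt0//.
      apply: Hr.
      + by split => //=; rewrite in_itv/=; move: ti tSi => /andP[? ?] /andP[? ?]; apply/andP; split; lra.
      + by split => //=; rewrite in_itv.
      + split => /=; last exact: ballxx.
        rewrite /ball/= ger0_norm ?subr_ge0 ?ltW//.
        apply: lt_trans mr; rewrite -(tS i); lra.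
  have tel : (1 - s) ^+ 2 * f (1, y) - s ^+ 2 * f (0, y) = \sum_(i < m.+1) (F (t i.+1) - F (t i)).
    rewrite -(big_mkord xpredT (fun i => F (t i.+1) - F (t i))) telescope_sumr//.
    by rewrite /F /t divff ?gt_eqF// mul0r sub0r sqrrN.
  rewrite /E tel -sumrB (le_trans (ler_norm_sum _ _ _))//.
  apply: (@le_trans _ _ (\sum_(i < m.+1) e / m.+1%:R)); first exact: ler_sum.
  by rewrite sumr_const card_ord -[_ *+ _]mulr_natl mulrC divfK ?gt_eqF.
(* A violation at [x] would persist on a neighbourhood in [Omega], which contains interior
   points. *)
move=> Ox; rewrite leNgt; apply/negP => Ee.
have cE : {within Omega, continuous E}.
  have cf' (u : R) (g : T -> R) : 0 <= u <= 1 -> {within Q, continuous g} ->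
      {within Omega, continuous (fun y => g (u, y))}.
    move=> u01 cg; apply: (@within_continuous_precomp R _ _ Omega Q (at_time u) g cg).
      exact: continuous_at_time.
    by move=> v Ov; split => //=; rewrite in_itv.
  move=> y; apply: cvgB; first apply: cvgB.
  - by apply: cvgM; [exact: cvg_cst|apply: (cf' 1) => //; rewrite ler01 lexx].
  - by apply: cvgM; [exact: cvg_cst|apply: (cf' 0) => //; rewrite ler01 lexx].
  - apply: (@cvg_sumR R _ _ (nbhs (y : subspace Omega))) => i.
    apply: cvgM; first exact: cvg_cst.
    by apply: (cf' (t i)) => //; apply: t01; exact: ltnW.
have /subspace_continuousP/(_ x Ox) cEx := cE.
have nE : \forall y \near within Omega (nbhs x), e < `|E y|.
  exact: (@cvgr_gt _ _ _ _ _ _ (cvg_norm cEx) e Ee).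
have [y [Oy /(_ (interior_subset Oy)) Hy]] := interior_dense Ox nE.
by have := inner y Oy; rewrite leNgt Hy.
Unshelve. all: by end_near. Qed.

End riemann_sums.

Lemma mxdot_sumr {R : realType} m n (I : Type) (s : seq I) (A : 'M[R]_(m, n))
    (F : I -> 'M[R]_(m, n)) :
  mxdot A (\sum_(i <- s) F i) = \sum_(i <- s) mxdot A (F i).
Proof. by rewrite /mxdot mulmx_sumr linear_sum. Qed.

Lemma psd_mxZ {R : realType} n (c : R) (X : 'M[R]_n) : 0 <= c -> psd_mx X -> psd_mx (c *: X).
Proof.
move=> c0 [sX X0]; split; first by rewrite linearZ/= sX.
by move=> u; rewrite -scalemxAr -scalemxAl mxE mulr_ge0.
Qed.

Lemma psd_mx_sum {R : realType} n (I : finType) (F : I -> 'M[R]_n) :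
  (forall i, psd_mx (F i)) -> psd_mx (\sum_i F i).
Proof.
move=> HF; split; first by rewrite linear_sum; apply: eq_bigr => i _; exact: (HF i).1.
move=> u; rewrite quad_mxdot_outer mxdot_sumr; apply: sumr_ge0 => i _.
by rewrite -quad_mxdot_outer; exact: (HF i).2.
Qed.

(** * The discretised interpolation and its limit *)

Section competitor.
Context {R : realType} (n k d : nat).
Local Notation T := (R * 'rV[R]_d)%type.
Local Notation Xch := (Xcharge (borel T) (R := R) n k).
Variable Omega : set 'rV[R]_d.
Hypotheses (compO : compact Omega) (O0 : Omega !=set0) (smoothO : smooth_boundary Omega).

Let Q : set T := cylinder Omega.

Let closedO : closed Omega.
Proof. by apply: compact_closed compO; exact: (@norm_hausdorff R 'rV[R]_d). Qed.

Let mO : measurable (Omega : set (borel 'rV[R]_d)).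
Proof. exact: borel_closed. Qed.

Let compQ : compact Q. Proof. exact: cylinder_compact. Qed.

Let closedQ : closed Q.
Proof. by apply: compact_closed compQ; exact: (@norm_hausdorff R T). Qed.

Let mQ : measurable (Q : set (borel T)). Proof. exact: borel_closed. Qed.

Let bQ (f : T -> R) : {within Q, continuous f} -> bounded_measurable (Q : set (borel T)) f.
Proof. exact: within_continuous_bounded_measurable. Qed.

Lemma within_continuous_at_time (t : R) (f : T -> R) : 0 <= t <= 1 ->
  {within Q, continuous f} -> {within Omega, continuous (fun x => f (t, x))}.
Proof.
move=> t01 cf; apply: (@within_continuous_precomp R _ _ Omega Q (at_time t) f cf).
  exact: continuous_at_time.
by move=> y Oy; split => //=; rewrite in_itv.
Qed.

Let bO (t : R) (f : T -> R) : 0 <= t <= 1 -> {within Q, continuous f} ->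
  bounded_measurable (Omega : set (borel 'rV[R]_d)) (fun x => f (t, x)).
Proof.
move=> *; apply: within_continuous_bounded_measurable => //.
exact: within_continuous_at_time.
Qed.

Let t01 m (i : 'I_m.+1) : 0 <= (i%:R / m.+1%:R : R) <= 1.
Proof. by rewrite divr_ge0//= ler_pdivrMr// mul1r ler_nat ltnW. Qed.

(** The Riemann sums converge uniformly on [Omega], so they can be integrated against [nu]. The case
    [s = 0] leaves the value at time 1, and [s = 1] minus the value at time 0; they are used for
    [G1] and [G0]. *)
Lemma cvg_riemann_cintegral (nu : {charge set (borel 'rV[R]_d) -> \bar R})
    (f dtf : T -> R) (s : R) :
  {within Q, continuous f} -> {within Q, continuous dtf} ->
  (forall z, Q^° z -> is_derive z ((1, 0) : T) f (dtf z)) ->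
  \sum_(i < m.+1) m.+1%:R^-1 * ((i%:R / m.+1%:R - s) ^+ 2 *
      cintegral nu Omega (fun x => dtf (i%:R / m.+1%:R, x)) +
    2 * (i%:R / m.+1%:R - s) * cintegral nu Omega (fun x => f (i%:R / m.+1%:R, x)))
  @[m --> \oo] -->
  (1 - s) ^+ 2 * cintegral nu Omega (fun x => f (1, x)) -
    s ^+ 2 * cintegral nu Omega (fun x => f (0, x)).
Proof.
move=> cf cdf Hf.
have b0 : bounded_measurable (Omega : set (borel 'rV[R]_d)) (fun x => s ^+ 2 * f (0, x)).
  by apply: bounded_measurableZ; apply: bO => //; rewrite lexx ler01.
have b1 : bounded_measurable (Omega : set (borel 'rV[R]_d)) (fun x => (1 - s) ^+ 2 * f (1, x)).
  by apply: bounded_measurableZ; apply: bO => //; rewrite lexx ler01.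
pose g m (i : 'I_m.+1) x : R := (i%:R / m.+1%:R - s) ^+ 2 * dtf (i%:R / m.+1%:R, x) +
        2 * (i%:R / m.+1%:R - s) * f (i%:R / m.+1%:R, x).
have bg m (i : 'I_m.+1) : bounded_measurable (Omega : set (borel 'rV[R]_d)) (g m i).
  by apply: bounded_measurableD; apply: bounded_measurableZ; exact: bO.
have E m : \sum_(i < m.+1) m.+1%:R^-1 * ((i%:R / m.+1%:R - s) ^+ 2 *
      cintegral nu Omega (fun x => dtf (i%:R / m.+1%:R, x)) +
    2 * (i%:R / m.+1%:R - s) * cintegral nu Omega (fun x => f (i%:R / m.+1%:R, x))) =
    cintegral nu Omega (fun x => \sum_(i < m.+1) m.+1%:R^-1 * g m i x).
  rewrite cintegral_sum//; last by move=> i; exact: bounded_measurableZ.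
  apply: eq_bigr => i _; rewrite cintegralZ// cintegralD//;
    try (by apply: bounded_measurableZ; exact: bO).
  by rewrite !cintegralZ//; exact: bO.
under eq_cvg do rewrite E.
rewrite -!cintegralZ//; [|by apply: bO => //; rewrite lexx ler01..].
rewrite -cintegralB//.
set tv := fine (tvar nu Omega).
have tv0 : 0 <= tv by rewrite fine_ge0.
apply/cvgrPdist_le => e e0.
have e1 : 0 < e / (tv + 1) by rewrite divr_gt0// ltr_wpDl.
have := riemann_sum compO smoothO s cf cdf Hf e1.
apply: filterS => m Hm.
have bs : bounded_measurable (Omega : set (borel 'rV[R]_d))
    (fun x => \sum_(i < m.+1) m.+1%:R^-1 * g m i x).
  by apply: bounded_measurable_sum => i; exact: bounded_measurableZ.
rewrite -cintegralB//; last exact: bounded_measurableB b1 b0.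
have bd := bounded_measurableB (bounded_measurableB b1 b0) bs.
apply: le_trans; first exact: ler_norm_cintegral bd.
apply: (@le_trans _ _ (\int[tvar nu]_(x in Omega) (e / (tv + 1)))).
  apply: le_Rintegral => //; apply: bounded_measurable_integrable => //.
  - exact: bounded_measurable_norm.
  - exact: bounded_measurable_cst.
rewrite Rintegral_cst// -/tv -mulrAC ler_pdivrMr ?ltr_wpDl// ler_wpM2l ?ltW//.
by rewrite ltrDl.
Qed.

Variables (G0 G1 : mxcharge (borel 'rV[R]_d) (R := R) n n).
Hypotheses (G0_psd : in_MSplus G0 Omega) (G1_psd : in_MSplus G1 Omega).

Let G (c : bool) := if c then G1 else G0.

Let Gpsd c A : measurable A -> psd_mx (mxvalue (G c) A).
Proof. by case: c => /=; [exact: G1_psd.2|exact: G0_psd.2]. Qed.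

(** A node is a time step with a choice of endpoint. With [t] the time of the node, [sg] is [t] for
    [G1] and [t - 1] for [G0]; its square gives the weights in [G], its double those in [R]. *)
Let node m := ('I_m.+1 * bool)%type.
Let tau m (p : node m) : R := p.1%:R / m.+1%:R.
Let sg m (p : node m) : R := tau p - (~~ p.2)%:R.
Let slices m (w : node m -> R) a b : {charge set (borel T) -> \bar R} :=
  csum [seq (w p, slice (tau p) (G p.2 a b)) | p <- index_enum (node m)].

(* The time discretisation, by slices at [i / (m + 1)], of the competitor
   [((1 - t)^2 G0 + t^2 G1, 0, 2 (t - 1) G0 + 2 t G1)]. *)
Definition interpolation m : Xch := XCharge
  (fun a b => slices (fun p : node m => m.+1%:R^-1 * sg p ^+ 2) a b)
  (fun _ _ => @czero _ _ R)
  (fun a b => slices (fun p : node m => m.+1%:R^-1 * (2 * sg p)) a b).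

Let sg1 m (p : node m) : `|sg p| <= 1.
Proof.
rewrite /sg /tau ler_norml; move: (t01 p.1) => /andP[]; move: (_ / _) => u.
by case: p.2 => /= *; apply/andP; split; lra.
Qed.

Let gmat c (psi : 'rV[R]_d -> R) : 'M[R]_n := \matrix_(a, b) cintegral (G c a b) Omega psi.

Let gmat_psd c psi : bounded_measurable (Omega : set (borel 'rV[R]_d)) psi ->
  (forall x, Omega x -> 0 <= psi x) -> psd_mx (gmat c psi).
Proof. by move=> bpsi psi0; apply: psd_mxint_charge => // A; exact: Gpsd. Qed.

Let cintegral_slices m (w : node m -> R) a b f : {within Q, continuous f} ->
  cintegral (slices w a b) Q f =
  \sum_p w p * cintegral (G p.2 a b) Omega (fun x => f (tau p, x)).
Proof.
move=> cf; rewrite cintegral_csum//; last exact: bQ.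
by rewrite big_map; apply: eq_bigr => p _; rewrite cintegral_slice ?t01//; exact: bQ.
Qed.

Let mxint_slices m (w : node m -> R) f : {within Q, continuous f} ->
  mxint (slices w) Q f = \sum_p w p *: gmat p.2 (fun x => f (tau p, x)).
Proof.
move=> cf; apply/matrixP => a b; rewrite mxE cintegral_slices// summxE.
by apply: eq_bigr => p _; rewrite !mxE.
Qed.

Let K : R := \sum_c \sum_a \sum_b fine (tvar (G c a b) setT).

(** There are [2 (m + 1)] nodes of weight at most [2 / (m + 1)], so the values are at most [4 K],
    and [tvar_le_of_abs] doubles this. *)
Let tvar_slices m (w : node m -> R) a b : (forall p, `|w p| <= m.+1%:R^-1 * 2) ->
  fine (tvar (slices w a b) Q) <= 8 * K.
Proof.
move=> w2; apply: (@le_trans _ _ (2 * (4 * K))); last by lra.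
apply: tvar_le_of_abs => // A mA; rewrite fine_csum// big_map.
have K_ge c : fine (tvar (G c a b) setT) <= K.
  rewrite /K (bigD1 c)//= (bigD1 a)//= (bigD1 b)//= -!addrA lerDl.
  by rewrite !addr_ge0//; do ?[apply: sumr_ge0 => ? _]; rewrite fine_ge0.
have K0 : 0 <= K by do 3!apply: sumr_ge0 => ? _; rewrite fine_ge0.
rewrite (le_trans (ler_norm_sum _ _ _))//.
apply: (@le_trans _ _ (\sum_(p : node m) (m.+1%:R^-1 * 2 * K))).
  apply: ler_sum => p _; rewrite normrM ler_pM//=.
  apply: (@le_trans _ _ (fine (tvar (G p.2 a b) setT))); last exact: K_ge.
  rewrite sliceE; apply: abs_charge_le_tvar.
  by have := at_time_measurable (tau p) measurableT mA; rewrite setTI.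
rewrite sumr_const card_prod card_ord card_bool -[_ *+ _]mulr_natl natrM.
rewrite le_eqVlt; apply/orP; left; apply/eqP; field.
by rewrite gt_eqF// ltr_wpDr.
Qed.

(** The square of [s B - 2 M] for the form [g] is nonnegative. The resulting bound does not involve
    [s]. *)
Let Jdual_le (M B g : 'M[R]_n) (s : R) : psd_mx g ->
  Jdual M B (s ^+ 2 *: g) (2 * s *: g) <= 2 * mxdot (M *m M^T) g.
Proof.
move=> gpsd; have [sgm _] := gpsd.
have := psd_mxdot_ge0 (s *: B - 2 *: M) gpsd.
rewrite /Jdual !mxdotZr mulmxBr -!scalemxAr mxdotDl !mxdotDr !mxdotNr !mxdotNl !mxdotZl !mxdotZr.
rewrite -!mxdot_mulmxr.
have -> : mxdot M (g *m B) = mxdot B (g *m M).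
  by rewrite mxdot_mulmxl sgm mxdotC.
rewrite (mxdot_mulmxr M) -(mxdot_mulmxr M); nra.
Qed.

Lemma interpolation_psd_tested m : psd_tested (interpolation m) Q.
Proof.
move=> phi cphi phi01; have cphi' := @continuous_subspaceT _ _ Q _ cphi.
rewrite mxint_slices//; apply: psd_mx_sum => p; apply: psd_mxZ.
  by rewrite mulr_ge0// sqr_ge0.
apply: gmat_psd => [|x _]; first by apply: bO; rewrite ?t01.
by have /andP[] := phi01 (tau p, x).
Qed.

(** Once [Jdual_le] has removed the matrices [B i], what is left is linear and monotone in the test
    function. The [phi i] sum to at most 1, so the total is at most its value for the constant 1,
    whatever [m]. *)
Lemma interpolation_dual_bounded (M : 'M[R]_n) : exists C : R,
  forall m, dual_bounded (interpolation m) Q M C.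
Proof.
pose S c := mxdot (M *m M^T) (gmat c (fun=> 1)).
exists (2 * \sum_c S c) => m N B phi cphi phi0 phi1.
have cQ i := @continuous_subspaceT _ _ Q _ (cphi i).
have bphi (p : node m) i :
    bounded_measurable (Omega : set (borel 'rV[R]_d)) (fun x => phi i (tau p, x)).
  by apply: bO; rewrite ?t01.
pose g (p : node m) i := gmat p.2 (fun x => phi i (tau p, x)).
have JE i : Jdual M (B i) (mxint (XG (interpolation m)) Q (phi i))
    (mxint (XR (interpolation m)) Q (phi i)) =
    \sum_p m.+1%:R^-1 * Jdual M (B i) (sg p ^+ 2 *: g p i) (2 * sg p *: g p i).
  rewrite !mxint_slices// /Jdual !mxdot_sumr mulr_sumr -sumrB; apply: eq_bigr => p _.
  by rewrite -/(g p i) !mxdotZr; ring.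
apply: (@le_trans _ _ (\sum_i \sum_p m.+1%:R^-1 * (2 * mxdot (M *m M^T) (g p i)))).
  apply: ler_sum => i _; rewrite JE; apply: ler_sum => p _.
  rewrite ler_wpM2l//; apply: Jdual_le; apply: gmat_psd => // x _.
rewrite exchange_big/=.
apply: (@le_trans _ _ (\sum_(p : node m) m.+1%:R^-1 * (2 * S p.2))).
  apply: ler_sum => p _; rewrite -mulr_sumr ler_wpM2l// -mulr_sumr ler_wpM2l//.
  rewrite -mxdot_sumr -subr_ge0 /S -mxdotNr -mxdotDr -mxdot_mulmxr.
  set X := _ - _; suff psdX : psd_mx X by exact: psd_mxdot_ge0.
  have -> : X = gmat p.2 (fun x => 1 - \sum_i phi i (tau p, x)).
    apply/matrixP => a b; rewrite !mxE summxE cintegralB//.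
    - by rewrite cintegral_sum//; congr (_ - _); apply: eq_bigr => i _; rewrite mxE.
    - exact: bounded_measurable_cst.
    - exact: bounded_measurable_sum.
  apply: gmat_psd => [|x _]; last by rewrite subr_ge0.
  apply: bounded_measurableB; first exact: bounded_measurable_cst.
  exact: bounded_measurable_sum.
rewrite -(pair_big xpredT xpredT (fun (i : 'I_m.+1) c => m.+1%:R^-1 * (2 * S c)))/=.
by rewrite sumr_const card_ord -mulr_sumr -mulr_sumr -[_ *+ _]mulr_natl mulrA divff ?mul1r//.
Qed.

Variables (L0 : {linear 'M[R]_n -> 'M[R]_(n, k)})
  (L : 'I_d -> {linear 'M[R]_n -> 'M[R]_(n, k)}).

(** The sums over the nodes are Riemann sums of the time derivatives of [t^2 f] and [(t - 1)^2 f],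
    so the continuity equation holds asymptotically. *)
Let cvg_interpolation a b (f dtf : T -> R) :
  {within Q, continuous f} -> {within Q, continuous dtf} ->
  (forall z, Q^° z -> is_derive z ((1, 0) : T) f (dtf z)) ->
  cintegral (XG (interpolation m) a b) Q dtf + cintegral (XR (interpolation m) a b) Q f
  @[m --> \oo] -->
  cintegral (G1 a b) Omega (fun x => f (1, x)) - cintegral (G0 a b) Omega (fun x => f (0, x)).
Proof.
move=> cf cdf Hf.
have E m : cintegral (XG (interpolation m) a b) Q dtf + cintegral (XR (interpolation m) a b) Q f =
   \sum_c \sum_(i < m.+1) m.+1%:R^-1 * ((i%:R / m.+1%:R - (~~ c)%:R) ^+ 2 *
      cintegral (G c a b) Omega (fun x => dtf (i%:R / m.+1%:R, x)) +
    2 * (i%:R / m.+1%:R - (~~ c)%:R) * cintegral (G c a b) Omega (fun x => f (i%:R / m.+1%:R, x))).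
  rewrite !cintegral_slices// -big_split/= exchange_big pair_big/=.
  by apply: eq_bigr => p _; rewrite [RHS]mulrDr !mulrA.
under eq_cvg do rewrite E.
have -> : cintegral (G1 a b) Omega (fun x => f (1, x)) -
    cintegral (G0 a b) Omega (fun x => f (0, x)) =
    \sum_c ((1 - (~~ c)%:R) ^+ 2 * cintegral (G c a b) Omega (fun x => f (1, x)) -
    (~~ c)%:R ^+ 2 * cintegral (G c a b) Omega (fun x => f (0, x))).
  by rewrite big_bool/= subr0 subrr expr0n !expr1n !mul1r !mul0r subr0 sub0r.
by apply: cvg_sumR => c; exact: cvg_riemann_cintegral.
Qed.

Lemma is_derive_entry (V : normedModType R) m p (F : V -> 'M[R]_(m, p)) z v A a b :
  is_derive z v F A -> is_derive z v (fun y => F y a b) (A a b).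
Proof.
move=> [dF FE]; have cv : (fun h : R => h^-1 *: ((fun y => F y a b) (h *: v + z) - F z a b))
    @ 0^' --> A a b.
  have cA : (fun h : R => h^-1 *: ((F \o shift z) (h *: v) - F z)) @ 0^' --> A.
    by rewrite -FE; exact: dF.
  apply: cvg_trans (cvg_comp _ _ cA (@coord_continuous R m p a b A)).
  by apply: near_eq_cvg; near=> h; rewrite /= !mxE.
by apply: DeriveDef; [apply/cvg_ex; exists (A a b)|exact: cvg_lim cv].
Unshelve. all: by end_near. Qed.

(** The bounds on the discretisations are uniform in [m], so [weak_limit] applies to them directly;
    the continuity equation is checked for the limit only. *)
Lemma finite_competitor (L2 : 'M[R]_n) : pd_mx L2 ->
  exists (C : R) (mu : Xch), CE L0 L Omega G0 G1 mu /\ (action 0 L2 mu Q <= C%:E)%E.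
Proof.
move=> pdL2; have [C HC] := interpolation_dual_bounded (invmx L2); exists C.
have w0 m : 0 <= (m.+1%:R^-1 : R) by rewrite invr_ge0.
have sgle m (p : node m) : `|sg p| <= 2 by rewrite (le_trans (sg1 p))// ler1n.
have [|||phi [mu [phi_lt inQ cmu act]]] :=
    @weak_limit R d n k Q compQ (cylinder_nonempty O0) interpolation L2 (8 * K) C pdL2 _ _ _ HC
      interpolation_psd_tested.
- move=> m a b; apply: tvar_slices => p.
  have sg2 : `|sg p| ^+ 2 <= 1 by rewrite exprn_ile1.
  by rewrite normrM ger0_norm// ler_wpM2l// normrX (le_trans sg2)// ler1n.
- move=> m a b; apply: tvar_slices => p.
  rewrite normrM ger0_norm// ler_wpM2l// normrM ger0_norm//.
  by rewrite -[leRHS]mulr1 ler_wpM2l.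
- by move=> a b f _; under eq_cvg do rewrite cintegral_czero; exact: cvg_cst.
have cphi := cvg_homo_infty phi_lt.
exists mu; split => //; split => // Phi dtPhi dxPhi HPhi.
have [_ cPhi cdt cdx dPhi] := HPhi; have [cG cq cR] := cmu.
(* Every discretisation has [q = 0], so this integral is a limit of zeros. *)
have -> : mxintegral (Xq mu) Q (Dstar L0 L Phi dxPhi) = 0.
  apply: big1 => a _; apply: big1 => b _.
  have cD : {within Q, continuous (fun z => Dstar L0 L Phi dxPhi z a b)}.
    exact: within_continuous_Dstar HPhi.
  have := cq a b _ cD.
  under eq_cvg do rewrite /= cintegral_czero.
  by move=> /cvg_lim <- //; rewrite lim_cst.
have cv : mxintegral (XG (interpolation (phi m))) Q dtPhi +
   mxintegral (XR (interpolation (phi m))) Q Phi @[m --> \oo] -->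
   mxintegral (XG mu) Q dtPhi + mxintegral (XR mu) Q Phi.
  by apply: cvgD; apply: cvg_mxintegral => // a b; exact: within_continuous_entry.
rewrite addr0 -(cvg_lim _ cv)//; apply/cvg_lim => //.
pose S m := \sum_a \sum_b (cintegral (XG (interpolation m) a b) Q (fun z => dtPhi z a b) +
  cintegral (XR (interpolation m) a b) Q (fun z => Phi z a b)).
have -> : (fun m => mxintegral (XG (interpolation (phi m))) Q dtPhi +
   mxintegral (XR (interpolation (phi m))) Q Phi) = S \o phi.
  apply/funext => m; rewrite /S /mxintegral /= -big_split; apply: eq_bigr => a _.
  by rewrite -big_split.
apply: (cvg_comp _ _ cphi).
rewrite /mxintegral -sumrB; apply: cvg_sumR => a; rewrite -sumrB; apply: cvg_sumR => b.
apply: cvg_interpolation; try exact: within_continuous_entry.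
by move=> z Qz; apply: is_derive_entry; exact: (dPhi z Qz).1.
Qed.

End competitor.

(** * Convergence of the values and of the minimizers *)

Section values.
Context {R : realType} (n k d : nat).
Local Notation T := (R * 'rV[R]_d)%type.
Local Notation Xch := (Xcharge (borel T) (R := R) n k).
Variables (L0 : {linear 'M[R]_n -> 'M[R]_(n, k)})
  (L : 'I_d -> {linear 'M[R]_n -> 'M[R]_(n, k)}) (Omega : set 'rV[R]_d)
  (G0 G1 : mxcharge (borel 'rV[R]_d) (R := R) n n) (L2 : 'M[R]_n).

Lemma action_ge0 (L1 : 'M[R]_k) (mu : Xch) Q : (0 <= action L1 L2 mu Q)%E.
Proof. by apply: integral_ge0 => x _; exact: J_density_ge0. Qed.

Lemma action_le0 (L1 : 'M[R]_k) (mu : Xch) Q : (action L1 L2 mu Q <= action 0 L2 mu Q)%E.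
Proof.
by apply: ge0_le_lower_integral => x _; [exact: J_density_ge0|exact: J_density_le_J0].
Qed.

Lemma WB2_ge0 (L1 : 'M[R]_k) : (0 <= WB2 L0 L Omega G0 G1 L1 L2)%E.
Proof. by apply: le_ereal_inf_tmp => _ [mu _ <-]; exact: action_ge0. Qed.

Lemma WB2_le_action (L1 : 'M[R]_k) mu : CE L0 L Omega G0 G1 mu ->
  (WB2 L0 L Omega G0 G1 L1 L2 <= action L1 L2 mu (cylinder Omega))%E.
Proof. by move=> HCE; apply: ereal_inf_lbound; exists mu. Qed.

Lemma WB2_le0 (L1 : 'M[R]_k) :
  (WB2 L0 L Omega G0 G1 L1 L2 <= WB2 L0 L Omega G0 G1 0 L2)%E.
Proof.
apply: le_ereal_inf_tmp => _ [mu HCE <-].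
exact: le_trans (WB2_le_action L1 HCE) (action_le0 _ _ _).
Qed.

End values.

Theorem proposition4p6 (R : realType) (n k d : nat)
  (n_gt0 : (0 < n)%N) (k_gt0 : (0 < k)%N) (d_gt0 : (0 < d)%N)
  (Omega : set 'rV[R]_d) (Omega_compact : compact Omega)
  (Omega_int : Omega^° !=set0) (Omega_smooth : smooth_boundary Omega)
  (L0 : {linear 'M[R]_n -> 'M[R]_(n, k)})
  (L : 'I_d -> {linear 'M[R]_n -> 'M[R]_(n, k)})
  (L0_id : L0 1%:M = 0)
  (G0 G1 : mxcharge (borel 'rV[R]_d) (R := R) n n)
  (G0_psd : in_MSplus G0 Omega) (G1_psd : in_MSplus G1 Omega)
  (L2 : 'M[R]_n) (L2_pd : pd_mx L2) :
  WB2 L0 L Omega G0 G1 L1 L2 @[L1 --> psd_to0 k] -->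
    WB2 L0 L Omega G0 G1 0 L2 /\
  forall (L1_ : nat -> 'M[R]_k)
    (mu_ : nat -> Xcharge (borel (R * 'rV[R]_d)%type) (R := R) n k),
    (forall j, psd_mx (L1_ j)) ->
    frobenius (L1_ j) @[j --> \oo] --> (0 : R) ->
    (forall j, WB2_minimizer L0 L Omega G0 G1 (L1_ j) L2 (mu_ j)) ->
    exists (phi : nat -> nat)
      (mu : Xcharge (borel (R * 'rV[R]_d)%type) (R := R) n k),
      [/\ {homo phi : i j / (i < j)%N},
          WB2_minimizer L0 L Omega G0 G1 0 L2 mu &
          weak_star_cvg (cylinder Omega) (mu_ \o phi) mu].
Proof.
have O0 : Omega !=set0 by case: Omega_int => x /interior_subset Ox; exists x.
have [C [mu0 [CE0 act0]]] :=
  finite_competitor Omega_compact O0 Omega_smooth G0_psd G1_psd L0 L L2_pd.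
have [r rE] : exists r : R, WB2 L0 L Omega G0 G1 0 L2 = r%:E.
  exists (fine (WB2 L0 L Omega G0 G1 0 L2)); rewrite fineK// ge0_fin_numE ?WB2_ge0//.
  by apply: le_lt_trans (ltry C); exact: le_trans (WB2_le_action _ _ CE0) act0.
split.
  rewrite rE => U [e /= e0 HU].
  (* The upper bound is [WB2_le0]; only the lower one is left. *)
  suff [dl dl0 Hdl] : exists2 dl : R, 0 < dl & forall L1 : 'M[R]_k, psd_mx L1 ->
      frobenius L1 < dl -> ((r - e)%:E < WB2 L0 L Omega G0 G1 L1 L2)%E.
    exists dl => // L1 [psdL1 frL1] /=.
    have := Hdl L1 psdL1 frL1; have := WB2_le0 L0 L Omega G0 G1 L2 L1; rewrite rE.
    case: (WB2 _ _ _ _ _ L1 _) => // v; rewrite lee_fin lte_fin => vr rv.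
    by apply: HU => /=; rewrite ger0_norm ?subr_ge0//; lra.
  apply: contrapT => noL1.
  have bad j : exists L1 : 'M[R]_k, [/\ psd_mx L1, frobenius L1 < j.+1%:R^-1 &
      (WB2 L0 L Omega G0 G1 L1 L2 <= (r - e)%:E)%E].
    apply: contrapT => H; apply: noL1; exists j.+1%:R^-1; first by rewrite invr_gt0.
    by move=> L1 psdL1 frL1; rewrite ltNge; apply/negP => le; apply: H; exists L1.
  have [L1_ HL1] := choice bad.
  (* Near minimizers suffice here, at the price of half of the gap [e]. *)
  have near_inf j : exists mu : Xcharge (borel (R * 'rV[R]_d)%type) (R := R) n k,
      CE L0 L Omega G0 G1 mu /\ (action (L1_ j) L2 mu (cylinder Omega) <= (r - e / 2)%:E)%E.
    have [_ _ le] := HL1 j.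
    have : (WB2 L0 L Omega G0 G1 (L1_ j) L2 < (r - e / 2)%:E)%E.
      by apply: le_lt_trans le _; rewrite lte_fin; lra.
    by move=> /ereal_inf_lt[_ [mu HCE <-]] /ltW ?; exists mu.
  have [mu_ Hmu] := choice near_inf.
  have [||||phi [mu [_ HCE _ act]]] := @CE_compactness R n k d Omega Omega_compact O0 L0 L G0 G1
      L0_id n_gt0 L2 L1_ mu_ (r - e / 2) L2_pd.
  - by move=> j; have [] := HL1 j.
  - apply: (@squeeze_cvgr _ _ _ _ (fun=> 0) (fun j => j.+1%:R^-1)).
    + by apply: nearW => j; have [_ /ltW -> _] := HL1 j; rewrite sqrtr_ge0.
    + exact: cvg_cst.
    + exact: cvg_harmonic.
  - by move=> j; exact: (Hmu j).1.
  - by move=> j; exact: (Hmu j).2.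
  (* The limit would have an action for [0] below the infimum [r]. *)
  have := le_trans (WB2_le_action L2 0 HCE) act.
  by rewrite rE lee_fin; lra.
move=> L1_ mu_ psdL cL Hmin.
have [|phi [mu [phi_lt HCE wcv act]]] := @CE_compactness R n k d Omega Omega_compact O0 L0 L G0 G1
    L0_id n_gt0 L2 L1_ mu_ r L2_pd psdL cL (fun j => (Hmin j).1).
  (* The minimizers have action at most [r], so the limit has action at most [r] as well, which
     makes it optimal. *)
  by move=> j; rewrite (Hmin j).2 -rE; exact: WB2_le0.
exists phi, mu; split => //; split => //.
by apply/eqP; rewrite eq_le WB2_le_action// rE act.
Qed.
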